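(* Let $L = \mathcal{J}(P)$ be a finite non-decomposable distributive lattice with $|P| \geq 2$, and let \[ 0_L = \xi_0 < \xi_1 < \cdots < \xi_s = 1_L \] be all the apexes of $L$. Let $L_i = [\xi_{i-1}, \xi_i] = \{a \in L : \xi_{i-1} \leq a \leq \xi_i\}$ for $1 \leq i \leq s$. Then $L$ is of König type if and only if the following two conditions are satisfied: (1) each $L_i$ is quasi-thin with $\theta(L_i) \leq 2$; (2) if $\theta(L_i) = 2$ and $\theta(L_{i'}) = 2$ with $1 \leq i < i' \leq s$, then there is $j$ with $i < j < i'$ and $\theta(L_j) = 0$.
   Context: For a finite poset $P$, $\mathcal{J}(P)$ is the finite distributive lattice of poset ideals (down-closed subsets) of $P$, ordered by inclusion; every finite distributive lattice $L$ is of this form, with $P$ the subposet of join-irreducible elements of $L$. Put $d = |P|$; every maximal chain of $L$ has length $d$ (that is, $d+1$ elements). The rank $\mathrm{rank}_L(a)$ of $a \in L$ is the maximal length of chains of $L$ with top element $a$, and $\rho_L(i)$ is the number of $a \in L$ of rank $i$, $0 \leq i \leq d$. $0_L$ and $1_L$ are the minimum and maximum of $L$. An apex of $L$ is an element $\xi \in L$ which is comparable with every element of $L$ (equivalently $\rho_L(\mathrm{rank}_L(\xi)) = 1$). $L \neq \{0_L,1_L\}$ is simple if its only apexes are $0_L$ and $1_L$. $L$ is decomposable if $L = L' \oplus L''$ (ordinal sum: the disjoint union in which every element of $L'$ is smaller than every element of $L''$) with $L', L''$ distributive lattices; otherwise $L$ is non-decomposable. Equivalently, $L$ is non-decomposable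 if and only if $\mathrm{rank}_L(\xi') - \mathrm{rank}_L(\xi) \geq 2$ for all apexes $\xi < \xi'$ of $L$. In the situation of the claim each interval $L_i$ is a simple finite distributive lattice. A finite simple distributive lattice $L = \mathcal{J}(P)$ with $|P| = d$ is quasi-thin if $\rho_L(i) \leq 3$ for each $1 \leq i < d$; in this case $\theta(L) = |\{ i : \rho_L(i) = 3\}|$. Let $K$ be a field and $S = K[\{x_a\}_{a \in L}]$ the polynomial ring in $|L|$ variables. For incomparable $a, b \in L$ put $f_{a,b} = x_a x_b - x_{a \wedge b} x_{a \vee b}$. The join-meet ideal $I_L \subset S$ is generated by all $f_{a,b}$ with $a,b \in L$ incomparable (these form a minimal system of homogeneous generators of $I_L$); its height is $h = |L| - (d+1)$. $L$ is of König type if there exist a sequence $f_{a_1,b_1}, \ldots, f_{a_h,b_h}$ of $h = |L| - (d+1)$ such binomials and a monomial order $<$ on $S$ for which $\mathrm{in}_<(f_{a_1,b_1}), \ldots, \mathrm{in}_<(f_{a_h,b_h})$ is a regular sequence. *)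

(* Defs.v *)
From HB Require Import structures.
From mathcomp Require Import all_boot all_order all_algebra.
From mathcomp Require Import mpoly.

Set Implicit Arguments.
Unset Strict Implicit.
Unset Printing Implicit Defensive.

Import Order.TTheory Order.DefaultSetSubsetOrder GRing.Theory.

Local Open Scope order_scope.

Definition poset_ideal (disp : Order.disp_t) (P : finPOrderType disp) :
  {pred {set P}} :=
  fun I => [forall x in I, forall y, (y <= x) ==> (y \in I)].

Fact J_display : Order.disp_t. Proof. exact: Order.Disp tt tt. Qed.

Record J (disp : Order.disp_t) (P : finPOrderType disp) := MkJ {
  J_val :> {set P};
  J_valP : J_val \in @poset_ideal disp P
}.

HB.instance Definition _ (disp : Order.disp_t) (P : finPOrderType disp) :=
  [isSub for @J_val disp P].
HB.instance Definition _ (disp : Order.disp_t) (P : finPOrderType disp) :=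
  [Finite of J P by <:].

Lemma poset_idealP (disp : Order.disp_t) (P : finPOrderType disp)
    (I : {set P}) :
  reflect (forall x y, x \in I -> y <= x -> y \in I) (I \in @poset_ideal disp P).
Proof.
apply: (iffP 'forall_in_'forall_implyP) => H x; first by move=> y /H; apply.
by move=> xI y; apply: H.
Qed.

Fact poset_ideal_meet (disp : Order.disp_t) (P : finPOrderType disp) :
  meet_closed (@poset_ideal disp P).
Proof.
move=> A B /poset_idealP hA /poset_idealP hB; apply/poset_idealP => x y.
by rewrite Order.SetSubsetOrder.meetEsubset !inE => /andP[/hA xA /hB xB] yx; rewrite xA ?xB.
Qed.

Fact poset_ideal_join (disp : Order.disp_t) (P : finPOrderType disp) :
  join_closed (@poset_ideal disp P).
Proof.
move=> A B /poset_idealP hA /poset_idealP hB; apply/poset_idealP => x y.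
by rewrite Order.SetSubsetOrder.joinEsubset !inE => /orP[/hA|/hB] h /h ->; rewrite ?orbT.
Qed.

Fact poset_ideal_bot (disp : Order.disp_t) (P : finPOrderType disp) :
  \bot \in @poset_ideal disp P.
Proof. by apply/poset_idealP => x y; rewrite Order.SetSubsetOrder.botEsubset inE. Qed.

Fact poset_ideal_top (disp : Order.disp_t) (P : finPOrderType disp) :
  \top \in @poset_ideal disp P.
Proof. by apply/poset_idealP => x y; rewrite Order.SetSubsetOrder.topEsubset !inE. Qed.

HB.instance Definition _ (disp : Order.disp_t) (P : finPOrderType disp) :=
  Order.isTBLatticeClosed.Build _ _ (@poset_ideal disp P)
    (@poset_ideal_meet disp P) (@poset_ideal_join disp P)
    (@poset_ideal_bot disp P) (@poset_ideal_top disp P).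

HB.instance Definition _ (disp : Order.disp_t) (P : finPOrderType disp) :=
  [SubChoice_isTBSubLattice of J P by <: with J_display].

Fact J_meetUl (disp : Order.disp_t) (P : finPOrderType disp) :
  @left_distributive (J P) (J P) Order.meet Order.join.
Proof.
by move=> A B C; apply: val_inj; exact: meetUl.
Qed.

HB.instance Definition _ (disp : Order.disp_t) (P : finPOrderType disp) :=
  Order.Lattice_Meet_isDistrLattice.Build _ (J P) (@J_meetUl disp P).


Section Sublattices.

Context {disp : Order.disp_t} {L : finTBDistrLatticeType disp}.
Implicit Types (A B C : {set L}) (a b x y z : L).

(* The notions below are relative to a set [A] of elements of [L], carrying the
   induced order, so that they apply both to [L] itself, as [[set: L]], and to
   its intervals. [A] is meant to be nonempty and closed under meet and join:
   it is then a distributive lattice with the operations of [L]. *)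
Definition sublattice A : Prop := [/\ A != set0, meet_closed A & join_closed A].

Definition itv x y : {set L} := [set a | x <= a <= y].

Definition bot_in A : L := \meet_(a in A) a.
Definition top_in A : L := \join_(a in A) a.

Definition join_irreducible A x : bool :=
  [&& x \in A, x != bot_in A &
      [forall y in A, forall z in A,
         (x == y `|` z) ==> ((x == y) || (x == z))]].

(* |P| when A is isomorphic to J(P). *)
Definition dim A : nat := #|[set x in A | join_irreducible A x]|.

Definition chain C : bool := [forall a in C, forall b in C, a >=< b].

Definition chain_with_top A a C : bool :=
  [&& C \subset A, chain C, a \in C & [forall c in C, c <= a]].

(* A chain with n elements has length n - 1. *)
Definition rank A a : nat :=
  (\max_(C : {set L} | chain_with_top A a C) #|C|.-1)%N.

Definition rho A (i : nat) : nat := #|[set a in A | rank A a == i]|.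

Definition apex A x : bool := (x \in A) && [forall a in A, x >=< a].

Definition simple A : Prop :=
  A <> [set bot_in A; top_in A] /\
  (forall x, apex A x <-> x = bot_in A \/ x = top_in A).

Definition quasi_thin A : Prop :=
  simple A /\ (forall i : nat, (1 <= i < dim A)%N -> (rho A i <= 3)%N).

Definition theta A : nat := #|[set i : 'I_(dim A).+1 | rho A i == 3%N]|.

End Sublattices.

(* When [L] is the ordinal sum of [A] and [B], these are lattices for the
   induced order exactly when they are sublattices of [L]. *)
Definition ordinal_sum (disp : Order.disp_t) (L : finTBDistrLatticeType disp)
    (A B : {set L}) : Prop :=
  [/\ A :|: B = [set: L], [disjoint A & B] & {in A & B, forall a b, a < b}].

Definition decomposable (disp : Order.disp_t)
    (L : finTBDistrLatticeType disp) : Prop :=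
  exists A B : {set L}, [/\ sublattice A, sublattice B & ordinal_sum A B].

Local Open Scope ring_scope.

Definition ideal_gen (R : comNzRingType) (s : seq R) (p : R) : Prop :=
  exists c : 'I_(size s) -> R, p = \sum_(i < size s) c i * s`_i.

Definition regular_sequence (R : comNzRingType) (s : seq R) : Prop :=
  (forall i, (i < size s)%N -> forall p : R,
     ideal_gen (take i s) (s`_i * p) -> ideal_gen (take i s) p) /\
  ~ ideal_gen s 1.

(* Non-strict orders, which are well-orders by Dickson's lemma. *)
Definition monomial_order (n : nat) (le : rel 'X_{1..n}) : Prop :=
  [/\ [/\ reflexive le, antisymmetric le, transitive le & total le],
      (forall m, le 0%MM m) &
      (forall m m1 m2, le m1 m2 -> le (m1 + m)%MM (m2 + m)%MM)].

(* The largest monomial of the support of [p], or 1 if [p = 0]; this is [mlead]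
   with an arbitrary monomial order in place of that of the library. *)
Definition init_monom (K : fieldType) (n : nat) (le : rel 'X_{1..n})
    (p : {mpoly K[n]}) : 'X_{1..n} :=
  \big[(fun m1 m2 => if le m1 m2 then m2 else m1)/0%MM]_(m <- msupp p) m.

Definition init (K : fieldType) (n : nat) (le : rel 'X_{1..n})
    (p : {mpoly K[n]}) : {mpoly K[n]} := 'X_[init_monom le p].

Section JoinMeet.

Context (K : fieldType) {disp : Order.disp_t} (L : finTBDistrLatticeType disp).

Definition xvar (a : L) : {mpoly K[#|L|]} := 'X_(enum_rank a).

Definition join_meet_binom (a b : L) : {mpoly K[#|L|]} :=
  xvar a * xvar b - xvar (a `&` b)%O * xvar (a `|` b)%O.

Definition konig_type : Prop :=
  exists (s : seq (L * L)) (le : rel 'X_{1..#|L|}),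
    [/\ size s = (#|L| - (dim [set: L]).+1)%N,
        (forall a b, (a, b) \in s -> (a >< b)%O),
        monomial_order le &
        regular_sequence [seq init le (join_meet_binom ab.1 ab.2) | ab <- s]].

End JoinMeet.

(* Main.v *)
Require Import Defs.
From mathcomp Require Import all_boot all_order all_algebra.
From mathcomp Require Import mpoly.
From mathcomp Require Import zify ring.

(** The initial monomial of f_{a,b} is x_a x_b or x_{a/\b} x_{a\/b}, and quadratic
    monomials form a regular sequence iff they are pairwise coprime. So L is of
    König type iff there are |L| - (d+1) binomials with pairwise disjoint initial
    monomials, for some monomial order. Write such a binomial as x_p x_v - x_a x_b
    with initial monomial x_p x_v.

    Necessity. Disjointness makes the vectors e_p + e_v - e_a - e_b linearly
    independent (in a vanishing integral combination, the products of the initial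
    monomials would be both larger than and equal to those of the other ones).
    They are orthogonal to the modular functions on L, which separate the
    functions supported on a maximal chain; hence at most |I| - (D+1) of the
    binomials live in an interval I of rank D. Every binomial lives on one side of
    each apex, so that, by counting, this bound is attained when I joins two
    apexes, and then 2(|I| - D - 1) <= |I|, i.e. |I| <= 2D + 2. Applied to all
    the pairs of apexes, this inequality gives (1) and (2); in particular a level
    with at least four elements would have neighbours with at most two, which is
    impossible.

    Sufficiency. If p never occurs among the a, b of the previous binomials, then
    weights increasing quickly along the sequence of the p give a monomial order
    for which each x_p x_v is initial. Such a sequence is built in each block of
    the ordinal sum: a block with theta = 1 can leave unused either of its two
    apexes, one with theta = 0 leaves both, one with theta = 2 uses both, and by
    (2) the blocks can be glued without using an apex twice. *)

Set Implicit Arguments.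
Unset Strict Implicit.
Unset Printing Implicit Defensive.

Import Order.TTheory GRing.Theory.

Local Open Scope order_scope.

(** * Graded distributive lattices *)

Section Graded.

Context {disp : Order.disp_t} {L : finTBDistrLatticeType disp}.
Implicit Types (rk : L -> nat) (a b c x y z : L).

(** Counting leaves no freedom. Let a block of rank D have inner levels of two or three elements. It
    has 2(D - 1) + theta inner elements, and its D - 1 + theta binomials need 2(D - 1) + 2 theta
    variables, so their initial monomials must use every inner element and exactly theta of the two
    apexes. Each certificate is therefore a perfect matching, and the difficulty is to find one
    whose pivots can be ordered.

    An apex followed by two-element levels is an odd number of elements. Such a run is therefore
    matched up to one free element, whose partner is an element beyond the next level: the join of
    that level when the run comes from below, its meet when the run comes from above.

    When the two three-element levels are separated, the constructions from the two apexes glue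
    across the levels in between. When they are adjacent, these constructions interfere, and the
    shape of the two levels matters: either two elements lie over different elements of the level
    below (split shape), or three elements cover a common one and generate a Boolean cube. The
    position of the meet of the level above then decides the matching. *)

Definition graded rk : Prop :=
  [/\ forall a b, a < b -> (rk a < rk b)%N,
      forall a b, (rk (a `&` b) + rk (a `|` b) = rk a + rk b)%N,
      forall a b, a < b -> exists2 c, a < c <= b & rk c = (rk a).+1 &
      forall a b, a < b -> exists2 c, a <= c < b & rk b = (rk c).+1].

Definition lev rk (k : nat) : {set L} := [set a | rk a == k].

Definition pair_lev rk k a b : Prop :=
  [/\ a != b, rk a = k, rk b = k & forall x, rk x = k -> x = a \/ x = b].

Definition triple_lev rk k a b c : Prop :=
  [/\ [/\ a != b, a != c & b != c], [/\ rk a = k, rk b = k & rk c = k] &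
      forall x, rk x = k -> [\/ x = a, x = b | x = c]].

Context (rk : L -> nat) (gr : graded rk).

Lemma rk_lt a b : a < b -> (rk a < rk b)%N.
Proof. by case: gr => + _ _ _; apply. Qed.

Lemma rk_modular a b : (rk (a `&` b) + rk (a `|` b) = rk a + rk b)%N.
Proof. by case: gr => _ + _ _; apply. Qed.

Lemma rk_le a b : a <= b -> (rk a <= rk b)%N.
Proof. by rewrite le_eqVlt => /orP[/eqP-> //|/rk_lt/ltnW]. Qed.

Lemma eq_rk a b : a <= b -> (rk b <= rk a)%N -> a = b.
Proof. by rewrite le_eqVlt => /orP[/eqP //|/rk_lt]; case: ltngtP. Qed.

Lemma incomp a b w :
  a `&` b = w -> (rk w < rk a)%N -> (rk w < rk b)%N -> a >< b.
Proof.
move=> <- ha hb; apply/negP => /orP[/meet_l|/meet_r] e; move: ha hb;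
  by rewrite e ltnn.
Qed.

Lemma rk_incomp a b : a != b -> rk a = rk b -> (rk (a `&` b) < rk a)%N.
Proof.
move=> ab e; apply: rk_lt; rewrite lt_neqAle leIl andbT.
apply: contra ab => /eqP h; apply/eqP/eq_rk; last by rewrite e.
by rewrite -h leIr.
Qed.

Lemma meet_cover k a b c :
  a != b -> rk a = k.+1 -> rk b = k.+1 -> rk c = k -> c <= a -> c <= b ->
  a `&` b = c.
Proof.
move=> ab ra rb rc ca cb; apply/esym/eq_rk; first by rewrite lexI ca.
have := rk_incomp ab; rewrite ra rb; lia.
Qed.

Lemma join_cover k a b c :
  a != b -> rk a = k -> rk b = k -> rk c = k.+1 -> a <= c -> b <= c ->
  a `|` b = c.
Proof.
move=> ab ra rb rc ca cb; apply/eq_rk; first by rewrite leUx ca.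
have := rk_incomp ab; have := rk_modular a b; rewrite ra rb; lia.
Qed.

Lemma rk_join_cover k a b c :
  a != b -> rk a = k.+1 -> rk b = k.+1 -> rk c = k -> c <= a -> c <= b ->
  rk (a `|` b) = k.+2.
Proof.
move=> ab ra rb rc ca cb; have := rk_modular a b.
rewrite (meet_cover ab ra rb rc ca cb); lia.
Qed.

Lemma rk_meet_cover k a b c :
  a != b -> rk a = k -> rk b = k -> rk c = k.+1 -> a <= c -> b <= c ->
  (rk (a `&` b)).+1 = k.
Proof.
move=> ab ra rb rc ca cb; have := rk_modular a b.
rewrite (join_cover ab ra rb rc ca cb); lia.
Qed.

(** If the joins agree, meeting with b gives b = (a /\ b) \/ (b /\ c) = b /\ c by distributivity, as
    a /\ b = m lies below b /\ c. So three upper covers of one element have three different pairwise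
    joins. *)
Lemma join_cancel k a b c m :
  rk a = k.+1 -> rk b = k.+1 -> rk c = k.+1 -> rk m = k ->
  m <= a -> m <= b -> m <= c -> a != b -> a != c -> b != c ->
  a `|` b != a `|` c.
Proof.
move=> ra rb rc rm ma mb mc ab ac bc; apply: contra bc => /eqP e.
have : b = b `&` (a `|` c) by rewrite -e joinC joinKI.
rewrite meetUr [b `&` a]meetC (meet_cover ab ra rb rm ma mb).
have /join_r -> : m <= b `&` c by rewrite lexI mb.
by move=> h; apply/eqP/eq_rk; [rewrite h leIr|rewrite rc rb].
Qed.

Lemma meet_cancel k a b c m :
  rk a = k -> rk b = k -> rk c = k -> rk m = k.+1 ->
  a <= m -> b <= m -> c <= m -> a != b -> a != c -> b != c ->
  a `&` b != a `&` c.
Proof.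
move=> ra rb rc rm ma mb mc ab ac bc; apply: contra bc => /eqP e.
have : b = b `|` (a `&` c) by rewrite -e meetC meetKU.
rewrite joinIr [b `|` a]joinC (join_cover ab ra rb rm ma mb).
have /meet_r -> : b `|` c <= m by rewrite leUx mb.
by move=> h; rewrite eq_sym; apply/eqP/eq_rk; [rewrite h leUr|rewrite rc rb].
Qed.

(** Between a /\ b and a \/ b choose i covered by a and j covering a; c is the complement of a in
    [i, j]. In a two-element level c has to be b, which places the meet and the join of the level in
    the adjacent levels. *)
Lemma exchange a b : a != b -> rk a = rk b ->
  exists c, [/\ c != a, rk c = rk a, (rk (a `&` c)).+1 = rk a
                & rk (a `|` c) = (rk a).+1].
Proof.
move=> ab e; have [_ _ up down] := gr.
have [i /andP[/= lei lti] ri] : exists2 i, a `&` b <= i < a & rk a = (rk i).+1.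
  by apply: down; rewrite lt_neqAle leIl andbT; apply: contraTneq (rk_incomp ab e)
    => ->; rewrite ltnn.
have [j /andP[ltj lej] rj] : exists2 j, a < j <= a `|` b & rk j = (rk a).+1.
  apply: up; rewrite lt_neqAle leUl andbT; apply: contraNneq ab => h.
  by apply/eqP/esym/eq_rk; rewrite ?e // h leUr.
have ej : j = a `|` (j `&` b).
  by rewrite joinIr (join_r (ltW ltj)) (meet_l lej).
pose c := i `|` (j `&` b).
have cj : c <= j by rewrite leUx leIl (le_trans (ltW lti) (ltW ltj)).
have nca : ~~ (c <= a).
  rewrite leUx (ltW lti) /=; apply/negP => /join_l h.
  by move: ltj; rewrite {1}ej h ltxx.
have nac : ~~ (a <= c).
  apply/negP => /meet_l; rewrite /c meetUr (meet_r (ltW lti)) => h.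
  have h2 : i `|` (a `&` (j `&` b)) = i.
    by apply/join_l/(le_trans _ lei); rewrite leI2 // leIr.
  by move: lti; rewrite -[X in _ < X]h h2 ltxx.
have rc : rk c = rk a.
  have ic : i < c.
    rewrite lt_neqAle leUl andbT; apply: contraNneq nca => <-; exact: ltW.
  have cj' : c < j.
    rewrite lt_neqAle cj andbT; apply: contraNneq nac => ->; exact: ltW.
  move: (rk_lt ic) (rk_lt cj'); lia.
exists c; have ca : a != c by apply: contraNneq nac => <-.
split=> //; first by rewrite eq_sym.
- by apply: (@rk_meet_cover _ _ _ j) => //; exact: ltW.
- by rewrite (join_cover ca erefl rc rj (ltW ltj) cj).
Qed.

Lemma pair_levC k a b : pair_lev rk k a b -> pair_lev rk k b a.
Proof.
case=> ab ra rb h; split; rewrite 1?eq_sym // => x /h; tauto.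
Qed.

Lemma card_lev2 k a : #|lev rk k| = 2 -> rk a = k -> exists b, pair_lev rk k a b.
Proof.
move=> /eqP/cards2P-[x] [y] [xy e] ra.
have h z : rk z = k -> z = x \/ z = y.
  move=> rz; have : z \in lev rk k by rewrite inE rz.
  by rewrite e !inE => /orP[]/eqP; tauto.
have [rx ry] : rk x = k /\ rk y = k.
  have : x \in lev rk k by rewrite e !inE eqxx.
  have : y \in lev rk k by rewrite e !inE eqxx orbT.
  by rewrite !inE => /eqP-> /eqP->.
have [->|->] := h _ ra; last by exists x; apply: pair_levC; split.
by exists y; split.
Qed.

Lemma pair_lev_ex k : #|lev rk k| = 2 -> exists a b, pair_lev rk k a b.
Proof.
move=> c2; have : (0 < #|lev rk k|)%N by rewrite c2.
by case/card_gt0P => a; rewrite inE => /eqP/(card_lev2 c2) h; exists a.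
Qed.

Lemma card_lev1 k a b : #|lev rk k| = 1 -> rk a = k -> rk b = k -> a = b.
Proof.
move=> /eqP/cards1P c1 /eqP ra /eqP rb; case: c1 => x e.
have : a \in lev rk k by rewrite inE.
have : b \in lev rk k by rewrite inE.
by rewrite e !inE => /eqP-> /eqP->.
Qed.

Lemma card_lev3 k a : #|lev rk k| = 3 -> rk a = k ->
  exists b c, triple_lev rk k a b c.
Proof.
move=> c3 /eqP ra; have al : a \in lev rk k by rewrite inE.
have : #|lev rk k :\ a| == 2 by move: c3; rewrite (cardsD1 a) al add1n => -[->].
case/cards2P => b [c [bc e]]; exists b, c.
have : b \in lev rk k :\ a by rewrite e !inE eqxx.
have : c \in lev rk k :\ a by rewrite e !inE eqxx orbT.
rewrite !inE => /andP[ca rc] /andP[ba rb]; split.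
- by rewrite (eq_sym a b) (eq_sym a c).
- by split; apply/eqP.
move=> x /eqP rx; have [->|xa] := eqVneq x a; first by constructor.
have : x \in lev rk k :\ a by rewrite !inE xa.
by rewrite e !inE => /orP[]/eqP->; [constructor 2|constructor 3].
Qed.

Lemma pair_meet k a b : pair_lev rk k a b -> (rk (a `&` b)).+1 = k.
Proof.
case=> ab ra rb h; have [c [ca rc]] := exchange ab (etrans ra (esym rb)).
rewrite ra in rc *; case: (h _ rc) => e; rewrite e ?eqxx // in ca *.
Qed.

Lemma pair_join k a b : pair_lev rk k a b -> rk (a `|` b) = k.+1.
Proof.
by move=> h; have := pair_meet h; case: h => ab ra rb _;
  have := rk_modular a b; lia.
Qed.

Lemma pair_incomp k a b : pair_lev rk k a b -> a >< b.
Proof.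
move=> h; have := pair_meet h; case: h => ab ra rb _ e.
by apply: (@incomp a b _ erefl); rewrite ?ra ?rb -e.
Qed.

End Graded.

(** * Quads and thin lattices *)

Section Quads.

Context {T : eqType}.

(* ((p, v), (a, b)) stands for a binomial x_p x_v - x_a x_b, up to sign, whose
   initial monomial is meant to be x_p x_v because p exceeds both a and b. *)
Definition quad : Type := ((T * T) * (T * T))%type.

Implicit Types (q : quad) (Q : seq quad).

Definition pivot q : T := q.1.1.
Definition partner q : T := q.1.2.
Definition lead q : seq T := [:: pivot q; partner q].
Definition tail q : seq T := [:: q.2.1; q.2.2].
Definition leads Q : seq T := flatten [seq lead q | q <- Q].

(** Acyclicity in the form that the weights use: a tail may contain earlier pivots, but no later
    one. The pivot of a quad is kept out of its own tail by [rect]. *)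
Definition ordered Q : bool :=
  pairwise (fun q q' => pivot q' \notin tail q) Q.

Lemma ordered_cat Q1 Q2 :
  ordered (Q1 ++ Q2) <->
  [/\ {in Q1 & Q2, forall q q', pivot q' \notin tail q}, ordered Q1 & ordered Q2].
Proof.
rewrite /ordered pairwise_cat; split; first by case/and3P => /allrelP.
by case=> h -> ->; rewrite !andbT; apply/allrelP.
Qed.

Lemma ordered_cons q Q :
  ordered (q :: Q) = all (fun q' => pivot q' \notin tail q) Q && ordered Q.
Proof. by []. Qed.

Lemma leads_cat Q1 Q2 : leads (Q1 ++ Q2) = leads Q1 ++ leads Q2.
Proof. by rewrite /leads map_cat flatten_cat. Qed.

Lemma size_leads Q : size (leads Q) = (size Q).*2.
Proof. by elim: Q => //= q Q IH; rewrite IH. Qed.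

Lemma leadsP Q x :
  reflect (exists2 q, q \in Q & x \in lead q) (x \in leads Q).
Proof.
apply: (iffP flatten_mapP) => -[q qQ xq]; by exists q.
Qed.

End Quads.
Arguments quad : clear implicits.
Arguments pivot {T} !q /.
Arguments partner {T} !q /.

(* [lia] is slow in contexts with many order-theoretic hypotheses. *)
Ltac arith :=
  repeat match goal with
  | H : ?T |- _ => lazymatch T with
    | is_true (leq _ _) => fail
    | is_true (andb (leq _ _) _) => fail
    | @eq nat _ _ => fail
    | is_true (negb (@eq_op _ _ _)) => fail
    | _ => clear H
    end
  end; lia.

(** * Matching a run of two-element levels that starts at an apex *)

Section Transport.

Context {disp : Order.disp_t} {L : finTBDistrLatticeType disp}.
Implicit Types (a b c x y z : L) (q : quad L) (Q : seq (quad L)).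

Definition meet_join a b c d : bool :=
  [&& a >< b & (c, d) \in [:: (a `&` b, a `|` b); (a `|` b, a `&` b)]].

(** The lead may be the incomparable pair or the pair of meet and join, each listed in either order,
    so that any of the four elements can be made the pivot. *)
Definition rect q : bool :=
  meet_join q.1.1 q.1.2 q.2.1 q.2.2 || meet_join q.2.1 q.2.2 q.1.1 q.1.2.

Lemma rect_incomp p v a b :
  p >< v -> p `&` v = a -> p `|` v = b -> rect ((p, v), (a, b)).
Proof. by move=> h <- <-; rewrite /rect /meet_join h !inE eqxx. Qed.

Lemma rect_meet_join p v a b :
  a >< b -> a `&` b = p -> a `|` b = v -> rect ((p, v), (a, b)).
Proof. by move=> h <- <-; rewrite /rect /meet_join /= h !inE eqxx ?orbT. Qed.

Lemma rect_join_meet p v a b :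
  a >< b -> a `|` b = p -> a `&` b = v -> rect ((p, v), (a, b)).
Proof. by move=> h <- <-; rewrite /rect /meet_join /= h !inE eqxx ?orbT. Qed.

(* The elements satisfying [inner], together with [top], are covered by the
   initial monomials of [Q1 ++ Q2] and of the quad with pivot [top]; [inner] is
   meant to be the part of a block strictly below the two-element level
   [{a, b}] (and [mu], [top] the meet and the join of [a] and [b]), or dually
   strictly above. A quad with pivot [a] and with [mu] in its tail may be
   inserted between [Q1] and [Q2]. *)
Definition transport (inner pinner : pred L) (a b mu top : L) (n : nat) : Prop :=
  exists Q1 Q2 w u z,
  [/\ [/\ all rect (Q1 ++ Q2), rect ((top, w), (u, z)),
          ordered (Q1 ++ Q2) & size (Q1 ++ Q2) = n],
      [/\ inner w, inner u \/ u = a \/ u = b & z = a \/ z = b],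
      {in Q1 ++ Q2, forall q, [/\ pinner (pivot q), inner (partner q) &
         {in tail q, forall x, inner x \/ x = a \/ x = b}]},
      (forall x, inner x -> x = w \/ x \in leads (Q1 ++ Q2)) &
      {in Q1, forall q, a \notin tail q} /\ {in Q2, forall q, pivot q != mu}].

Context (rk : L -> nat) (gr : graded rk).

Notation lev := (lev rk).
Notation pair_lev := (pair_lev rk).

(* In the step below [z] is the element of the level which is not the join of
   the previous level, and [j] the other one. *)
Definition pretransport (m l : nat) (z j : L) : Prop :=
  exists Q1 Q2 w u,
  [/\ [/\ all rect (Q1 ++ Q2), ordered (Q1 ++ Q2) & size (Q1 ++ Q2) = (l - m).-1],
      [/\ u `&` z = w, u `|` z = j `|` z, u >< z & (m <= rk w < l)%N],
      (m <= rk u < l)%N \/ u = j,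
      {in Q1 ++ Q2, forall q, [/\ (m < rk (pivot q) < l)%N, (m <= rk (partner q) < l)%N &
         {in tail q, forall x, (m <= rk x < l)%N \/ x = j}]} &
      (forall x, (m <= rk x < l)%N -> x = w \/ x \in leads (Q1 ++ Q2)) /\
      ({in Q1, forall q, j \notin tail q} /\
       {in Q2, forall q, pivot q != z `&` j})].

(** When [l = m.+1] the level below is the apex, and either element of level l may play the part of
    z. *)
Definition nonjoin (m l : nat) (z j : L) : Prop :=
  l = m.+1 \/ exists c d, pair_lev l.-1 c d /\ j = c `|` d.

Section Steps.

Variables (m l : nat).
Hypothesis c1 : #|lev m| = 1.
Hypothesis c2 : forall k, (m < k <= l)%N -> #|lev k| = 2.

Lemma pretransport_base z j : pair_lev m.+1 z j -> pretransport m m.+1 z j.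
Proof.
move=> h; have [zj rz rj _] := h; have rm := pair_meet gr h.
exists [::], [::], (z `&` j), j; split; rewrite ?subSnn //; try by right.
- split; [exact: meetC| |exact (pair_incomp gr (pair_levC h))|arith].
  by [].
- split=> // x; rewrite ltnS -eqn_leq => /eqP e; left.
  by apply: (card_lev1 c1) => //; case: rm.
Qed.

End Steps.

(** Level l = {y, n} is matched with itself by a quad of pivot n and tail y /\ n, j, which is
    exactly what the gap between [Q1] and [Q2] admits. The free element is kept: u <= j and y = z /\
    j give u /\ z = u /\ y = w. *)
Lemma pretransport_straight m l z y n j :
  (m < l)%N ->
  pair_lev l.+1 z j -> pair_lev l y n -> y = z `&` j -> j = y `|` n ->
  pretransport m l y n -> pretransport m l.+1 z j.
Proof.
move=> ml hz hy ey ej [Q1 [Q2 [w [u [[rQ oQ sQ] [uy ujn uiy rw] ru bQ [cQ [s1 s2]]]]]]].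
have [yn ry rn hyn] := hy; have [zj rz rj hzj] := hz.
have uj : u <= j by rewrite ej joinC -ujn leUl.
have yz : y <= z by rewrite ey leIl.
pose q := ((n, y), (y `&` n, j)) : quad L.
have rq : rect q.
  rewrite /q; apply: rect_incomp; last by rewrite joinC.
    exact (pair_incomp gr (pair_levC hy)).
  by rewrite meetC.
have rm := pair_meet gr hy.
have perm : perm_eq (Q1 ++ q :: Q2) (q :: (Q1 ++ Q2)) by rewrite -cat1s perm_catCA.
have mem q' : q' \in Q1 ++ q :: Q2 -> q' = q \/ q' \in Q1 ++ Q2.
  by rewrite (perm_mem perm) inE => /orP[/eqP|]; tauto.
have bt q' x : q' \in Q1 ++ Q2 -> x \in tail q' -> (rk x <= l)%N.
  move=> /bQ[_ _ h] /h[|->]; arith.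
exists Q1, (q :: Q2), w, u; split.
- split.
  + by rewrite (perm_all _ perm) /= rq.
  + move/ordered_cat: oQ => [h12 o1 o2]; apply/ordered_cat; split=> //.
      move=> q1 q2 q1Q; rewrite inE => /orP[/eqP->|]; first exact: s1.
      exact: h12.
    rewrite /ordered /= -/(ordered _) o2 andbT; apply/allP => q2 q2Q.
    rewrite !inE negb_or s2 //=; apply: contraTneq isT => e.
    have := bQ q2; rewrite mem_cat q2Q orbT => /(_ isT)[]; rewrite e rj; arith.
  + by rewrite (perm_size perm) /= sQ; arith.
- split.
  + have -> : u `&` z = u `&` (z `&` j) by rewrite [z `&` j]meetC meetA (meet_l uj).
    by rewrite -ey.
  + apply/eqP; rewrite eq_le; apply/andP; split.
      by rewrite leU2.
    by rewrite leUx leUr andbT ej joinC -ujn leUx leUl (le_trans yz) ?leUr.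
  + apply: (@incomp _ _ rk _ _ w).
    * have -> : u `&` z = u `&` (z `&` j) by rewrite [z `&` j]meetC meetA (meet_l uj).
      by rewrite -ey.
    * apply: (rk_lt gr); rewrite lt_neqAle -uy leIl andbT.
      by apply: contraNneq uiy => <-; rewrite le_comparable // leIr.
    * arith.
  + arith.
- left; case: ru => [|->]; arith.
- move=> q' /mem[->|/[dup] q'Q /bQ[h1 h2 h3]].
    split; rewrite /= ?rn ?ry; try arith.
    by move=> x; rewrite !inE /q /= => /orP[]/eqP->; [left; arith|right].
  split; [arith|arith|move=> x /h3[|->]; left; arith].
- split.
    move=> x; case: (ltnP (rk x) l) => [xl /andP[mx _]|lx xm].
      case: (cQ x); rewrite ?mx //; first by left.
      by move=> /leadsP[q' q'Q xq']; right; apply/leadsP; exists q';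
        rewrite // (perm_mem perm) inE q'Q orbT.
    right; apply/leadsP; exists q; first by rewrite (perm_mem perm) inE eqxx.
    by have [|->|->] := hyn x; rewrite ?inE ?eqxx ?orbT //; arith.
  split.
    move=> q' q'Q; apply/negP => /(bt q'); rewrite mem_cat q'Q => /(_ isT).
    by rewrite rj ltnn.
  move=> q'; rewrite inE -ey => /orP[/eqP->|q'Q]; first by rewrite /= eq_sym.
  apply: contraTneq isT => e.
  by have := bQ q'; rewrite mem_cat q'Q orbT => /(_ isT)[]; rewrite e ry; arith.
Qed.

(** Here y is both the join of the level below and the meet of the level above, so no transport
    treats it as the non-join of its level. The old transport is closed by a quad of pivot y and
    partner w, then n is matched with n', and y' becomes the new free element, with n in the place
    of u. *)
Lemma pretransport_turn m l z j y n y' n' z0 j0 :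
  (m < l)%N ->
  pair_lev l.+2 z j -> pair_lev l.+1 y n -> pair_lev l y' n' -> pair_lev l z0 j0 ->
  y = z `&` j -> j = y `|` n -> y = y' `|` n' -> y' = y `&` n ->
  pretransport m l z0 j0 -> pretransport m l.+2 z j.
Proof.
move=> ml hz hy hy' hz0 ey ej ejy' ey'
  [Q1 [Q2 [w [u [[rQ oQ sQ] [uz uj uiz rw] ru bQ [cQ [s1 s2]]]]]]].
have [yn ry rn hyn] := hy; have [zj rz rj hzj] := hz.
have [yn' ry' rn' hyn'] := hy'; have [zj0 rz0 rj0 hzj0] := hz0.
have ej0 : j0 `|` z0 = y.
  apply: (@join_cover _ _ _ gr l) => //; first by rewrite eq_sym.
    by rewrite ejy'; case: (hyn' _ rj0) => ->; rewrite ?leUl ?leUr.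
  by rewrite ejy'; case: (hyn' _ rz0) => ->; rewrite ?leUl ?leUr.
have yz : y <= z by rewrite ey leIl.
have y'y : y' <= y by rewrite ejy' leUl.
have n'y : n' <= y by rewrite ejy' leUr.
have y'n : y' <= n by rewrite ey' leIr.
have nj : n <= j by rewrite ej leUr.
pose q1 := ((y, w), (u, z0)) : quad L.
pose q2 := ((n, n'), (y' `&` n', j)) : quad L.
have rq1 : rect q1 by apply: rect_join_meet; rewrite ?uj.
have nn' : n `&` n' = y' `&` n'.
  by rewrite ey' [y `&` n]meetC -meetA (meet_r n'y).
have rm := pair_meet gr hy'.
have rq2 : rect q2.
  apply: rect_incomp => //.
    by apply: (@incomp _ _ rk _ _ _ nn'); arith.
  by rewrite ej ejy' [y' `|` n']joinC -joinA (join_r y'n) joinC.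
have bt q' x : q' \in Q1 ++ Q2 -> x \in tail q' -> (rk x <= l)%N.
  move=> /bQ[_ _ h] /h[|->]; arith.
have ru' : (m <= rk u <= l)%N by case: ru => [|->]; arith.
have nz : n `&` z = y' by rewrite ey' ey [RHS]meetC meetCA (meet_l nj) meetC.
exists (Q1 ++ Q2 ++ [:: q1]), [:: q2], y', n; rewrite -!catA /=.
have mem q' : q' \in Q1 ++ Q2 ++ [:: q1; q2] -> [\/ q' = q1, q' = q2 | q' \in Q1 ++ Q2].
  by rewrite catA mem_cat !inE => /or3P[h|/eqP->|/eqP->];
    [constructor 3|constructor 1|constructor 2].
have q1Q : q1 \in Q1 ++ Q2 ++ [:: q1; q2] by rewrite !mem_cat !inE eqxx !orbT.
have q2Q : q2 \in Q1 ++ Q2 ++ [:: q1; q2] by rewrite !mem_cat !inE eqxx !orbT.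
have ltn : (rk (y' `&` n')).+1 = l by exact: rm.
split.
- split.
  + by move: rQ; rewrite !all_cat => /andP[-> ->]; rewrite /= rq1 rq2.
  + rewrite catA; apply/ordered_cat; split=> //.
      move=> qa qb /bt h; rewrite mem_seq2 => /orP[]/eqP->; apply/negP => /h;
      by rewrite /= ?ry ?rn ltnn.
    rewrite /ordered /q1 /q2 /= !inE !andbT negb_or; apply/andP; split;
    by apply/eqP => e; move: rn; rewrite e /=; arith.
  + by rewrite catA size_cat sQ /=; arith.
- split=> //.
  + by rewrite -{1}(join_r yz) joinCA joinA -ej.
  + by apply: (@incomp _ _ rk _ _ _ nz); arith.
  + arith.
- left; arith.
- move=> q' /mem[->|->|/bQ[h1 h2 h3]].
  + split; rewrite /= ?ry; try arith.
    by move=> x; rewrite !inE /= => /orP[]/eqP->; left; arith.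
  + split; rewrite /= ?rn ?rn'; try arith.
    by move=> x; rewrite !inE /= => /orP[]/eqP->; [left; arith|right].
  + split; [arith|arith|move=> x /h3[|->]; left; arith].
- split.
    move=> x /andP[mx xl]; have [xl1|xl1] := ltnP (rk x) l.
      have [|->|] := cQ x; first by rewrite mx.
        by right; apply/leadsP; exists q1; rewrite // !inE /= eqxx orbT.
      move=> /leadsP[q' q'Q xq']; right; apply/leadsP; exists q' => //.
      by rewrite catA mem_cat q'Q.
    have [xe|xe] : rk x = l \/ rk x = l.+1 by arith.
      have [->|->] := hyn' _ xe; [by left|right].
      by apply/leadsP; exists q2; rewrite // !inE /= eqxx orbT.
    right; apply/leadsP; have [->|->] := hyn _ xe.
      by exists q1; rewrite // !inE /= eqxx.
    by exists q2; rewrite // !inE /= eqxx.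
  split.
    move=> q'; rewrite catA mem_cat inE => /orP[/bt h|/eqP->].
      by apply/negP => /h; rewrite rj; arith.
    by rewrite !inE; apply/norP; split; apply/eqP => e; move: rj; rewrite e /=; arith.
  by move=> q'; rewrite inE => /eqP-> /=; rewrite -ey eq_sym.
Qed.

(* A level that continues straight is inserted below the previous pivots, and
   one that turns is handled together with the level below it. *)
Lemma pretransportP m l z j :
  #|lev m| = 1 -> (m < l)%N -> (forall k, (m < k <= l)%N -> #|lev k| = 2) ->
  pair_lev l z j -> nonjoin m l z j -> pretransport m l z j.
Proof.
move=> c1; elim/ltn_ind: l z j => l IH z j ml c2 hz nj.
have [lm|lm] := eqVneq l m.+1.
  by rewrite lm in hz *; exact: pretransport_base.
have {nj}[c [d [hc ejc]]] : exists c d, pair_lev l.-1 c d /\ j = c `|` d.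
  by case: nj => // e; rewrite e eqxx in lm.
have [k ek] : exists k, l = k.+1 by exists l.-1; arith.
rewrite {l}ek /= in IH ml c2 hz lm hc *.
have mk : (m < k)%N by arith.
have c2k i : (m < i <= k)%N -> #|lev i| = 2 by move=> ?; apply: c2; arith.
have ry := pair_meet gr hz; case: ry => ry.
have [n hy] : exists n, pair_lev k (z `&` j) n.
  by apply: card_lev2 ry; apply: c2k; rewrite mk leqnn.
set y := z `&` j in hy *.
have ej : j = y `|` n.
  have [cd rc rd _] := hc; have [yn ry' rn hyn] := hy; rewrite ejc.
  by move: cd; case: (hyn _ rc) => ->; case: (hyn _ rd) => ->; rewrite ?eqxx // joinC.
have straight : nonjoin m k y n -> pretransport m k.+1 z j.
  by move=> h; apply: (pretransport_straight mk hz hy) => //; apply: IH.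
have [km|km] := eqVneq k m.+1; first by apply: straight; left.
have [i ei] : exists i, k = i.+1 by exists k.-1; arith.
rewrite {k}ei /= in IH ml c2 hz lm hc c2k mk ry hy straight km *.
have mi : (m < i)%N by arith.
have [c' [d' hc']] : exists c d, pair_lev i c d.
  by apply: pair_lev_ex; apply: c2k; rewrite mi leqnSn.
have [yn ry' rn hyn] := hy.
(* The level turns when the join of the level below is y, the meet of the level above; otherwise it
   continues straight. *)
have [ey|en] := hyn _ (pair_join gr hc'); last first.
  by apply: straight; right; exists c', d'; split.
have [n' hy'] : exists n', pair_lev i (y `&` n) n'.
  by apply: card_lev2; [apply: c2k; rewrite mi leqnSn|case: (pair_meet gr hy)].
have e' : y = y `&` n `|` n'.
  rewrite -{1}ey; have [cd rc rd _] := hc'; have [_ _ _ h] := hy'.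
  by move: cd; case: (h _ rc) => ->; case: (h _ rd) => ->; rewrite ?eqxx // joinC.
(* The recursion at level i needs a labelling given by the join of level i - 1, which may differ
   from the labels y /\ n and n' given by the levels above. *)
have [z0 [j0 [hz0 nj0]]] : exists z0 j0, pair_lev i z0 j0 /\ nonjoin m i z0 j0.
  have [im|im] := eqVneq i m.+1; first by exists c', d'; split=> //; left.
  have [a [b hab]] : exists a b, pair_lev i.-1 a b.
    by apply: pair_lev_ex; apply: c2k; arith.
  have rj : rk (a `|` b) = i by rewrite (pair_join gr hab); arith.
  have [z0 hz0] : exists z0, pair_lev i (a `|` b) z0.
    by apply: card_lev2 rj; apply: c2k; arith.
  exists z0, (a `|` b); split; first exact: pair_levC.
  by right; exists a, b.
apply: (pretransport_turn mi hz hy hy' hz0) => //.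
by apply: IH => // k ?; apply: c2k; arith.
Qed.

(** One of a and b is the join of the level below, unless that level is the apex. If it is a, the
    gap of the pretransport is the required one; if it is b, no tail contains a and all the quads go
    into the first list. *)
Lemma transport_lower m l a b :
  #|lev m| = 1 -> (m < l)%N -> (forall k, (m < k <= l)%N -> #|lev k| = 2) ->
  pair_lev l a b ->
  transport (fun x => m <= rk x < l)%N (fun x => m < rk x < l)%N
    a b (a `&` b) (a `|` b) (l - m).-1.
Proof.
move=> c1 ml c2 hab.
have conv z j : pair_lev l z j -> nonjoin m l z j ->
    exists Q1 Q2 w u, [/\ [/\ all rect (Q1 ++ Q2), rect ((z `|` j, w), (u, z)),
          ordered (Q1 ++ Q2) & size (Q1 ++ Q2) = (l - m).-1],
      (m <= rk w < l)%N /\ ((m <= rk u < l)%N \/ u = j),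
      {in Q1 ++ Q2, forall q, [/\ (m < rk (pivot q) < l)%N, (m <= rk (partner q) < l)%N &
         {in tail q, forall x, (m <= rk x < l)%N \/ x = j}]},
      (forall x, (m <= rk x < l)%N -> x = w \/ x \in leads (Q1 ++ Q2)) &
      {in Q1, forall q, j \notin tail q} /\ {in Q2, forall q, pivot q != z `&` j}].
  move=> hz nj; have := pretransportP c1 ml c2 hz nj.
  case=> Q1 [Q2 [w [u [[rQ oQ sQ] [uz uj ui rw] ru bQ [cQ ss]]]]].
  exists Q1, Q2, w, u; split=> //; split=> //.
  by apply: rect_join_meet => //; rewrite uj joinC.
have [nj|nj] : nonjoin m l b a \/ nonjoin m l a b.
  have [lm|lm] := eqVneq l m.+1; first by left; left.
  have [c [d hc]] : exists c d, pair_lev l.-1 c d.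
    by apply: pair_lev_ex; apply: c2; arith.
  have [ab ra rb hx] := hab.
  have /hx[e|e] : rk (c `|` d) = l by rewrite (pair_join gr hc); arith.
    by left; right; exists c, d.
  by right; right; exists c, d.
- have [Q1 [Q2 [w [u [h1 [h2 h3] h4 h5 h6]]]]] := conv _ _ (pair_levC hab) nj.
  exists Q1, Q2, w, u, b; rewrite [a `|` b]joinC [a `&` b]meetC.
  split=> //; [by split=> //; [tauto|right]|].
  by move=> q /h4[? ? h]; split=> // x /h; tauto.
- have [Q1 [Q2 [w [u [h1 [h2 h3] h4 h5 h6]]]]] := conv _ _ hab nj.
  exists (Q1 ++ Q2), [::], w, u, a; rewrite cats0.
  split=> //; [by split=> //; [tauto|left]| |].
    by move=> q /h4[? ? h]; split=> // x /h; tauto.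
  split=> // q /h4[_ _ h]; apply/negP => /h; have [ab ra _ _] := hab.
  by rewrite ra ltnn andbF => -[//|e]; rewrite e eqxx in ab.
Qed.

End Transport.

(** * Order duality *)

Section Dual.

Context {disp : Order.disp_t} {L : finTBDistrLatticeType disp}.
Implicit Types (a b c x y z : L) (q : quad L) (Q : seq (quad L)).

Lemma rect_dual q : @rect _ (L^d : finTBDistrLatticeType _) q = rect q.
Proof.
case: q => [[p v] [a b]]; rewrite /rect /meet_join /=.
have cmp (x y : L) : @Order.comparable _ L^d x y = (x >=< y).
  by rewrite /Order.comparable !leEdual orbC.
by rewrite !cmp !inE !meetEdual !joinEdual; congr (_ && _ || _ && _); apply: orbC.
Qed.

Context (rk : L -> nat) (N : nat).
Hypothesis rkN : forall a, (rk a <= N)%N.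

(** The rank is an abstract graded function throughout, so that upper constructions are the lower
    ones in the dual lattice; level k becomes level N - k. *)
Definition drk : L^d -> nat := fun a => (N - rk a)%N.

Lemma graded_dual : graded rk -> graded drk.
Proof.
have aux1 A C : (A = C.+1 -> A <= N -> N - C = (N - A).+1)%N by arith.
case=> [h1 h2 h3 h4]; rewrite /drk; split.
- by move=> a b /h1; have := rkN a; have := rkN b; arith.
- move=> a b.
  have aux A B C D : (C + D = A + B -> A <= N -> B <= N -> C <= N -> D <= N ->
    (N - D) + (N - C) = (N - A) + (N - B))%N by arith.
  exact: (aux _ _ _ _ (h2 a b) (rkN _) (rkN _) (rkN _) (rkN _)).
- move=> a b /h4[c /andP[bc ca] e]; exists c.
    by apply/andP; split; [exact: ca|exact: bc].
  by apply: aux1 e (rkN _).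
- move=> a b /h3[c /andP[bc ca] e]; exists c.
    by apply/andP; split; [exact: ca|exact: bc].
  by apply: aux1 e (rkN _).
Qed.

Lemma lev_dual k : (k <= N)%N -> lev drk (N - k) = lev rk k.
Proof.
move=> kN; apply/setP => a; rewrite !inE /drk; have := rkN a.
by move=> h; apply/eqP/eqP; arith.
Qed.

Lemma pair_lev_dual k a b : (k <= N)%N -> pair_lev rk k a b -> pair_lev drk (N - k) a b.
Proof.
move=> kN [ab ra rb h]; split=> //; rewrite /drk ?ra ?rb //.
by move=> x e; apply: h; have := rkN x; arith.
Qed.

End Dual.

(** * Transports from an upper apex, and runs of two-element levels away from the apexes *)

Section Transport.

Context {disp : Order.disp_t} {L : finTBDistrLatticeType disp}.
Implicit Types (a b c x y z : L) (q : quad L) (Q : seq (quad L)).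
Context (rk : L -> nat) (gr : graded rk).

Notation lev := (lev rk).
Notation pair_lev := (pair_lev rk).

Lemma transport_upper m l a b :
  #|lev m| = 1 -> (l < m)%N -> (forall k, (l <= k < m)%N -> #|lev k| = 2) ->
  pair_lev l a b ->
  transport (fun x => l < rk x <= m)%N (fun x => l < rk x < m)%N
    a b (a `|` b) (a `&` b) (m - l).-1.
Proof.
move=> c1 lm c2 hab; pose N := (\max_(a : L) rk a)%N.
have rkN a0 : (rk a0 <= N)%N by exact: leq_bigmax.
have mN : (m <= N)%N.
  have /card_gt0P[x] : (0 < #|lev m|)%N by rewrite c1.
  by rewrite inE => /eqP <-.
have lN : (l <= N)%N by apply: leq_trans mN; exact: ltnW.
have eq1 x : (N - m <= drk rk N x < N - l)%N = (l < rk x <= m)%N.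
  by rewrite /drk; have := rkN x; arith.
have eq2 x : (N - m < drk rk N x < N - l)%N = (l < rk x < m)%N.
  by rewrite /drk; have := rkN x; arith.
have := @transport_lower _ _ _ (graded_dual rkN gr) (N - m) (N - l) a b.
rewrite lev_dual // => /(_ c1) []; first by arith.
- move=> k hk; have -> : k = (N - (N - k))%N by arith.
  by rewrite lev_dual ?leq_subr //; apply: c2; arith.
- exact: pair_lev_dual.
move=> Q1 [Q2 [w [u [z [[rQ rw oQ sQ] [iw iu zab] bQ cQ ss]]]]].
exists Q1, Q2, w, u, z; split.
- split=> //; last by rewrite sQ; arith.
    by move: rQ; rewrite (eq_all (@rect_dual _ L)).
  by rewrite -rect_dual.
- by split=> //; rewrite -eq1.
- move=> q /bQ[h1 h2 h3]; split; rewrite -?eq1 -?eq2 //.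
  by move=> x /h3; rewrite -eq1.
- by move=> x; rewrite -eq1 => /cQ.
- by [].
Qed.

(* The tails meet the levels next to [lo .. lo + n - 1] only in the meet of the
   lowest level and in the join of the highest one. *)
Lemma middle n lo : (forall k, (lo <= k < lo + n)%N -> #|lev k| = 2) ->
  exists Q, [/\ all rect Q, ordered Q, size Q = n,
    {in Q, forall q, [/\ (lo <= rk (pivot q) < lo + n)%N,
        (lo <= rk (partner q) < lo + n)%N &
        {in tail q, forall x, [\/ (lo <= rk x < lo + n)%N,
           (rk x).+1 = lo /\ (forall e, rk e = lo -> x <= e) |
           rk x = (lo + n)%N /\ (forall e, (rk e).+1 = (lo + n)%N -> e <= x)]}]} &
    forall x, (lo <= rk x < lo + n)%N -> x \in leads Q].
Proof.
elim: n lo => [|n IH] lo c2.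
  by exists [::]; split=> // x; rewrite addn0; arith.
have [Q [rQ oQ sQ bQ cQ]] : exists Q, [/\ all rect Q, ordered Q, size Q = n,
    {in Q, forall q, [/\ (lo.+1 <= rk (pivot q) < lo.+1 + n)%N,
        (lo.+1 <= rk (partner q) < lo.+1 + n)%N &
        {in tail q, forall x, [\/ (lo.+1 <= rk x < lo.+1 + n)%N,
           (rk x).+1 = lo.+1 /\ (forall e, rk e = lo.+1 -> x <= e) |
           rk x = (lo.+1 + n)%N /\ (forall e, (rk e).+1 = (lo.+1 + n)%N -> e <= x)]}]} &
    forall x, (lo.+1 <= rk x < lo.+1 + n)%N -> x \in leads Q].
  by apply: IH => k ?; apply: c2; arith.
(* The quad of level lo is appended last, so its pivot a must avoid the tails of [Q]. At level lo
   these contain at most the meet of level lo + 1, and a is taken to be the other element. *)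
have [a [b [hab hb]]] : exists a b, pair_lev lo a b /\
    {in Q, forall q, a \notin tail q}.
  have [c [d hcd]] : exists c d, pair_lev lo c d.
    by apply: pair_lev_ex; apply: c2; arith.
  have [n0|n0] := posnP n.
    by exists c, d; split=> //; move: sQ; rewrite n0 => /size0nil->.
  have [e [f hef]] : exists c d, pair_lev lo.+1 c d.
    by apply: pair_lev_ex; apply: c2; arith.
  have rm : rk (e `&` f) = lo by have := pair_meet gr hef; arith.
  have [p hp] : exists p, pair_lev lo (e `&` f) p.
    by apply: card_lev2 rm; apply: c2; arith.
  exists p, (e `&` f); split; first exact: pair_levC.
  have [mp _ rp _] := hp; have [_ re rf _] := hef.
  move=> q /bQ[_ _ h]; apply/negP => /h[|[_ h1]|[]].
  - by rewrite rp; arith.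
  - move/eqP: mp; apply; apply/esym/(eq_rk gr); last by rewrite rm rp.
    by rewrite lexI !h1.
  - by rewrite rp; arith.
have [ab ra rb hx] := hab; have rm := pair_meet gr hab; have rj := pair_join gr hab.
exists (rcons Q ((a, b), (a `&` b, a `|` b))); split.
- by rewrite all_rcons rQ andbT; apply: rect_incomp => //; exact: pair_incomp hab.
- rewrite -cats1; apply/ordered_cat; split=> // q q2 qQ.
  by rewrite mem_seq1 => /eqP-> /=; exact: hb.
- by rewrite size_rcons sQ.
- move=> q; rewrite mem_rcons inE => /orP[/eqP->|/bQ[h1 h2 h3]] /=.
    split; try arith; move=> x; rewrite !inE /= => /orP[]/eqP->.
      constructor 2; split=> // e /hx[]->; [exact: leIl|exact: leIr].
    case: (posnP n) => [n0|n0]; last by constructor 1; arith.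
    constructor 3; rewrite n0 addn1; split=> // e [] /hx[]->; [exact: leUl|exact: leUr].
  split; [arith|arith|move=> x /h3[h|[h _]|[h1' h2']]].
  + by constructor 1; arith.
  + by constructor 1; arith.
  + by constructor 3; rewrite addnS -addSn.
- move=> x xl; rewrite /leads map_rcons flatten_rcons mem_cat; apply/orP.
  have [e|e] := eqVneq (rk x) lo.
    by right; case: (hx _ e) => ->; rewrite !inE /= eqxx ?orbT.
  by left; apply: cQ; arith.
Qed.

End Transport.

(** * Levels with three elements *)

Section Triples.

Context {disp : Order.disp_t} {L : finTBDistrLatticeType disp}.
Implicit Types (a b c x y z : L) (q : quad L) (Q : seq (quad L)).
Context (rk : L -> nat) (gr : graded rk).

Notation lev := (lev rk).
Notation pair_lev := (pair_lev rk).
Notation triple_lev := (triple_lev rk).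

Lemma card_lev_ge3 k x y z :
  rk x = k -> rk y = k -> rk z = k -> x != y -> x != z -> y != z ->
  (2 < #|lev k|)%N.
Proof.
move=> rx ry rz xy xz yz.
have <- : #|[set x; y; z]| = 3.
  rewrite setUC cardsU1 cards2 xy !inE negb_or.
  by rewrite (eq_sym z x) (eq_sym z y) xz yz.
apply/subset_leq_card/subsetP => e; rewrite !inE.
by move=> /orP[/orP[]|] /eqP->; apply/eqP.
Qed.

Lemma triple_joins k x y z m :
  rk x = k.+1 -> rk y = k.+1 -> rk z = k.+1 -> x != y -> x != z -> y != z ->
  rk m = k -> m <= x -> m <= y -> m <= z ->
  [/\ rk (x `|` y) = k.+2, rk (x `|` z) = k.+2 & rk (y `|` z) = k.+2] /\
  [/\ x `|` y != x `|` z, x `|` y != y `|` z & x `|` z != y `|` z].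
Proof.
move=> rx ry rz xy xz yz rm mx my mz; split.
  by split; apply: (rk_join_cover gr) rm _ _.
split.
- exact: (join_cancel gr rx ry rz rm).
- by rewrite [x `|` y]joinC; apply: (join_cancel gr ry rx rz rm); rewrite // eq_sym.
- rewrite [x `|` z]joinC [y `|` z]joinC.
  by apply: (join_cancel gr rz rx ry rm); rewrite // eq_sym.
Qed.

(** The three pairwise joins have rank k + 2 and are distinct by [join_cancel]. *)
Lemma no_triple_above k x y z m : (#|lev k.+2| <= 2)%N ->
  rk x = k.+1 -> rk y = k.+1 -> rk z = k.+1 -> x != y -> x != z -> y != z ->
  rk m = k -> m <= x -> m <= y -> m <= z -> False.
Proof.
move=> c2 rx ry rz xy xz yz rm mx my mz.
have [[r1 r2 r3] [n1 n2 n3]] := triple_joins rx ry rz xy xz yz rm mx my mz.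
by have := card_lev_ge3 r1 r2 r3 n1 n2 n3; rewrite ltnNge c2.
Qed.

Lemma no_triple_below k x y z m : (#|lev k| <= 2)%N ->
  rk x = k.+1 -> rk y = k.+1 -> rk z = k.+1 -> x != y -> x != z -> y != z ->
  rk m = k.+2 -> x <= m -> y <= m -> z <= m -> False.
Proof.
move=> c2 rx ry rz xy xz yz rm xm ym zm.
have rr u v : u != v -> rk u = k.+1 -> rk v = k.+1 -> u <= m -> v <= m ->
    rk (u `&` v) = k.
  by move=> uv ru rv um vm; have [] := rk_meet_cover gr uv ru rv rm um vm.
have [yx zx zy] : [/\ y != x, z != x & z != y].
  by rewrite (eq_sym y) (eq_sym z) (eq_sym z).
have := @card_lev_ge3 k (x `&` y) (x `&` z) (y `&` z).
rewrite !rr // => /(_ erefl erefl erefl); rewrite ltnNge c2.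
move=> h; apply: (notF (h _ _ _)).
- exact: (meet_cancel gr rx ry rz rm).
- by rewrite [x `&` y]meetC; apply: (meet_cancel gr ry rx rz rm).
- rewrite [x `&` z]meetC [y `&` z]meetC.
  exact: (meet_cancel gr rz rx ry rm).
Qed.

Lemma cover_below k x y : rk x = k.+1 -> rk y = k.+1 -> x != y ->
  exists2 c, c <= x & rk c = k.
Proof.
move=> rx ry xy; have [_ _ _ down] := gr.
have lt : x `&` y < x.
  rewrite lt_neqAle leIl andbT; apply: contraNneq xy => h.
  by apply/eqP/(eq_rk gr); rewrite ?rx ?ry // -h leIr.
have [c /andP[_ /ltW cx] rc] := down _ _ lt.
by exists c => //; move: rc; rewrite rx => -[].
Qed.

(* With [a `|` b], the three-element level above [{a, b}] has either one element
   above each of [a] and [b] only, or two elements above [a] only. *)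
Lemma triple_above l : #|lev l| = 2 -> #|lev l.+1| = 3 ->
  exists a b u v, [/\ pair_lev l a b, triple_lev l.+1 (a `|` b) u v,
    a <= u, ~~ (b <= u) &
    (b <= v /\ ~~ (a <= v)) \/ (a <= v /\ ~~ (b <= v))].
Proof.
move=> c2 c3; have [a [b hab]] := pair_lev_ex c2.
have rj := pair_join gr hab.
have [u [v huv]] := card_lev3 c3 rj.
have [[ju jv uv] [_ ru rv] hx] := huv; have [ab ra rb hl] := hab.
have one x y : x != a `|` b -> rk x = l.+1 -> rk y = l.+1 -> x != y ->
    (a <= x /\ ~~ (b <= x)) \/ (b <= x /\ ~~ (a <= x)).
  move=> xj rx ry xy; have nab : ~~ ((a <= x) && (b <= x)).
    apply: contra xj => h; rewrite eq_sym; apply/eqP/(eq_rk gr).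
      by rewrite leUx.
    by rewrite rx rj.
  have [c cx /hl[] e] := cover_below rx ry xy; subst c; rewrite cx in nab.
    by left.
  by right; split=> //; move: nab; rewrite andbT.
have uj : u != a `|` b by rewrite eq_sym.
have vj : v != a `|` b by rewrite eq_sym.
have vu : v != u by rewrite eq_sym.
have [[au bu]|[bu au]] := one u v uj ru rv uv.
  exists a, b, u, v; split=> //.
  by have [[? ?]|[? ?]] := one v u vj rv ru vu; [right|left].
exists b, a, u, v; rewrite [b `|` a]joinC; split=> //; first exact: pair_levC.
by have [[? ?]|[? ?]] := one v u vj rv ru vu; [left|right].
Qed.

Lemma meet_nle l a b v : pair_lev l a b -> b <= v -> ~~ (a <= v) ->
  a `&` v = a `&` b.
Proof.
move=> hab bv nav; have rm := pair_meet gr hab; have [_ ra _ _] := hab.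
apply/esym/(eq_rk gr); first by rewrite leI2.
have /(rk_lt gr) : a `&` v < a.
  by rewrite lt_neqAle leIl andbT; apply: contraNneq nav => <-; exact: leIr.
by rewrite ra; arith.
Qed.

Lemma rect_side l a b v : pair_lev l a b -> b <= v -> ~~ (a <= v) -> rk v = l.+1 ->
  rect ((v, a), (a `&` b, a `|` b `|` v)).
Proof.
move=> hab bv nav rv; have rm := pair_meet gr hab; have [_ ra _ _] := hab.
have e : v `&` a = a `&` b by rewrite meetC (meet_nle hab).
apply: rect_incomp => //.
  by apply: (@incomp _ _ rk _ _ _ e); arith.
by rewrite -joinA (join_r bv) joinC.
Qed.

(** [K] collects the quads whose tails may reach level r + 1. A run given by [middle] from level r +
    1 on has tails meeting level r only in an element below all of level r + 1; as each pivot of [K]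
    fails to be below some element of that level, the run may be placed between [Q] and [K]. *)
Definition lower_cap (m r : nat) : Prop := exists Q K,
  [/\ [/\ all rect (Q ++ K), ordered Q, ordered K & size (Q ++ K) = (r - m).+1],
      {in Q, forall q, [/\ (m < rk (pivot q) <= r)%N, (m <= rk (partner q) <= r)%N &
        {in tail q, forall x, (m <= rk x < r)%N}]},
      {in K, forall q, [/\ rk (pivot q) = r, (m <= rk (partner q) <= r)%N,
        {in tail q, forall x, (m <= rk x < r)%N \/ rk x = r.+1} &
        exists2 f, rk f = r.+1 & ~~ (pivot q <= f)]} &
      forall x, (m <= rk x <= r)%N -> x \in leads (Q ++ K)].

Definition upper_cap (m r : nat) : Prop := exists Q K,
  [/\ [/\ all rect (Q ++ K), ordered Q, ordered K & size (Q ++ K) = (m - r).+1],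
      {in Q, forall q, [/\ (r <= rk (pivot q) < m)%N, (r <= rk (partner q) <= m)%N &
        {in tail q, forall x, (r < rk x <= m)%N}]},
      {in K, forall q, [/\ rk (pivot q) = r, (r <= rk (partner q) <= m)%N,
        {in tail q, forall x, (r < rk x <= m)%N \/ (rk x).+1 = r} &
        exists2 f, (rk f).+1 = r & ~~ (f <= pivot q)]} &
      forall x, (r <= rk x <= m)%N -> x \in leads (Q ++ K)].

Lemma leads_sub Q Q' x : {subset Q <= Q'} -> x \in leads Q -> x \in leads Q'.
Proof. by move=> h /leadsP[q /h qQ' xq]; apply/leadsP; exists q. Qed.

(** With only two elements at level l + 2, three elements of level l + 1 cannot all lie over a. So
    besides a \/ b there is u over a alone and v over b alone, and u /\ b = v /\ a = a /\ b: b and a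
    become the partners of u and v, while a \/ b is left to the transport from the apex. *)
Lemma lower_capP m l :
  #|lev m| = 1 -> (m < l)%N -> (forall k, (m < k <= l)%N -> #|lev k| = 2) ->
  #|lev l.+1| = 3 -> #|lev l.+2| = 2 -> lower_cap m l.+1.
Proof.
move=> c1 ml c2 c3 c2'; have c2l : #|lev l| = 2 by apply: c2; arith.
have [a [b [u [v [hab huv au bu hv]]]]] := triple_above c2l c3.
have [[ju jv uv] [rj ru rv] hx] := huv.
have [ab ra rb hl] := hab; have rm := pair_meet gr hab.
have [bv av] : b <= v /\ ~~ (a <= v).
  case: hv => // -[av _].
  by case: (no_triple_above _ rj ru rv ju jv uv ra); rewrite ?c2' ?leUl.
have hba := pair_levC hab.
have [Q1 [Q2 [w [u' [z [[rQ rw oQ sQ] [iw iu zab] bQ cQ _]]]]]] :=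
  transport_lower gr c1 ml c2 hab.
pose q0 := ((a `|` b, w), (u', z)) : quad L.
pose q1 := ((v, a), (a `&` b, a `|` b `|` v)) : quad L.
pose q2 := ((u, b), (b `&` a, b `|` a `|` u)) : quad L.
have rju : rk (a `|` b `|` u) = l.+2 by apply: (rk_join_cover gr _ rj ru ra); rewrite ?leUl.
have rjv : rk (a `|` b `|` v) = l.+2 by apply: (rk_join_cover gr _ rj rv rb); rewrite ?leUr.
have rjv' : rk (b `|` a `|` u) = l.+2 by rewrite [b `|` a]joinC.
have rm' : (rk (b `&` a)).+1 = l by rewrite meetC.
have tQ q x : q \in Q1 ++ Q2 -> x \in tail q -> (m <= rk x < l.+1)%N.
  by move=> /bQ[_ _ h] /h[|[]->]; arith.
exists ((Q1 ++ Q2) ++ [:: q0]), [:: q1; q2]; split.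
- split.
  + rewrite !all_cat -all_cat rQ /= rw /=.
    by rewrite (rect_side hab) // (rect_side hba).
  + apply/ordered_cat; split=> // q q'; rewrite mem_seq1 => qQ /eqP-> /=.
    by apply/negP => /(tQ _ _ qQ); rewrite rj; arith.
  + rewrite /ordered /= !andbT !inE; apply/norP; split; apply/eqP => /= e.
      by move: rm; rewrite -e ru; arith.
    by move: rjv; rewrite -e ru; arith.
  + by rewrite !size_cat -size_cat sQ /=; arith.
- move=> q; rewrite mem_cat mem_seq1 => /orP[/[dup] qQ /bQ[h1 h2 h3]|/eqP->].
    split; [arith|arith|by move=> x /(tQ _ _ qQ)].
  rewrite /= rj; split; [arith|arith|].
  move=> x; rewrite !inE /= => /orP[]/eqP->; last by case: zab => ->; arith.
  by case: iu => [|[]->]; arith.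
- move=> q; rewrite mem_seq2 => /orP[]/eqP-> /=; rewrite ?ru ?rv; split=> //.
  + arith.
  + by move=> x; rewrite !inE /= => /orP[]/eqP->; [left; arith|right].
  + exists (a `|` b `|` u) => //; apply/negP => vle.
    by apply: (no_triple_below _ rj ru rv ju jv uv rju); rewrite ?c2l ?leUl ?leUr.
  + arith.
  + by move=> x; rewrite !inE /= => /orP[]/eqP->; [left; arith|right].
  + exists (a `|` b `|` v) => //; apply/negP => vle.
    by apply: (no_triple_below _ rj ru rv ju jv uv rjv); rewrite ?c2l ?leUl ?leUr.
- move=> x /andP[mx xl]; have [xl1|lx] := ltnP (rk x) l.
    have [|->|xQ] := cQ x; first by rewrite mx.
      by apply/leadsP; exists q0; rewrite ?mem_cat !inE /= eqxx ?orbT.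
    by apply: leads_sub xQ => q qQ; rewrite 2!mem_cat qQ.
  have [e|e] : rk x = l \/ rk x = l.+1 by arith.
    by case: (hl _ e) => ->; apply/leadsP; [exists q1|exists q2];
      rewrite ?mem_cat !inE /= eqxx ?orbT.
  by case: (hx _ e) => ->; apply/leadsP; [exists q0|exists q2|exists q1];
      rewrite ?mem_cat !inE /= eqxx ?orbT.
Qed.

End Triples.

(** * Certificates for blocks *)

Section BlockCert.

Context {disp : Order.disp_t} {L : finTBDistrLatticeType disp}.

(* The block lies between the apexes of rank [m] and [M]; [bot] and [top] tell
   whether these are used by an initial monomial. *)
Definition block_cert (rk : L -> nat) (m M : nat) (bot top : bool) : Prop :=
  exists Q, [/\ [/\ all rect Q, ordered Q & size Q = (M - m).-1 + bot + top]%N,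
    {in Q, forall q, [/\ (m < rk (pivot q) < M)%N, (m <= rk (partner q) <= M)%N &
       {in tail q, forall x, (m <= rk x <= M)%N}]} &
    forall x, (m + ~~ bot <= rk x < M + top)%N -> x \in leads Q].

End BlockCert.

Section Blocks.

Context {disp : Order.disp_t} {L : finTBDistrLatticeType disp}.
Implicit Types (a b c x y z : L) (q : quad L) (Q : seq (quad L)).
Context (rk : L -> nat) (gr : graded rk).

Notation lev := (lev rk).
Notation pair_lev := (pair_lev rk).
Notation triple_lev := (triple_lev rk).

Lemma upper_capP m l :
  #|lev m| = 1 -> (l < m)%N -> (forall k, (l <= k < m)%N -> #|lev k| = 2) ->
  forall r, r.+1 = l -> #|lev r| = 3 -> #|lev r.-1| = 2 -> (0 < r)%N ->
  upper_cap rk m r.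
Proof.
move=> c1 lm c2 r rl c3 c2' r0; pose N := (\max_(a : L) rk a)%N.
have rkN a0 : (rk a0 <= N)%N by exact: leq_bigmax.
have mN : (m <= N)%N.
  have /card_gt0P[x] : (0 < #|lev m|)%N by rewrite c1.
  by rewrite inE => /eqP <-.
have := @lower_capP _ _ _ (graded_dual rkN gr) (N - m) (N - l).
have e1 : (N - l).+1 = (N - r)%N by arith.
have e2 : (N - r).+1 = (N - r.-1)%N by arith.
rewrite e1 e2 !(lev_dual rkN); try arith.
case=> //; first by arith.
  move=> k hk; have -> : k = (N - (N - k))%N by arith.
  by rewrite lev_dual ?leq_subr //; apply: c2; arith.
move=> Q0 [K0 [[rQ oQ oK sQ] bQ0 bK0 cQ0]].
pose Q : seq (quad L) := Q0; pose K : seq (quad L) := K0.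
have t1 x : (N - m < drk rk N x <= N - r)%N = (r <= rk x < m)%N.
  by rewrite /drk; have := rkN x; clear -mN lm rl; lia.
have t2 x : (N - m <= drk rk N x <= N - r)%N = (r <= rk x <= m)%N.
  by rewrite /drk; have := rkN x; clear -mN lm rl; lia.
have t3 x : (N - m <= drk rk N x < N - r)%N = (r < rk x <= m)%N.
  by rewrite /drk; have := rkN x; clear -mN lm rl; lia.
have t4 x : drk rk N x = (N - r)%N -> rk x = r.
  by rewrite /drk; have := rkN x; clear -mN lm rl; lia.
have t5 x : drk rk N x = (N - r.-1)%N -> (rk x).+1 = r.
  by rewrite /drk; have := rkN x; clear -mN lm rl r0; lia.
exists Q, K; split.
- split=> //; last by move: sQ; rewrite /Q /K => ->; arith.
  by move: rQ; rewrite (eq_all (@rect_dual _ L)).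
- move=> q /bQ0[]; rewrite t1 t2 => h1 h2 h3; split=> // x /h3.
  by rewrite t3.
- move=> q /bK0[]; rewrite t2 e2 => /t4 h1 h2 h3 [f /t5 rf nf].
  by split=> //; [move=> x /h3; rewrite t3 => -[|/t5]; [left|right]|exists f].
- by move=> x; rewrite -t2 => /cQ0.
Qed.

Lemma block_cert_dual N m M bot top : (forall a, (rk a <= N)%N) ->
  (m <= M <= N)%N ->
  @block_cert _ (L^d : finTBDistrLatticeType _) (drk rk N) (N - M) (N - m) top bot ->
  block_cert rk m M bot top.
Proof.
move=> rkN hmM [Q [[rQ oQ sQ] bQ0 cQ0]]; exists Q.
have t1 x : (N - M < drk rk N x < N - m)%N = (m < rk x < M)%N.
  by rewrite /drk; have := rkN x; clear -hmM; lia.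
have t2 x : (N - M <= drk rk N x <= N - m)%N = (m <= rk x <= M)%N.
  by rewrite /drk; have := rkN x; clear -hmM; lia.
have t3 x : (m + ~~ bot <= rk x < M + top)%N ->
    (N - M + ~~ top <= drk rk N x < N - m + bot)%N.
  by rewrite /drk; have := rkN x; clear -hmM; case: bot; case: top => /=; lia.
split.
- split=> //; last by rewrite sQ; clear -hmM; lia.
  by move: rQ; rewrite (eq_all (@rect_dual _ L)).
- by move=> q /bQ0[]; rewrite t1 t2 => h1 h2 h3; split=> // x /h3; rewrite t2.
- by move=> x /t3/cQ0.
Qed.

Lemma block_cert_thin m M : (m < M)%N ->
  (forall k, (m < k < M)%N -> #|lev k| = 2) -> block_cert rk m M false false.
Proof.
move=> mM c2; have [|Q [rQ oQ sQ bQ cQ]] := @middle _ _ _ gr (M - m).-1 m.+1.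
  by move=> k hk; apply: c2; arith.
exists Q; split.
- by split=> //; rewrite !addn0.
- move=> q /bQ[h1 h2 h3]; split; [arith|arith|].
  by move=> x /h3[h|[h _]|[h _]]; arith.
- by move=> x hx; apply: cQ; arith.
Qed.

Lemma block_cert_lower m M r : (m < r < M)%N -> #|lev m| = 1 ->
  (forall k, (m < k < M)%N -> #|lev k| = if k == r then 3 else 2) ->
  m.+1 != r -> r.+1 != M -> block_cert rk m M true false.
Proof.
move=> hr c1 c2 mr rM; have [l el] : exists l, r = l.+1 by exists r.-1; arith.
subst r.
have [||||Q [K [[rQ oQ oK sQ] bQ bK cQ]]] := lower_capP gr (m := m) (l := l) c1.
- by arith.
- move=> k hk; rewrite c2; last by arith.
  by rewrite ifN_eq //; arith.
- by rewrite c2 ?eqxx //; arith.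
- by rewrite c2 ?ifN_eq //; arith.
have [|D [rD oD sD bD cD]] := @middle _ _ _ gr (M - l.+2) l.+2.
  move=> k hk; rewrite c2; last by arith.
  by rewrite ifN_eq //; arith.
(* The joins in the tails of [K] may be pivots of [D], so [D] has to precede [K]. *)
exists (Q ++ D ++ K); split.
- split.
  + by move: rQ; rewrite !all_cat rD => /andP[-> ->].
  + apply/ordered_cat; split=> //; last first.
      apply/ordered_cat; split=> // q q' /bD[_ _ h] /bK[rp _ _ [f rf nf]].
      apply/negP => /h[|[_ h']|[h' _]]; [arith| |arith].
      by move: nf; rewrite h'.
    move=> q q' /bQ[_ _ h]; rewrite mem_cat => /orP[/bD[h' _ _]|/bK[h' _ _ _]];
      apply/negP => /h; arith.
  + by move: sQ; rewrite !size_cat sD /=; arith.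
- move=> q; rewrite !mem_cat => /or3P[/bQ[h1 h2 h3]|/bD[h1 h2 h3]|/bK[h1 h2 h3 _]].
  + by split; [arith|arith|move=> x /h3; arith].
  + by split; [arith|arith|move=> x /h3[h|[h _]|[h _]]; arith].
  + by split; [arith|arith|move=> x /h3[h|h]; arith].
- move=> x hx; case: (ltnP l.+1 (rk x)) => h.
    by apply: leads_sub (cD x _); [move=> q; rewrite !mem_cat => ->; rewrite orbT|arith].
  by apply: leads_sub (cQ x _); [move=> q; rewrite !mem_cat => /orP[]->; rewrite ?orbT|arith].
Qed.

Lemma block_cert_two m M r r' : (m < r < r')%N -> (r' < M)%N -> r.+1 != r' ->
  #|lev m| = 1 -> #|lev M| = 1 ->
  (forall k, (m < k < M)%N -> #|lev k| = if (k == r) || (k == r') then 3 else 2) ->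
  m.+1 != r -> r'.+1 != M -> block_cert rk m M true true.
Proof.
move=> hr hr' nrr c1 c1' c2 mr rM; have [l el] : exists l, r = l.+1 by exists r.-1; arith.
subst r.
have c2' k : (m < k < M)%N -> k != l.+1 -> k != r' -> #|lev k| = 2.
  by move=> hk h1 h2; rewrite c2 // (negbTE h1) (negbTE h2).
have [||||Q [K [[rQ oQ oK sQ] bQ bK cQ]]] := lower_capP gr (m := m) (l := l) c1.
- by arith.
- by move=> k hk; apply: c2'; arith.
- by rewrite c2 ?eqxx //; arith.
- by apply: c2'; arith.
have [||||||Q' [K' [[rQ' oQ' oK' sQ'] bQ' bK' cQ']]] :=
   @upper_capP M r'.+1 c1' _ _ r'.
- by arith.
- by move=> k hk; apply: c2'; arith.
- by [].
- by rewrite c2 ?eqxx ?orbT //; arith.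
- by apply: c2'; arith.
- by arith.
have [|D [rD oD sD bD cD]] := @middle _ _ _ gr (r' - l.+2) l.+2.
  by move=> k hk; apply: c2'; arith.
(* Tails of [K] and [K'] may contain pivots of [D], which precedes both. Since l + 2 < r', the tails
   of [K] stay below level r', where the pivots of [K'] are. *)
exists (Q ++ Q' ++ D ++ K ++ K'); split.
- split.
  + by move: rQ rQ'; rewrite !all_cat rD => /andP[-> ->] /andP[-> ->].
  + apply/ordered_cat; split=> //.
      move=> q q' /bQ[_ _ h]; rewrite !mem_cat => /or4P[];
      [move=> /bQ'[h' _ _]|move=> /bD[h' _ _]|move=> /bK[h' _ _ _]|move=> /bK'[h' _ _ _]];
      apply/negP => /h; arith.
    apply/ordered_cat; split=> //.
      move=> q q' /bQ'[_ _ h]; rewrite !mem_cat => /or3P[];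
      [move=> /bD[h' _ _]|move=> /bK[h' _ _ _]|move=> /bK'[h' _ _ _]];
      apply/negP => /h; arith.
    apply/ordered_cat; split=> //.
      move=> q q' /bD[_ _ h]; rewrite mem_cat => /orP[/bK|/bK'] [rp _ _ [f rf nf]].
        apply/negP => /h[|[_ h']|[h' _]]; [arith| |arith].
        by move: nf; rewrite h'.
      apply/negP => /h[|[h' _]|[h1' h']]; [arith|arith|].
      by move: nf; rewrite h' // rf; arith.
    apply/ordered_cat; split=> //.
    by move=> q q' /bK[_ _ h _] /bK'[rp _ _ _]; apply/negP => /h[]; arith.
  + by move: sQ sQ'; rewrite !size_cat sD /=; arith.
- move=> q; rewrite !mem_cat; case/orP=> [/bQ[h1 h2 h3]|].
    by split; [arith|arith|move=> x /h3; arith].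
  move/or4P=> [/bQ'[h1 h2 h3]|/bD[h1 h2 h3]|/bK[h1 h2 h3 _]|/bK'[h1 h2 h3 _]].
  + by split; [arith|arith|move=> x /h3; arith].
  + by split; [arith|arith|move=> x /h3[h|[h _]|[h _]]; arith].
  + by split; [arith|arith|move=> x /h3[h|h]; arith].
  + by split; [arith|arith|move=> x /h3[h|h]; arith].
- move=> x hx; case: (leqP (rk x) l.+1) => h.
    by apply: leads_sub (cQ x _); [move=> q; rewrite !mem_cat => /orP[]->; rewrite ?orbT|arith].
  case: (leqP r' (rk x)) => h'.
    by apply: leads_sub (cQ' x _); [move=> q; rewrite !mem_cat => /orP[]->; rewrite ?orbT|arith].
  by apply: leads_sub (cD x _); [move=> q; rewrite !mem_cat => ->; rewrite ?orbT|arith].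
Qed.

End Blocks.

(** * Gluing transports around two adjacent three-element levels *)

Section Sandwich.

Context {disp : Order.disp_t} {L : finTBDistrLatticeType disp}.
Implicit Types (a b c x y z : L) (q : quad L) (Q S K : seq (quad L)).
Context (rk : L -> nat) (gr : graded rk).

Notation lev := (lev rk).
Notation pair_lev := (pair_lev rk).
Notation triple_lev := (triple_lev rk).

(** Meant for levels l + 1 and l + 2 of three elements. The two transports take all that lies
    outside levels l to l + 3, together with a \/ b and c /\ d. The eight other elements of these
    four levels are left to the four quads of [S] and [K]; the quad of [S] is of the kind that may
    be inserted between [Q1] and [Q2]. *)
Lemma sandwich m M l a b c d S K :
  #|lev m| = 1 -> #|lev M| = 1 -> (m < l)%N -> (l.+3 < M)%N ->
  (forall k, (m < k <= l)%N -> #|lev k| = 2) ->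
  (forall k, (l.+3 <= k < M)%N -> #|lev k| = 2) ->
  pair_lev l a b -> pair_lev l.+3 c d ->
  S = [::] \/ S = [:: ((a, c), (a `&` b, c `|` d))] ->
  all rect (S ++ K) -> ordered K -> (size S + size K)%N = 4 ->
  {in K, forall q, [/\ (l < rk (pivot q) < l.+3)%N, (m <= rk (partner q) <= M)%N &
     {in tail q, forall x, (m <= rk x <= M)%N}]} ->
  (forall x, (l <= rk x <= l.+3)%N ->
     [\/ x = a `|` b, x = c `&` d | x \in leads (S ++ K)]) ->
  block_cert rk m M true true.
Proof.
move=> c1 c1' ml lM c2 c2' hab hcd hS rSK oK sSK bK cK.
have [Q1 [Q2 [w [u [z [[rQ rw oQ sQ] [iw iu zab] bQ cQ [s1 s2]]]]]]] :=
  transport_lower gr c1 ml c2 hab.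
have [P1 [P2 [w' [u' [z' [[rP rw' oP sP] [iw' iu' zcd] bP cP _]]]]]] :=
  transport_upper gr c1' lM c2' hcd.
have [Q eQ] : {Q | Q = Q1 ++ Q2} by exists (Q1 ++ Q2).
have [P eP] : {P | P = P1 ++ P2} by exists (P1 ++ P2).
rewrite -eQ in rQ oQ sQ bQ cQ; rewrite -eP in rP oP sP bP cP.
have [ab ra rb hl] := hab; have [cd rc rd hl'] := hcd.
have rm := pair_meet gr hab; have rj := pair_join gr hab.
have rm' := pair_meet gr hcd; have rj' := pair_join gr hcd.
pose h := ((a `|` b, w), (u, z)) : quad L.
pose h' := ((c `&` d, w'), (u', z')) : quad L.
have tQ q : q \in Q -> {in tail q, forall x, (m <= rk x <= l)%N}.
  by move=> /bQ[_ _ e] x /e[|[]->]; arith.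
have tP q : q \in P -> {in tail q, forall x, (l.+3 <= rk x <= M)%N}.
  by move=> /bP[_ _ e] x /e[|[]->]; arith.
have th : {in tail h, forall x, (m <= rk x <= l)%N}.
  move=> x; rewrite !inE /= => /orP[]/eqP->; last by case: zab => ->; arith.
  by case: iu => [|[]->]; arith.
have th' : {in tail h', forall x, (l.+3 <= rk x <= M)%N}.
  move=> x; rewrite !inE /= => /orP[]/eqP->; last by case: zcd => ->; arith.
  by case: iu' => [|[]->]; arith.
have pQ q : q \in Q -> (m < rk (pivot q) < l)%N by case/bQ.
have bS q : q \in S -> [/\ pivot q = a, partner q = c & tail q = [:: a `&` b; c `|` d]].
  by case: hS => ->; rewrite ?inE // => /eqP->.
have oS : ordered S by case: hS => ->.
have subQ1 : {subset Q1 <= Q} by move=> q; rewrite eQ mem_cat => ->.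
have subQ2 : {subset Q2 <= Q} by move=> q; rewrite eQ mem_cat => ->; rewrite orbT.
(* [P] is first because c \/ d, in the tail of [S], may be one of its pivots; [K] is last because
   its tails may lie anywhere between m and M. *)
pose R := P ++ Q1 ++ S ++ Q2 ++ h :: h' :: K.
have memR q : q \in R -> [\/ q \in P, q \in Q, q \in S | [\/ q = h, q = h' | q \in K]].
  rewrite !mem_cat !inE => /or4P[e|e|e|/or4P[e|/eqP e|/eqP e|e]].
  - by constructor 1.
  - by constructor 2; exact: subQ1.
  - by constructor 3.
  - by constructor 2; exact: subQ2.
  - by constructor 4; constructor 1.
  - by constructor 4; constructor 2.
  - by constructor 4; constructor 3.
have sub1 : {subset P <= R} by move=> q e; rewrite mem_cat e.
have sub2 : {subset Q <= R}.
  by move=> q; rewrite eQ mem_cat => /orP[]e; rewrite !mem_cat e ?orbT.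
have sub3 : {subset S ++ K <= R}.
  by move=> q; rewrite mem_cat => /orP[]e; rewrite !mem_cat ?inE e ?orbT.
have hR : h \in R by rewrite !mem_cat !inE eqxx ?orbT.
have h'R : h' \in R by rewrite !mem_cat !inE eqxx ?orbT.
exists R; split.
- split.
  + move: rQ rSK; rewrite eQ !all_cat /= rw rw' rP.
    by move=> /andP[-> ->] /andP[-> ->].
  + have ohK : ordered (h :: h' :: K).
      rewrite /ordered /= -/(ordered K) oK andbT.
      apply/andP; split; last first.
        by apply/allP => q /bK[e _ _]; apply/negP => /th'; arith.
      apply/andP; split; first by apply/negP => /th /=; arith.
      by apply/allP => q /bK[e _ _]; apply/negP => /th; arith.
    have phK q : q \in h :: h' :: K -> (l < rk (pivot q) < l.+3)%N.
      by rewrite !inE => /or3P[/eqP->|/eqP->|/bK[]] //=; arith.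
    apply/ordered_cat; split=> //.
      move=> q q' /tP e; rewrite !mem_cat => /or4P[/subQ1/pQ r|/bS[-> _ _]|/subQ2/pQ r|/phK r];
      by apply/negP => /e; arith.
    move: (oQ); rewrite eQ => /ordered_cat[o12 o1 o2].
    apply/ordered_cat; split=> //.
      move=> q q' qQ; rewrite !mem_cat => /or3P[/bS[-> _ _]|/(o12 _ _ qQ)|/phK e] //.
        exact: s1.
      by apply/negP => /(tQ _ (subQ1 _ qQ)); arith.
    apply/ordered_cat; split=> //.
      move=> q q' /bS[_ _ ->]; rewrite mem_cat !inE negb_or => /orP[q'Q|/phK e].
        rewrite s2 //=; apply/eqP => e.
        by have := pQ _ (subQ2 _ q'Q); rewrite e; arith.
      by apply/andP; split; apply/eqP => e'; move: e; rewrite e'; arith.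
    apply/ordered_cat; split=> //.
    by move=> q q' /subQ2/tQ e /phK e'; apply/negP => /e; arith.
  + have aux (p q1 s q2 k : nat) : (s + k = 4 -> q1 + q2 = (l - m).-1 ->
        p = (M - l.+3).-1 -> p + (q1 + (s + (q2 + k.+2))) = (M - m).-1 + 1 + 1)%N.
      by arith.
    by move: sSK sQ sP; rewrite /R eQ !size_cat; exact: aux.
- move=> q /memR[/bP[e1 e2 e3]|/bQ[e1 e2 e3]|/bS[-> -> ->]|[->|->|/bK[e1 e2 e3]]].
  + split; [arith|arith|].
    by move=> x /e3[|[]->]; arith.
  + split; [arith|arith|].
    by move=> x /e3[|[]->]; arith.
  + split; [arith|arith|].
    by move=> x; rewrite !inE => /orP[]/eqP->; arith.
  + split; rewrite /=; [arith|arith|].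
    by move=> x /th; arith.
  + split; rewrite /=; [arith|arith|].
    by move=> x /th'; arith.
  + by split=> //; arith.
- move=> x /= hx; case: (ltnP (rk x) l) => e.
    have [|->|] := cQ x; first by arith.
      by apply/leadsP; exists h; rewrite // !inE /= eqxx orbT.
    exact: leads_sub.
  case: (ltnP l.+3 (rk x)) => e'.
    have [|->|] := cP x; first by arith.
      by apply/leadsP; exists h'; rewrite // !inE /= eqxx orbT.
    exact: leads_sub.
  have [|->|->|] := cK x; first by arith.
  - by apply/leadsP; exists h; rewrite // !inE /= eqxx.
  - by apply/leadsP; exists h'; rewrite // !inE /= eqxx.
  - exact: leads_sub.
Qed.

(** The same count when level l + 3 is the upper apex: without a \/ b, levels l to l + 3 leave 2 + 2
    + 3 + 1 = 8 elements to [K], the apex among them. *)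
Lemma half_sandwich m l a b K :
  #|lev m| = 1 -> #|lev l.+3| = 1 -> (m < l)%N ->
  (forall k, (m < k <= l)%N -> #|lev k| = 2) ->
  pair_lev l a b -> all rect K -> ordered K -> size K = 4 ->
  {in K, forall q, [/\ (l < rk (pivot q) < l.+3)%N, (m <= rk (partner q) <= l.+3)%N &
     {in tail q, forall x, (m <= rk x <= l.+3)%N}]} ->
  (forall x, (l <= rk x <= l.+3)%N -> x = a `|` b \/ x \in leads K) ->
  block_cert rk m l.+3 true true.
Proof.
move=> c1 c1' ml c2 hab rK oK sK bK cK.
have [Q1 [Q2 [w [u [z [[rQ rw oQ sQ] [iw iu zab] bQ cQ _]]]]]] :=
  transport_lower gr c1 ml c2 hab.
have [Q eQ] : {Q | Q = Q1 ++ Q2} by exists (Q1 ++ Q2).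
rewrite -eQ in rQ oQ sQ bQ cQ.
have [ab ra rb hl] := hab.
have rm := pair_meet gr hab; have rj := pair_join gr hab.
pose h := ((a `|` b, w), (u, z)) : quad L.
have tQ q : q \in Q -> {in tail q, forall x, (m <= rk x <= l)%N}.
  by move=> /bQ[_ _ e] x /e[|[]->]; arith.
have th : {in tail h, forall x, (m <= rk x <= l)%N}.
  move=> x; rewrite !inE /= => /orP[]/eqP->; last by case: zab => ->; arith.
  by case: iu => [|[]->]; arith.
have memR q : q \in Q ++ h :: K -> [\/ q \in Q, q = h | q \in K].
  by rewrite mem_cat inE => /or3P[|/eqP|] ?;
    [constructor 1|constructor 2|constructor 3].
have hR : h \in Q ++ h :: K by rewrite !mem_cat !inE eqxx ?orbT.
exists (Q ++ h :: K); split.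
- split.
  + by rewrite all_cat /= rQ rw.
  + apply/ordered_cat; split=> //.
      by move=> q q' /tQ e; rewrite inE => /orP[/eqP->|/bK[e' _ _]];
        apply/negP => /e /=; arith.
    rewrite /ordered /= -/(ordered K) oK andbT.
    by apply/allP => q /bK[e _ _]; apply/negP => /th; arith.
  + have aux (p : nat) : (p = (l - m).-1 -> p + 5 = (l.+3 - m).-1 + 1 + 1)%N by arith.
    by move: sQ; rewrite size_cat /= sK; exact: aux.
- move=> q /memR[/bQ[e1 e2 e3]|->|/bK[e1 e2 e3]].
  + split; [arith|arith|].
    by move=> x /e3[|[]->]; arith.
  + split; rewrite /=; [arith|arith|].
    by move=> x /th; arith.
  + by split=> //; arith.
- move=> x /= hx; case: (ltnP (rk x) l) => e.
    have [|->|] := cQ x; first by arith.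
      by apply/leadsP; exists h; rewrite // !inE /= eqxx orbT.
    by apply: leads_sub => q qQ; rewrite mem_cat qQ.
  have [|->|] := cK x; first by arith.
  - by apply/leadsP; exists h; rewrite // !inE /= eqxx.
  - by apply: leads_sub => q qQ; rewrite mem_cat inE qQ !orbT.
Qed.

End Sandwich.

(** * Boolean cubes spanned by three covers of one element *)

Section Cube.

Context {disp : Order.disp_t} {L : finTBDistrLatticeType disp}.
Implicit Types (a b c x y z : L) (q : quad L) (Q S K : seq (quad L)).
Context (rk : L -> nat) (gr : graded rk).

Notation lev := (lev rk).
Notation pair_lev := (pair_lev rk).
Notation triple_lev := (triple_lev rk).

Lemma rk_neq x y : rk x != rk y -> x != y.
Proof. by apply: contra_neq => ->. Qed.

Lemma triple_lev_full k x y z : #|lev k| = 3 ->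
  rk x = k -> rk y = k -> rk z = k -> x != y -> x != z -> y != z ->
  triple_lev k x y z.
Proof.
move=> c3 rx ry rz xy xz yz; split=> // e re.
have [e1|e1] := eqVneq e x; first by constructor 1.
have [e2|e2] := eqVneq e y; first by constructor 2.
have [e3|e3] := eqVneq e z; first by constructor 3.
have h : lev k :\ e = lev k :\ e by [].
have : (2 < #|lev k :\ e|)%N.
  have <- : #|[set x; y; z]| = 3.
    rewrite setUC cardsU1 cards2 xy !inE negb_or.
    by rewrite (eq_sym z x) (eq_sym z y) xz yz.
  apply/subset_leq_card/subsetP => f; rewrite !inE.
  by move=> /orP[/orP[]|] /eqP->; rewrite ?rx ?ry ?rz eqxx andbT eq_sym.
have el : e \in lev k by rewrite inE re.
by move: c3; rewrite (cardsD1 e) el add1n => -[->].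
Qed.

Lemma third k x y : #|lev k| = 3 -> rk x = k -> rk y = k -> x != y ->
  exists z, triple_lev k x y z.
Proof.
move=> c3 rx ry xy; have [a [b [[xa xb ab] [_ ra rb] h]]] := card_lev3 c3 rx.
have [e|e|e] := h _ ry; first by rewrite e eqxx in xy.
  by exists b; apply: triple_lev_full; rewrite ?e.
by exists a; apply: triple_lev_full => //; rewrite e // eq_sym.
Qed.

Lemma cover_above k x y : rk x = k -> rk y = k -> x != y ->
  exists2 c, x <= c & rk c = k.+1.
Proof.
move=> rx ry xy; have [_ _ up _] := gr.
have lt : x < x `|` y.
  rewrite lt_neqAle leUl andbT; apply: contraNneq xy => h.
  by apply/eqP/esym/(eq_rk gr); rewrite ?rx ?ry // h leUr.
by have [c /andP[/ltW cx _] rc] := up _ _ lt; exists c; rewrite // rc rx.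
Qed.

(** The bottom and the atoms of a Boolean lattice of rank three, whose coatoms are the pairwise
    joins of h, u and v. *)
Definition cube l a h u v : Prop :=
  [/\ rk a = l, [/\ rk h = l.+1, rk u = l.+1 & rk v = l.+1],
      [/\ h != u, h != v & u != v] & [/\ a <= h, a <= u & a <= v]].

Lemma cubeC l a h u v : cube l a h u v -> cube l a u h v.
Proof. by case=> ra [rh ru rv] [hu hv uv] [ah au av]; split=> //; split=> //; rewrite eq_sym. Qed.

Lemma cubeCA l a h u v : cube l a h u v -> cube l a h v u.
Proof. by case=> ra [rh ru rv] [hu hv uv] [ah au av]; split=> //; split=> //; rewrite eq_sym. Qed.

Section CubeLevels.

Context (l : nat) (a h u v : L) (cb : cube l a h u v).

Lemma cube_meet : h `&` u = a.
Proof.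
case: cb => ra [rh ru rv] [hu hv uv] [ah au av].
exact: (meet_cover gr hu rh ru ra).
Qed.

Lemma cube_rk : rk (h `|` u) = l.+2.
Proof.
case: cb => ra [rh ru rv] [hu hv uv] [ah au av].
exact: (rk_join_cover gr hu rh ru ra).
Qed.

Lemma cube_neq : h `|` u != h `|` v.
Proof.
case: cb => ra [rh ru rv] [hu hv uv] [ah au av].
exact: (join_cancel gr rh ru rv ra).
Qed.

End CubeLevels.

Section CubeCert.

Context (l : nat) (a h u v : L) (cb : cube l a h u v).
Let cb1 := cubeC cb.
Let cb2 := cubeCA cb.

Lemma cube_rk_top : rk (h `|` u `|` v) = l.+3.
Proof.
case: (cb) => ra [rh ru rv] [hu hv uv] [ah au av].
have <- : (h `|` u) `|` (h `|` v) = h `|` u `|` v.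
  by rewrite joinACA joinxx joinA.
by apply: (rk_join_cover gr (cube_neq cb) (cube_rk cb) (cube_rk cb2) rh);
  rewrite leUl.
Qed.

Lemma cube_meet_opp : u `&` (h `|` v) = a.
Proof. by rewrite meetUr (cube_meet cb1) (cube_meet (cubeCA cb1)) joinxx. Qed.

Lemma cube_opp : rect ((u, h `|` v), (a, h `|` u `|` v)).
Proof.
case: (cb) => ra [rh ru rv] [hu hv uv] [ah au av].
have e := cube_meet_opp.
apply: rect_incomp => //; last by rewrite joinCA joinA.
by apply: (@incomp _ _ rk _ _ _ e); rewrite ?ra ?ru ?(cube_rk cb2).
Qed.

Lemma cube_down : rect ((h `|` u, a), (h, u)).
Proof.
case: (cb) => ra [rh ru rv] [hu hv uv] [ah au av].
have e := cube_meet cb.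
apply: rect_join_meet => //.
by apply: (@incomp _ _ rk _ _ _ e); rewrite ?ra ?ru ?rh.
Qed.

Lemma cube_up : rect ((v, h `|` u `|` v), (h `|` v, u `|` v)).
Proof.
case: (cb) => ra [rh ru rv] [hu hv uv] [ah au av].
have e : (h `|` v) `&` (u `|` v) = v.
  by rewrite -joinIl (cube_meet cb) (join_r av).
apply: rect_meet_join => //.
  by apply: (@incomp _ _ rk _ _ _ e);
    rewrite rv ?(cube_rk cb2) ?(cube_rk (cubeCA cb1)).
by rewrite joinACA joinxx.
Qed.

(** The leads are all the elements of the cube except the atom h and the opposite coatom u \/ v;
    what happens to these two depends on the surroundings of the cube. *)
Definition cube_core : seq (quad L) :=
  [:: ((u, h `|` v), (a, h `|` u `|` v)); ((h `|` u, a), (h, u));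
      ((v, h `|` u `|` v), (h `|` v, u `|` v))].

Lemma cube_coreP :
  [/\ all rect cube_core, ordered cube_core &
    {in cube_core, forall q, [/\ (l < rk (pivot q) < l.+3)%N,
      (l <= rk (partner q) <= l.+3)%N & {in tail q, forall x, (l <= rk x <= l.+3)%N}]}].
Proof.
case: (cb) => ra [rh ru rv] [hu hv uv] [ah au av].
have rhu := cube_rk cb; have rhv := cube_rk cb2; have ruv := cube_rk (cubeCA cb1).
have rt := cube_rk_top; split.
- by rewrite /= cube_opp cube_down cube_up.
- rewrite /ordered /= !inE !negb_or !andbT.
  by rewrite (eq_sym v h) hv (eq_sym v u) uv !rk_neq //; rewrite ?rhu ?rhv ?ruv ?ra ?rt ?rv; lia.
- move=> q; rewrite !inE => /or3P[] /eqP-> /=;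
  by split; [arith|arith|move=> x; rewrite !inE /= => /orP[]/eqP->; arith].
Qed.

End CubeCert.

Lemma cube_lev l a h u v : cube l a h u v -> #|lev l.+1| = 3 -> #|lev l.+2| = 3 ->
  triple_lev l.+1 h u v /\ triple_lev l.+2 (h `|` u) (h `|` v) (u `|` v).
Proof.
move=> cb c3 c3'; case: (cb) => ra [rh ru rv] [hu hv uv] [ah au av].
have cb1 := cubeC cb; split; first exact: triple_lev_full.
apply: triple_lev_full => //.
- exact: cube_rk cb.
- exact: cube_rk (cubeCA cb).
- exact: cube_rk (cubeCA cb1).
- exact: cube_neq cb.
- by rewrite joinC; exact: cube_neq cb1.
- by rewrite [h `|` v]joinC [u `|` v]joinC; exact: cube_neq (cubeC (cubeCA cb)).
Qed.

Lemma block_cert_cube l :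
  #|lev l| = 1 -> #|lev l.+3| = 1 -> #|lev l.+1| = 3 -> #|lev l.+2| = 3 ->
  block_cert rk l l.+3 true true.
Proof.
move=> c1 c1' c3 c3'.
have [h rh] : exists h, rk h = l.+1.
  have /card_gt0P[h] : (0 < #|lev l.+1|)%N by rewrite c3.
  by rewrite inE => /eqP; exists h.
have [u [v [[hu hv uv] [_ ru rv] hx]]] := card_lev3 c3 rh.
have [a ah ra] := cover_below gr rh ru hu.
have [uh vh] : u != h /\ v != h by rewrite eq_sym hu eq_sym hv.
have au : a <= u.
  by have [a' ? ra'] := cover_below gr ru rh uh; rewrite (card_lev1 c1 ra ra').
have av : a <= v.
  by have [a' ? ra'] := cover_below gr rv rh vh; rewrite (card_lev1 c1 ra ra').
have cb : cube l a h u v by split.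
have [[_ _ f1] [_ _ f2]] := cube_lev cb c3 c3'.
have [rK oK bK] := cube_coreP cb; have rt := cube_rk_top cb.
have e : u `|` h `|` v = h `|` u `|` v by rewrite [u `|` h]joinC.
(* The block is the cube itself, so the two elements left by [cube_core] are matched with each
   other. *)
exists (((h, u `|` v), (a, h `|` u `|` v)) :: cube_core a h u v); split.
- split.
  + by move: rK (cube_opp (cubeC cb)); rewrite e /= => -> ->.
  + rewrite ordered_cons oK andbT.
    by apply/allP => q /bK[h1 _ _]; rewrite !inE negb_or;
      apply/andP; split; apply: rk_neq; rewrite /= ?ra ?rt; clear -h1; lia.
  + by clear; rewrite /=; lia.
- move=> q; rewrite inE => /orP[/eqP->|/bK[h1 h2 h3]].
    rewrite /= (cube_rk (cubeCA (cubeC cb))) rh; split; [by clear; lia|by clear; lia|].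
    by move=> x; rewrite !inE /= => /orP[]/eqP->; clear -ra rt; lia.
  by split.
- move=> x /=; rewrite addn0 addn1 ltnS => hxl.
  have [r|[r|[r|r]]] : rk x = l \/ rk x = l.+1 \/ rk x = l.+2 \/ rk x = l.+3.
    by clear -hxl; lia.
  + by rewrite (card_lev1 c1 r ra) !inE eqxx ?orbT.
  + by have [->|->|->] := f1 _ r; rewrite !inE eqxx ?orbT.
  + by have [->|->|->] := f2 _ r; rewrite !inE eqxx ?orbT.
  + by rewrite (card_lev1 c1' r rt) !inE eqxx ?orbT.
Qed.

End Cube.

(** * Two adjacent three-element levels next to two-element levels *)

Section Adjacent.

Context {disp : Order.disp_t} {L : finTBDistrLatticeType disp}.
Implicit Types (a b c x y z : L) (q : quad L) (Q S K : seq (quad L)).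
Context (rk : L -> nat) (gr : graded rk).

Notation lev := (lev rk).
Notation pair_lev := (pair_lev rk).
Notation triple_lev := (triple_lev rk).

(* If two of the three elements of a level are above different elements of the
   level below, the same holds, dually, one level up. *)
Lemma no_top_of_split l a b u v w t : pair_lev l a b -> #|lev l| = 2 ->
  triple_lev l.+1 (a `|` b) u v -> a <= u -> b <= v ->
  triple_lev l.+2 (a `|` b `|` u) (a `|` b `|` v) w ->
  rk t = l.+3 -> a `|` b `|` u <= t -> a `|` b `|` v <= t -> w <= t -> False.
Proof.
move=> hab c2 huv au bv [[n12 n1w n2w] [r1 r2 rw] hx] rt l1 l2 lw.
have [[ju jv uv] [rj ru rv] hy] := huv; have [ab ra rb hl] := hab.
have nvu : ~~ (v <= a `|` b `|` u).
  apply/negP => h; apply: (no_triple_below gr _ rj ru rv ju jv uv r1); rewrite ?c2 //.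
    exact: leUl.
  exact: leUr.
have nuv : ~~ (u <= a `|` b `|` v).
  apply/negP => h; apply: (no_triple_below gr _ rj ru rv ju jv uv r2); rewrite ?c2 //.
    exact: leUl.
  exact: leUr.
have m12 : (a `|` b `|` u) `&` (a `|` b `|` v) = a `|` b.
  by apply: (meet_cover gr n12 r1 r2 rj); rewrite leUl.
have [w1 w2] : w != a `|` b `|` u /\ w != a `|` b `|` v by rewrite eq_sym n1w eq_sym n2w.
have rm x : w != x -> rk x = l.+2 -> x <= t -> rk (w `&` x) = l.+1.
  by move=> wx rx xt; have [] := rk_meet_cover gr wx rw rx rt lw xt.
have n1 : w `&` (a `|` b `|` u) != a `|` b.
  rewrite meetC; have := meet_cancel gr r1 rw r2 rt l1 lw l2 n1w n12 _.
  by rewrite m12; apply; rewrite eq_sym.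
have n2 : w `&` (a `|` b `|` v) != a `|` b.
  rewrite meetC; have := meet_cancel gr r2 rw r1 rt l2 lw l1 n2w _ w1.
  by rewrite [_ `&` (a `|` b `|` u)]meetC m12; apply; rewrite eq_sym.
have uw : u <= w.
  have [e|e|e] := hy _ (rm _ w1 r1 l1); first by rewrite e eqxx in n1.
    by rewrite -e leIl.
  by rewrite -e leIr in nvu.
have vw : v <= w.
  have [e|e|e] := hy _ (rm _ w2 r2 l2); first by rewrite e eqxx in n2.
    by rewrite -e leIr in nuv.
  by rewrite -e leIl.
move/eqP: n1w; apply; apply: (eq_rk gr); last by rewrite rw r1.
by rewrite !leUx uw (le_trans au uw) (le_trans bv vw).
Qed.

Section Half.

Variables (m l : nat).
Hypotheses (ml : (m < l)%N) (c1 : #|lev m| = 1) (c1' : #|lev l.+3| = 1).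
Hypothesis c2 : forall k, (m < k <= l)%N -> #|lev k| = 2.
Hypotheses (c3 : #|lev l.+1| = 3) (c3' : #|lev l.+2| = 3).

Lemma cube_of_pair a b u v : pair_lev l a b -> triple_lev l.+1 (a `|` b) u v ->
  a <= u -> a <= v -> cube rk l a (a `|` b) u v.
Proof. by move=> [ab ra rb _] [hd hr _] au av; split=> //; split=> //; exact: leUl. Qed.

(** The split shape of [triple_above] cannot occur here: the apex at level l + 3 would be above all
    of level l + 2, against [no_top_of_split]. In the cube shape, a \/ b goes to the transport and u
    \/ v is matched with b. *)
Lemma block_cert_half_cube : block_cert rk m l.+3 true true.
Proof.
have c2l : #|lev l| = 2 by apply: c2; rewrite ml leqnn.
have [a [b [u [v [hab huv au bu hv]]]]] := triple_above gr c2l c3.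
have [[ju jv uv] [rj ru rv] hy] := huv; have [ab ra rb hl] := hab.
have rm := pair_meet gr hab.
case: hv => -[bv av].
  have rju : rk (a `|` b `|` u) = l.+2 by apply: (rk_join_cover gr _ rj ru ra); rewrite ?leUl.
  have rjv : rk (a `|` b `|` v) = l.+2 by apply: (rk_join_cover gr _ rj rv rb); rewrite ?leUr.
  have n12 : a `|` b `|` u != a `|` b `|` v.
    apply: contraTneq isT => e; exfalso.
    apply: (no_triple_below gr _ rj ru rv ju jv uv rju); rewrite ?c2l ?leUl ?leUr //.
    by rewrite e leUr.
  have [w hw] := third c3' rju rjv n12.
  have [_ [_ _ rw] _] := hw.
  have up x y : rk x = l.+2 -> rk y = l.+2 -> x != y -> forall t, rk t = l.+3 -> x <= t.
    move=> rx ry xy t rt; have [c xc rc] := cover_above gr rx ry xy.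
    by rewrite (card_lev1 c1' rt rc).
  have [t rt] : exists t, rk t = l.+3.
    have [c _ rc] := cover_above gr rju rjv n12; by exists c.
  have [[_ n1w n2w] _ _] := hw.
  case: (no_top_of_split hab c2l huv au bv hw rt).
  - exact: up rju rjv n12 t rt.
  - by apply: up rjv rju _ t rt; rewrite eq_sym.
  - by apply: up rw rju _ t rt; rewrite eq_sym.
have cb := cube_of_pair hab huv au bv.
have [f1 [_ [rhu rhv ruv] f2]] := cube_lev gr cb c3 c3'.
have [rK oK bK] := cube_coreP gr cb; have rt := cube_rk_top gr cb.
have eBuv : (u `|` v) `&` b = a `&` b.
  have {1}-> : b = (a `|` b) `&` b by rewrite meetC joinKIC.
  by rewrite meetA [_ `&` (a `|` b)]meetC meetUr (cube_meet gr cb)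
     (cube_meet gr (cubeCA cb)) joinxx.
have jBuv : (u `|` v) `|` b = a `|` b `|` u `|` v.
  by rewrite -{1}(join_r au) joinC !joinA [b `|` a]joinC.
have hba := pair_levC hab.
pose q0 := ((u `|` v, b), (a `&` b, a `|` b `|` u `|` v)) : quad L.
have rq0 : rect q0.
  by apply: rect_incomp => //; apply: (@incomp _ _ rk _ _ _ eBuv); rewrite ?ruv ?rb; arith.
apply: (half_sandwich (K := q0 :: cube_core a (a `|` b) u v) gr c1 c1' ml c2 hab).
- by rewrite /= rq0; move: rK => /= ->.
- rewrite ordered_cons oK andbT.
  apply/allP => q /bK[h1 _ _].
  rewrite (_ : tail q0 = [:: a `&` b; a `|` b `|` u `|` v]) // !inE negb_or.
  by apply/andP; split; apply: contraTneq h1 => ->; rewrite ?rt; clear -rm; lia.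
- by [].
- move=> q; rewrite inE => /orP[/eqP->|/bK[h1 h2 h3]].
    rewrite /= ruv rb; split; [by clear; lia|by clear -ml; lia|].
    by move=> x; rewrite !inE /= => /orP[]/eqP->; rewrite ?rt; clear -rm ml; lia.
  split; [by []|by clear -h2 ml; lia|move=> x /h3; clear -ml; lia].
- move=> x hx.
  have [r|[r|[r|r]]] : rk x = l \/ rk x = l.+1 \/ rk x = l.+2 \/ rk x = l.+3.
    by clear -hx; lia.
  + by right; have [->|->] := hl _ r; rewrite !inE eqxx ?orbT.
  + by have [->|->|->] := hy _ r; [left|right|right]; rewrite ?inE ?eqxx ?orbT.
  + by right; have [->|->|->] := f2 _ r; rewrite !inE eqxx ?orbT.
  + by right; rewrite (card_lev1 c1' r rt) !inE eqxx ?orbT.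
Qed.

End Half.

Section Full.

Variables (m l M : nat).
Hypotheses (ml : (m < l)%N) (lM : (l.+3 < M)%N).
Hypotheses (c1 : #|lev m| = 1) (c1' : #|lev M| = 1).
Hypothesis c2 : forall k, (m < k <= l)%N -> #|lev k| = 2.
Hypothesis c2' : forall k, (l.+3 <= k < M)%N -> #|lev k| = 2.
Hypotheses (c3 : #|lev l.+1| = 3) (c3' : #|lev l.+2| = 3).

(** The split shape, in the position where the meet of level l + 3 is the element over u. Then w /\
    d = u, so w and d form a lead, and likewise a \/ b \/ v and c, whose meet is a \/ b. *)
Lemma block_cert_planar a b u v w c d :
  pair_lev l a b -> triple_lev l.+1 (a `|` b) u v ->
  a <= u -> ~~ (b <= u) -> b <= v -> ~~ (a <= v) ->
  triple_lev l.+2 (a `|` b `|` u) (a `|` b `|` v) w ->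
  pair_lev l.+3 d c -> a `|` b `|` u <= d -> a `|` b `|` v <= d ->
  d `&` c = a `|` b `|` u -> w <= c -> block_cert rk m M true true.
Proof.
move=> hab huv au bu bv av hw hdc lud lvd edc wc.
have [[ju jv uv] [rj ru rv] hy] := huv; have [ab ra rb hl] := hab.
have [[n12 n1w n2w] [r1 r2 rw] hz] := hw; have [dc rd rc hd] := hdc.
have rm := pair_meet gr hab; have rt := pair_join gr hdc.
have c2l : #|lev l| = 2 by apply: c2; rewrite ml leqnn.
have c2l' : #|lev l.+3| = 2 by apply: c2'; rewrite leqnn.
have luc : a `|` b `|` u <= c by rewrite -edc leIr.
have w1 : w != a `|` b `|` u by rewrite eq_sym.
have nvu : ~~ (v <= a `|` b `|` u).
  apply/negP => h; apply: (no_triple_below gr _ rj ru rv ju jv uv r1); rewrite ?c2l //.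
    exact: leUl.
  exact: leUr.
have rwu : rk (w `&` (a `|` b `|` u)) = l.+1.
  by have [] := rk_meet_cover gr w1 rw r1 rc wc luc.
have ewu : w `&` (a `|` b `|` u) = u.
  have [e|//|e] := hy _ rwu; last by rewrite -e leIr in nvu.
  exfalso; apply: (no_triple_above gr _ r1 r2 rw n12 n1w n2w rj);
    rewrite ?c2l' ?leUl //.
  by rewrite -e leIl.
have wd : w `&` d = u.
  by rewrite -(meet_l wc) -meetA [c `&` d]meetC edc.
have wdj : w `|` d = d `|` c.
  rewrite -(join_r lud) joinA (join_cover gr w1 rw r1 rc wc luc).
  by rewrite (join_r lud) joinC.
have e1 : (a `|` b `|` v) `&` c = a `|` b.
  rewrite -(meet_l lvd) -meetA edc meetC.
  by apply: (meet_cover gr n12 r1 r2 rj); rewrite leUl.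
have e2 : (a `|` b `|` v) `|` c = d `|` c.
  rewrite -(join_r luc) joinA [_ `|` (a `|` b `|` u)]joinC (join_r luc).
  by rewrite (join_cover gr n12 r1 r2 rd lud lvd).
have hba := pair_levC hab.
have n21 : a `|` b `|` v != a `|` b by apply: (@rk_neq _ _ rk); rewrite r2 rj; clear; lia.
pose K := [:: ((a `|` b `|` v, c), (a `|` b, d `|` c));
   ((u, b), (b `&` a, b `|` a `|` u)); ((v, a), (a `&` b, a `|` b `|` v));
   ((w, d), (u, d `|` c))] : seq (quad L).
have hcd := pair_levC hdc.
apply: (sandwich (K := K) (S := [::]) gr c1 c1' ml lM c2 c2' hab hcd).
- by left.
- apply/and5P; split; rewrite ?(rect_side gr hab) ?(rect_side gr hba) //.
    apply: rect_incomp => //.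
    by apply: (@incomp _ _ rk _ _ _ e1); rewrite rj ?r2 ?rc; clear; lia.
  apply: rect_incomp => //.
  by apply: (@incomp _ _ rk _ _ _ wd); rewrite ru ?rw ?rd; clear; lia.
- rewrite /ordered /= !inE /= !negb_or !andbT [b `|` a]joinC.
  rewrite (eq_sym u (a `|` b)) ju (eq_sym v (a `|` b)) jv w1 (eq_sym w (a `|` b `|` v)) n2w.
  rewrite [b `&` a]meetC.
  rewrite !(@rk_neq _ _ rk) //; rewrite ?ru ?rv ?rw ?rt ?rj ?r1 ?r2 //; by clear -rm; lia.
- by [].
- have rm' : (rk (b `&` a)).+1 = l by rewrite meetC.
  have r1' : rk (b `|` a `|` u) = l.+2 by rewrite [b `|` a]joinC.
  move=> q; rewrite !inE => /or4P[] /eqP-> /=; rewrite ?ru ?rv ?rw ?r2 ?rb ?ra ?rc ?rd;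
  split; try (by clear -ml lM; lia); move=> x; rewrite !inE /= => /orP[]/eqP->;
  rewrite ?rj ?rt ?r1' ?r2 ?ru; by clear -ml lM rm rm'; lia.
- move=> x hx.
  have [r|[r|[r|r]]] : rk x = l \/ rk x = l.+1 \/ rk x = l.+2 \/ rk x = l.+3.
    by clear -hx; lia.
  + by constructor 3; have [->|->] := hl _ r; rewrite !inE eqxx ?orbT.
  + have [->|->|->] := hy _ r; first by constructor 1.
      by constructor 3; rewrite !inE eqxx ?orbT.
    by constructor 3; rewrite !inE eqxx ?orbT.
  + have [->|->|->] := hz _ r; first by constructor 2; rewrite meetC edc.
      by constructor 3; rewrite !inE eqxx ?orbT.
    by constructor 3; rewrite !inE eqxx ?orbT.
  + by constructor 3; have [->|->] := hd _ r; rewrite !inE eqxx ?orbT.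
Qed.

(** The upper transport takes the coatom u \/ v and the lower one the atom a \/ b, exactly what
    [cube_core] leaves. Outside the cube b and c remain; they form the quad of [S], with b in the
    part of the pivot a of [sandwich]. *)
Lemma block_cert_cube_opp a b u v c t :
  pair_lev l a b -> cube rk l a (a `|` b) u v -> t = a `|` b `|` u `|` v ->
  pair_lev l.+3 t c -> t `&` c = u `|` v -> block_cert rk m M true true.
Proof.
move=> hab cb et htc etc.
have [f1 [_ [rhu rhv ruv] f2]] := cube_lev gr cb c3 c3'.
have [rK oK bK] := cube_coreP gr cb; have [tc rt rc hd] := htc.
have [ab ra rb hl] := hab; have [_ [rj ru rv] [ju jv uv] [aj au av]] := cb.
have [_ _ hy] := f1; have hba := pair_levC hab.
have rm := pair_meet gr hab; have rtj := pair_join gr htc.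
have bt : b <= t by rewrite et -!joinA joinCA leUl.
have ebc : b `&` c = b `&` a.
  have -> : b `&` c = b `&` (u `|` v) by rewrite -etc meetA (meet_l bt).
  have {1}-> : b = b `&` (a `|` b) by rewrite joinKIC.
  by rewrite -meetA meetUr (cube_meet gr cb) (cube_meet gr (cubeCA cb)) joinxx.
have jbc : b `|` c = c `|` t.
  have uvc : u `|` v <= c by rewrite -etc leIr.
  rewrite -{1}(join_r uvc) joinA -{1}(join_r au) joinA joinA [b `|` a]joinC -et.
  exact: joinC.
pose S := [:: ((b, c), (b `&` a, c `|` t))] : seq (quad L).
have rm' : (rk (b `&` a)).+1 = l by rewrite meetC.
apply: (sandwich (K := cube_core a (a `|` b) u v) (S := S)
  gr c1 c1' ml lM c2 c2' hba (pair_levC htc)).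
- by right.
- rewrite /= -/(all rect _); move: rK => /= ->; rewrite andbT.
  by apply: rect_incomp => //; apply: (@incomp _ _ rk _ _ _ ebc); rewrite ?rb ?rc; clear -rm'; lia.
- by [].
- by [].
- move=> q /bK[h1 h2 h3]; split; [by clear -h1; lia|by clear -h2 ml lM; lia|].
  by move=> x /h3; clear -ml lM; lia.
- move=> x hx.
  have [r|[r|[r|r]]] : rk x = l \/ rk x = l.+1 \/ rk x = l.+2 \/ rk x = l.+3.
    by clear -hx; lia.
  + by constructor 3; have [->|->] := hl _ r; rewrite !inE eqxx ?orbT.
  + have [->|->|->] := hy _ r; first by constructor 1; rewrite joinC.
      by constructor 3; rewrite !inE eqxx ?orbT.
    by constructor 3; rewrite !inE eqxx ?orbT.
  + have [->|->|->] := f2 _ r; last by constructor 2; rewrite meetC.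
      by constructor 3; rewrite !inE eqxx ?orbT.
    by constructor 3; rewrite !inE eqxx ?orbT.
  + constructor 3; have [->|->] := hd _ r; last by rewrite !inE eqxx ?orbT.
    by rewrite {1}et !inE eqxx ?orbT.
Qed.

(** The upper transport now takes a coatom above the atom a \/ b, so u \/ v still needs a partner
    and [cube_core] does not fit. The cube is matched anew: u \/ v goes with b and v with c, outside
    the cube. *)
Lemma block_cert_cube_adj a b u v c t :
  pair_lev l a b -> cube rk l a (a `|` b) u v -> t = a `|` b `|` u `|` v ->
  pair_lev l.+3 t c -> t `&` c = a `|` b `|` u -> block_cert rk m M true true.
Proof.
move=> hab cb et htc etc.
have [f1 [[nhh _ nhu] [rhu rhv ruv] f2]] := cube_lev gr cb c3 c3'.
have [tc rt rc hd] := htc.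
have [ab ra rb hl] := hab; have [_ [rj ru rv] [ju jv uv] [aj au av]] := cb.
have [_ _ hy] := f1; have rm := pair_meet gr hab; have rtj := pair_join gr htc.
have vt : v <= t by rewrite et leUr.
have huc : a `|` b `|` u <= c by rewrite -etc leIr.
have cbv := cubeC (cubeCA cb).
have evc : v `&` c = a.
  rewrite -(meet_l vt) -meetA etc [a `|` b `|` u]joinC.
  exact: (cube_meet_opp gr (cubeCA (cubeC cb))).
have jvc : v `|` c = t `|` c.
  by rewrite -{1}(join_r huc) joinA [v `|` _]joinC -et.
have eBuv : (u `|` v) `&` b = a `&` b.
  have {1}-> : b = (a `|` b) `&` b by rewrite meetC joinKIC.
  by rewrite meetA [_ `&` (a `|` b)]meetC meetUr (cube_meet gr cb)
     (cube_meet gr (cubeCA cb)) joinxx.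
have jBuv : (u `|` v) `|` b = t.
  by rewrite et -{1}(join_r au) joinC !joinA [b `|` a]joinC.
have r3 := cube_down gr (cubeCA cb).
have r4 : rect ((u, t), (a `|` b `|` u, u `|` v)).
  have := cube_up gr (cubeCA cb); rewrite [v `|` u]joinC.
  by rewrite -joinA [v `|` u]joinC joinA -et.
pose K := [:: ((v, c), (a, t `|` c)); ((u `|` v, b), (a `&` b, t));
   ((a `|` b `|` v, a), (a `|` b, v)); ((u, t), (a `|` b `|` u, u `|` v))] : seq (quad L).
apply: (sandwich (K := K) (S := [::]) gr c1 c1' ml lM c2 c2' hab (pair_levC htc)).
- by left.
- apply/and5P; split=> //; apply: rect_incomp => //.
    by apply: (@incomp _ _ rk _ _ _ evc); rewrite ra ?rv ?rc; clear; lia.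
  by apply: (@incomp _ _ rk _ _ _ eBuv); rewrite ?ruv ?rb; clear -rm; lia.
- rewrite /ordered /= !inE /= !negb_or !andbT (eq_sym u (a `|` b)) ju uv.
  by rewrite !(@rk_neq _ _ rk) //; rewrite ?ru ?rv ?rtj ?rt ?rj ?rhv ?ruv ?ra; clear -rm; lia.
- by [].
- move=> q; rewrite !inE => /or4P[] /eqP-> /=; rewrite ?ru ?rv ?rhv ?ruv ?ra ?rb ?rc ?rt;
  split; try (by clear -ml lM; lia); move=> x; rewrite !inE /= => /orP[]/eqP->;
  rewrite ?rj ?rt ?rtj ?ra ?rv ?rhu ?ruv; by clear -ml lM rm; lia.
- move=> x hx.
  have [r|[r|[r|r]]] : rk x = l \/ rk x = l.+1 \/ rk x = l.+2 \/ rk x = l.+3.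
    by clear -hx; lia.
  + by constructor 3; have [->|->] := hl _ r; rewrite !inE eqxx ?orbT.
  + have [->|->|->] := hy _ r; first by constructor 1.
      by constructor 3; rewrite !inE eqxx ?orbT.
    by constructor 3; rewrite !inE eqxx ?orbT.
  + have [->|->|->] := f2 _ r; first by constructor 2; rewrite meetC.
      by constructor 3; rewrite !inE eqxx ?orbT.
    by constructor 3; rewrite !inE eqxx ?orbT.
  + by constructor 3; have [->|->] := hd _ r; rewrite !inE eqxx ?orbT.
Qed.

(** In the split shape w is not below d, so d /\ c is one of the other two elements of level l + 2,
    and these positions are mirror images. In the cube shape the meet of level l + 3 is one of the
    three coatoms, two of which are above a \/ b. *)
Lemma block_cert_full : block_cert rk m M true true.
Proof.
have c2l : #|lev l| = 2 by apply: c2; rewrite ml leqnn.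
have c2l' : #|lev l.+3| = 2 by apply: c2'; rewrite leqnn.
have [a [b [u [v [hab huv au bu hv]]]]] := triple_above gr c2l c3.
have [[ju jv uv] [rj ru rv] hy] := huv; have [ab ra rb hl] := hab.
have rju : rk (a `|` b `|` u) = l.+2 by apply: (rk_join_cover gr _ rj ru ra); rewrite ?leUl.
case: hv => -[bv av].
  have rjv : rk (a `|` b `|` v) = l.+2 by apply: (rk_join_cover gr _ rj rv rb); rewrite ?leUr.
  have n12 : a `|` b `|` u != a `|` b `|` v.
    apply: contraTneq isT => e; exfalso.
    apply: (no_triple_below gr _ rj ru rv ju jv uv rju); rewrite ?c2l ?leUl ?leUr //.
    by rewrite e leUr.
  have [w hw] := third c3' rju rjv n12.
  have [[_ n1w n2w] [_ _ rw] hz] := hw.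
  pose d := (a `|` b `|` u) `|` (a `|` b `|` v).
  have rd : rk d = l.+3.
    by apply: (rk_join_cover gr n12 rju rjv rj); rewrite leUl.
  have [c hdc] := card_lev2 c2l' rd; have [dc _ rc hd] := hdc.
  have wd : ~~ (w <= d).
    by apply/negP; apply: (no_top_of_split hab c2l huv au bv hw rd); rewrite ?leUl ?leUr.
  have wc : w <= c.
    have w1 : w != a `|` b `|` u by rewrite eq_sym.
    have [e we /hd[] ee] := cover_above gr rw rju w1; subst e => //.
    by rewrite we in wd.
  have rdc : rk (d `&` c) = l.+2 by have [] := pair_meet gr hdc.
  have [e|e|e] := hz _ rdc.
  - by apply: (block_cert_planar hab huv au bu bv av hw hdc); rewrite ?leUl ?leUr.
  - have hba := pair_levC hab.
    apply: (@block_cert_planar b a v u w c d hba);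
      rewrite ?[b `|` a]joinC ?leUl ?leUr //.
      split=> //; first by rewrite (eq_sym v u).
      by move=> x /hy[]; [constructor 1|constructor 3|constructor 2].
    by split=> //; [rewrite eq_sym|move=> x /hz[]; [constructor 2|constructor 1|constructor 3]].
  - by rewrite -e leIl in wd.
have cb := cube_of_pair hab huv au bv.
have [f1 [_ [rhu rhv ruv] f2]] := cube_lev gr cb c3 c3'.
have rt := cube_rk_top gr cb.
have [c htc] := card_lev2 c2l' rt.
have rtc : rk ((a `|` b `|` u `|` v) `&` c) = l.+2 by have [] := pair_meet gr htc.
have [e|e|e] := f2 _ rtc.
- exact: (block_cert_cube_adj hab cb erefl htc).
- apply: (@block_cert_cube_adj a b v u c (a `|` b `|` u `|` v) hab) => //.
    exact: cubeCA.
  by rewrite -!joinA [u `|` v]joinC.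
- exact: (block_cert_cube_opp hab cb erefl htc).
Qed.

End Full.

End Adjacent.

(** * Certificates for blocks according to theta *)

Section BlockTheta.

Context {disp : Order.disp_t} {L : finTBDistrLatticeType disp}.
Implicit Types (a b c x y z : L).
Context (rk : L -> nat) (gr : graded rk).

Notation lev := (lev rk).

(** All three elements cover the apex, so their pairwise joins are three elements of level k + 2.
    Hence a lone three-element level is never next to an apex. *)
Lemma apex_triple_above k : #|lev k| = 1 -> #|lev k.+1| = 3 -> (2 < #|lev k.+2|)%N.
Proof.
move=> c1 c3; rewrite ltnNge; apply/negP => c2.
have /card_gt0P[h] : (0 < #|lev k.+1|)%N by rewrite c3.
rewrite inE => /eqP rh; have [u [v [[hu hv uv] [_ ru rv] hx]]] := card_lev3 c3 rh.
have [a ah ra] := cover_below gr rh ru hu.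
have [uh vh] : u != h /\ v != h by rewrite eq_sym hu eq_sym hv.
have [a' au ra'] := cover_below gr ru rh uh.
have [a'' av ra''] := cover_below gr rv rh vh.
rewrite (card_lev1 c1 ra' ra) in au; rewrite (card_lev1 c1 ra'' ra) in av.
exact: (no_triple_above gr c2 rh ru rv hu hv uv ra).
Qed.

Lemma apex_triple_below k : #|lev k.+2| = 1 -> #|lev k.+1| = 3 -> (2 < #|lev k|)%N.
Proof.
move=> c1 c3; rewrite ltnNge; apply/negP => c2.
have /card_gt0P[h] : (0 < #|lev k.+1|)%N by rewrite c3.
rewrite inE => /eqP rh; have [u [v [[hu hv uv] [_ ru rv] hx]]] := card_lev3 c3 rh.
have [a ah ra] := cover_above gr rh ru hu.
have [uh vh] : u != h /\ v != h by rewrite eq_sym hu eq_sym hv.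
have [a' au ra'] := cover_above gr ru rh uh.
have [a'' av ra''] := cover_above gr rv rh vh.
rewrite (card_lev1 c1 ra' ra) in au; rewrite (card_lev1 c1 ra'' ra) in av.
exact: (no_triple_below gr c2 rh ru rv hu hv uv ra).
Qed.

Variables (m M : nat).
Hypotheses (c1 : #|lev m| = 1) (c1' : #|lev M| = 1) (mM : (m < M)%N).
Hypothesis c23 : forall k, (m < k < M)%N -> (2 <= #|lev k| <= 3)%N.

Definition width3 : seq nat :=
  [seq k <- iota m.+1 (M - m).-1 | #|lev k| == 3].

Lemma mem_width3 k : (k \in width3) = (m < k < M)%N && (#|lev k| == 3).
Proof.
rewrite mem_filter mem_iota andbC.
by have -> : (m.+1 + (M - m).-1 = M)%N by clear -mM; lia.
Qed.

Lemma card_lev_width3 k : (m < k < M)%N -> #|lev k| = if k \in width3 then 3 else 2.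
Proof.
move=> hk; rewrite mem_width3 hk andTb; case: eqP => // h.
by have := c23 hk; move: h; clear; lia.
Qed.

Lemma width3_inner r : r \in width3 ->
  (r.+1 \notin width3 -> m.+1 != r) /\ (r.-1 \notin width3 -> r.+1 != M).
Proof.
rewrite mem_width3 => /andP[hr /eqP c3]; split; rewrite mem_width3 => h; apply/eqP => e.
  subst r; have := apex_triple_above c1 c3; rewrite ltnNge => /negP; apply.
  have [e|ne] := eqVneq m.+2 M; first by rewrite e c1'.
  have hk : (m < m.+2 < M)%N by clear -hr ne; lia.
  by have := c23 hk; move: h; rewrite hk andTb; clear; lia.
case: r => [|r] in hr c3 h e *; first by [].
change r.+1.-1 with r in h.
have c1'' : #|lev r.+2| = 1 by rewrite e.
have := apex_triple_below c1'' c3; rewrite ltnNge => /negP; apply.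
have [e'|ne] := eqVneq r m; first by rewrite e' c1.
have hk : (m < r < M)%N by clear -hr ne e; lia.
by have := c23 hk; move: h; rewrite hk andTb; clear; lia.
Qed.

Lemma block_cert0 : size width3 = 0 -> block_cert rk m M false false.
Proof.
move=> /size0nil s0; apply: (block_cert_thin gr) => // k hk.
by rewrite card_lev_width3 // s0.
Qed.

Lemma block_cert1 : size width3 = 1 ->
  block_cert rk m M true false /\ block_cert rk m M false true.
Proof.
case e : width3 => [|r [|]] // _.
have rw : r \in width3 by rewrite e mem_head.
have hr : (m < r < M)%N by move: rw; rewrite mem_width3 => /andP[].
have [h1 h2] := width3_inner rw.
have {}h1 : m.+1 != r by apply: h1; rewrite e mem_seq1; clear; lia.
have {}h2 : r.+1 != M by apply: h2; rewrite e mem_seq1; clear -hr; lia.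
have c2 k : (m < k < M)%N -> #|lev k| = if k == r then 3 else 2.
  by move=> hk; rewrite card_lev_width3 // e mem_seq1.
split; first exact: (block_cert_lower gr hr c1 c2).
pose N := (\max_(a : L) rk a)%N.
have rkN a : (rk a <= N)%N by exact: leq_bigmax.
have MN : (M <= N)%N.
  have /card_gt0P[x] : (0 < #|lev M|)%N by rewrite c1'.
  by rewrite inE => /eqP <-.
apply: (block_cert_dual rkN); first by clear -hr MN; lia.
apply: (@block_cert_lower _ _ _ (graded_dual rkN gr) _ _ (N - r)).
- by clear -hr MN; lia.
- by rewrite (lev_dual rkN) //; clear -hr MN; lia.
- move=> k hk; have ek : k = (N - (N - k))%N by clear -hk; lia.
  rewrite {1}ek (lev_dual rkN) ?leq_subr // c2; last by clear -hk MN; lia.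
  by have -> : ((N - k)%N == r) = (k == N - r)%N by apply/eqP/eqP; clear -hk hr MN; lia.
- by clear -h2 hr MN; lia.
- by clear -h1 hr MN; lia.
Qed.

Lemma block_cert2 : size width3 = 2 -> block_cert rk m M true true.
Proof.
case e : width3 => [|r [|r' []]] // _.
have rw : r \in width3 by rewrite e mem_head.
have rw' : r' \in width3 by rewrite e !inE eqxx orbT.
have hr : (m < r < M)%N by move: rw; rewrite mem_width3 => /andP[].
have hr' : (m < r' < M)%N by move: rw'; rewrite mem_width3 => /andP[].
have rr' : (r < r')%N.
  have : sorted ltn width3 by apply: sorted_filter (iota_ltn_sorted _ _); exact: ltn_trans.
  by rewrite e /= andbT.
have c2 k : (m < k < M)%N -> #|lev k| = if (k == r) || (k == r') then 3 else 2.
  by move=> hk; rewrite card_lev_width3 // e !inE.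
have [er|ner] := eqVneq r.+1 r'; last first.
  have [h1 _] := width3_inner rw; have [_ h2] := width3_inner rw'.
  apply: (@block_cert_two _ _ _ gr m M r r') => //.
  - by clear -hr rr'; lia.
  - by clear -hr'; lia.
  - by apply: h1; rewrite e !inE; clear -ner; lia.
  - by apply: h2; rewrite e !inE; clear -ner rr'; lia.
have [l el] : exists l, r = l.+1 by exists r.-1; clear -hr; lia.
subst r r'.
have c3 : #|lev l.+1| = 3 by rewrite c2 ?eqxx.
have c3' : #|lev l.+2| = 3 by rewrite c2 ?eqxx ?orbT.
have c2' k : (m < k < M)%N -> k != l.+1 -> k != l.+2 -> #|lev k| = 2.
  by move=> hk h1 h2; rewrite c2 // (negbTE h1) (negbTE h2).
(* The two adjacent levels are next to both apexes, to one of them, or to none; being next to the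
   lower apex only is dual to being next to the upper one only. *)
have [elm|lm] := eqVneq m l; have [elM|lM] := eqVneq l.+3 M.
- have c1l : #|lev l| = 1 by rewrite -elm.
  have c1M : #|lev l.+3| = 1 by rewrite elM.
  by rewrite elm -elM; exact: (block_cert_cube gr).
- pose N := (\max_(a : L) rk a)%N.
  have rkN a : (rk a <= N)%N by exact: leq_bigmax.
  have MN : (M <= N)%N.
    have /card_gt0P[x] : (0 < #|lev M|)%N by rewrite c1'.
    by rewrite inE => /eqP <-.
  apply: (block_cert_dual rkN); first by clear -hr MN; lia.
  have e3 : (N - m)%N = (N - l.+3).+3 by clear -elm hr' MN lM; lia.
  have e2 : (N - l.+3).+2 = (N - l.+1)%N by clear -hr' MN lM; lia.
  have e1 : (N - l.+3).+1 = (N - l.+2)%N by clear -hr' MN lM; lia.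
  rewrite e3; apply: (block_cert_half_cube (graded_dual rkN gr)).
  + by clear -hr' MN lM; lia.
  + by rewrite (lev_dual rkN).
  + by rewrite -e3 (lev_dual rkN) //; clear -hr MN; lia.
  + move=> k hk; have ek : k = (N - (N - k))%N by clear -hk MN; lia.
    rewrite ek (lev_dual rkN) ?leq_subr //; apply: c2';
    by clear -hk hr' hr MN elm; lia.
  + by rewrite e1 (lev_dual rkN) //; clear -hr' MN; lia.
  + by rewrite e2 (lev_dual rkN) //; clear -hr' MN; lia.
- rewrite -elM; apply: (block_cert_half_cube gr) => //.
  + by clear -lm hr; lia.
  + by rewrite elM.
  + by move=> k hk; apply: c2'; clear -hk elM; lia.
- apply: (@block_cert_full _ _ _ gr m l M) => //.
  + by clear -lm hr; lia.
  + by clear -lM hr'; lia.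
  + by move=> k hk; apply: c2'; clear -hk hr; lia.
  + by move=> k hk; apply: c2'; clear -hk hr; lia.
Qed.

End BlockTheta.

(** * Monomial ideals and monomial orders *)

Section MonomialIdeals.

Local Open Scope ring_scope.

Section Ideals.

Context {R : comNzRingType}.
Implicit Types (s : seq R) (p : R).

Lemma ideal_gen0 s : ideal_gen s 0.
Proof. by exists (fun=> 0); rewrite big1 // => i _; rewrite mul0r. Qed.

Lemma ideal_genD s p q : ideal_gen s p -> ideal_gen s q -> ideal_gen s (p + q).
Proof.
move=> [c ->] [d ->]; exists (fun i => c i + d i).
by rewrite -big_split; apply: eq_bigr => i _; rewrite mulrDl.
Qed.

Lemma ideal_gen_mem s p c : p \in s -> ideal_gen s (c * p).
Proof.
move=> ps; have lt : (index p s < size s)%N by rewrite index_mem.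
exists (fun i => if i == Ordinal lt then c else 0).
rewrite (bigD1 (Ordinal lt)) //= eqxx nth_index // big1 ?addr0 //.
by move=> i /negbTE ->; rewrite mul0r.
Qed.

End Ideals.

Section Monomials.

Context (K : fieldType) (n : nat).
Implicit Types (m : 'X_{1..n}) (ms : seq 'X_{1..n}) (p : {mpoly K[n]}).

Definition monoms ms : seq {mpoly K[n]} := [seq 'X_[m] | m <- ms].

Lemma ideal_gen_monoms ms p :
  ideal_gen (monoms ms) p <->
  {in msupp p, forall m, has (fun m' => m' <= m)%MM ms}.
Proof.
split=> [[c ->] m /msupp_sum_le/flatten_mapP[i _]|h].
  have lt : (i < size ms)%N by rewrite -(size_map (fun m => 'X_[m] : {mpoly K[n]})).
  rewrite (nth_map 0%MM) // (perm_mem (msuppMX _ _)) => /mapP[m' _ ->].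
  by apply/hasP; exists (nth 0%MM ms i); [exact: mem_nth|exact: lem_addr].
rewrite [p]mpolyE; elim: (msupp p) h => [|m s IH] h.
  by rewrite big_nil; exact: ideal_gen0.
rewrite big_cons; apply: ideal_genD; last first.
  by apply: IH => m' m's; apply: h; rewrite inE m's orbT.
have /hasP[m' m's le] := h m (mem_head _ _).
rewrite -{2}(submK le) mpolyXD scalerAl; apply: ideal_gen_mem.
exact: (map_f (fun m => 'X_[m] : {mpoly K[n]})).
Qed.

Definition mcoprime m m' : bool := [forall i, (m i == 0%N) || (m' i == 0%N)].

Lemma mcoprimeP m m' i : mcoprime m m' -> m i = 0%N \/ m' i = 0%N.
Proof. by move=> /forallP/(_ i)/orP[]/eqP; tauto. Qed.

(** A monomial m' that divides m_i m and is coprime to m_i divides m. *)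
Lemma regular_monoms ms : pairwise mcoprime ms -> 0%MM \notin ms ->
  regular_sequence (monoms ms).
Proof.
move=> co nz; split; last first.
  move=> /ideal_gen_monoms/(_ 0%MM); rewrite msupp1 mem_seq1 eqxx => /(_ isT).
  move=> /hasP[m mms /mnm_lepP le]; move/negP: nz; apply.
  suff <- : m = 0%MM by [].
  by apply/mnmP => i; apply/eqP; rewrite mnm0E -leqn0 -[0%N](mnm0E i).
move=> i; rewrite size_map => lti p.
rewrite /monoms -map_take (nth_map 0%MM) // => /ideal_gen_monoms h.
apply/ideal_gen_monoms => m mp.
have : (nth 0%MM ms i + m)%MM \in msupp ('X_[nth 0%MM ms i] * p).
  by rewrite mulrC (perm_mem (msuppMX _ _)); apply/mapP; exists m.
move=> /h/hasP[m' m't /mnm_lepP le]; apply/hasP; exists m' => //.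
have /mcoprimeP cop : mcoprime m' (nth 0%MM ms i).
  have /(nthP 0%MM)[j ltj e] := m't.
  have ji : (j < i)%N by move: ltj; rewrite size_takel // ltnW.
  rewrite -e nth_take //; move/(pairwiseP 0%MM): co; apply; rewrite ?inE //.
  exact: ltn_trans lti.
apply/mnm_lepP => k; have := le k; rewrite mnmDE.
by case: (cop k) => ->.
Qed.

(** If x divides m_i and m_j with i < j, then m_j (m_i / x) = (m_j / x) m_i is in the ideal of the
    monomials before m_j, so by regularity m_i / x is too. But it has degree one, and the generators
    have degree two. *)
Lemma regular_monoms_coprime ms : {in ms, forall m, mdeg m = 2} ->
  regular_sequence (monoms ms) -> pairwise mcoprime ms.
Proof.
move=> deg [reg _]; apply/(pairwiseP 0%MM) => i j; rewrite !inE => lti ltj ij.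
apply/forallP => x; apply/negPn; rewrite negb_or; apply/negP => /andP[nix njx].
set mi := nth 0%MM ms i in nix *; set mj := nth 0%MM ms j in njx *.
have lei : (U_(x) <= mi)%MM by rewrite lep1mP.
have lej : (U_(x) <= mj)%MM by rewrite lep1mP.
have := reg j; rewrite size_map => /(_ ltj 'X_[mi - U_(x)]).
rewrite /monoms -map_take (nth_map 0%MM) // -/mj -mpolyXD => reg'.
have : ideal_gen (monoms (take j ms)) 'X_[mj + (mi - U_(x))].
  apply/ideal_gen_monoms => m; rewrite msuppX mem_seq1 => /eqP->.
  apply/hasP; exists mi.
    by rewrite /mi -(nth_take _ ij) mem_nth // size_takel // ltnW.
  apply/mnm_lepP => k; rewrite mnmDE mnmBE.
  by have /mnm_lepP/(_ k) := lei; have /mnm_lepP/(_ k) := lej; lia.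
move=> /reg'/ideal_gen_monoms/(_ (mi - U_(x))%MM); rewrite msuppX mem_seq1 eqxx.
move=> /(_ isT)/hasP[m /mem_take mms le].
have := deg _ mms; have : mdeg mi = 2 by apply: deg; exact: mem_nth.
have e : mdeg mi = (mdeg (mi - U_(x))%MM + 1)%N by rewrite -(mdeg1 x) -mdegD submK.
have : (mdeg m <= mdeg (mi - U_(x))%MM)%N by rewrite -(submK le) mdegD leq_addl.
by rewrite e; lia.
Qed.

End Monomials.

Section MonomialOrder.

Context (n : nat) (le : rel 'X_{1..n}) (mo : monomial_order le).

(** The support may be listed in either order, and both are checked. The initial value 1 of the fold
    loses because it is the least monomial. *)
Lemma init_monom2 (K : fieldType) (m1 m2 : 'X_{1..n}) :
  m1 != m2 -> m1 != 0%MM -> m2 != 0%MM -> le m2 m1 ->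
  init_monom le ('X_[m1] - 'X_[m2] : {mpoly K[n]}) = m1 /\
  init_monom le ('X_[m2] - 'X_[m1] : {mpoly K[n]}) = m1.
Proof.
case: mo => [[lexx anti trans tot] le0 _] m12 m10 m20 le21.
have n12 : le m1 m2 = false.
  by apply/negP => le12; move/eqP: m12; apply; apply: anti; rewrite le12.
have n0 m : m != 0%MM -> le m 0%MM = false.
  by move=> mn0; apply/negP => h; move/eqP: mn0; apply; apply: anti; rewrite h le0.
have key (p : {mpoly K[n]}) : msupp p =i [:: m1; m2] -> init_monom le p = m1.
  move=> e; have : perm_eq (msupp p) [:: m1; m2].
    by apply: uniq_perm => //; rewrite /= mem_seq1 m12.
  have [|] := eqVneq (msupp p) [:: m1; m2].
    by rewrite /init_monom => -> _; rewrite !big_cons big_nil n0 // n12.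
  rewrite /init_monom; case E : (msupp p) => [|a [|b []]] ne pe;
    try by have := perm_size pe.
  have : a \in [:: m1; m2] by rewrite -(perm_mem pe) mem_head.
  have : b \in [:: m1; m2] by rewrite -(perm_mem pe) !inE eqxx orbT.
  have ab : a != b.
    by have := perm_uniq pe; rewrite /= !mem_seq1 m12 => /andP[].
  rewrite !inE => /orP[]/eqP eb /orP[]/eqP ea; subst a b; rewrite ?eqxx // in ab ne *.
  by rewrite !big_cons big_nil n0 // le21.
split; apply: key => m; rewrite mcoeff_msupp mcoeffB !mcoeffX !inE.
  rewrite (eq_sym m m1) (eq_sym m m2); case: (eqVneq m1 m) => [<-|_].
    by rewrite (eq_sym m2) (negbTE m12) subr0 oner_eq0.
  by case: (m2 == m); rewrite sub0r oppr_eq0 ?oner_eq0 ?eqxx.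
rewrite (eq_sym m m1) (eq_sym m m2); case: (eqVneq m1 m) => [<-|_].
  by rewrite (eq_sym m2) (negbTE m12) sub0r oppr_eq0 oner_eq0.
by case: (m2 == m); rewrite subr0 ?oner_eq0 ?eqxx.
Qed.

End MonomialOrder.

End MonomialIdeals.

(** * König type in terms of quads *)

Section Konig.

Context {disp : Order.disp_t} {L : finTBDistrLatticeType disp}.
Implicit Types (a b c x y z : L) (q : quad L) (Q S : seq (quad L)).

Definition mon a b : 'X_{1..#|L|} := (U_(enum_rank a) + U_(enum_rank b))%MM.

Lemma monE a b x : mon a b (enum_rank x) = ((a == x) + (b == x))%N.
Proof. by rewrite mnmDE !mnm1E !(inj_eq enum_rank_inj). Qed.

Lemma mdeg_mon a b : mdeg (mon a b) = 2.
Proof. by rewrite mdegD !mdeg1. Qed.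

Lemma mon_neq0 a b : mon a b != 0%MM.
Proof. by rewrite -mdeg_eq0 mdeg_mon. Qed.

Lemma monC a b : mon a b = mon b a.
Proof. exact: addmC. Qed.

Lemma incomp_neq a b : a >< b ->
  [/\ a != b, a `&` b != a, a `&` b != b, a `|` b != a & a `|` b != b].
Proof.
move=> h; split; apply: contraNneq h; first by move=> ->; exact: comparablexx.
- by move=> <-; rewrite le_comparable // leIr.
- by move=> <-; rewrite ge_comparable // leIl.
- by move=> <-; rewrite ge_comparable // leUr.
- by move=> <-; rewrite le_comparable // leUl.
Qed.

Lemma le_meet_join a b : a `&` b <= a `|` b.
Proof. by rewrite (le_trans (leIl a b)) // leUl. Qed.

Lemma meet_neq_join a b : a >< b -> a `&` b != a `|` b.
Proof.
move=> h; apply: contraNneq h => e.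
by apply: (@le_comparable _ _ a b); rewrite (le_trans (leUl a b)) // -e leIr.
Qed.

Lemma mon_meet_join a b : a >< b -> mon a b != mon (a `&` b) (a `|` b).
Proof.
move=> /incomp_neq[_ h1 _ h2 _]; apply: contraTneq isT => e.
have := congr1 (fun m : 'X_{1..#|L|} => m (enum_rank a)) e.
by rewrite !monE eqxx (negbTE h1) (negbTE h2).
Qed.

Lemma rectP q : rect q ->
  [/\ pivot q != partner q, q.2.1 != q.2.2,
      pivot q \notin tail q & partner q \notin tail q].
Proof.
have ne x y : x != y -> (x == y = false) * (y == x = false).
  by move=> /negbTE e; rewrite (eq_sym y) e.
case: q => [[p v] [a b]]; rewrite /rect /meet_join /= !inE.
case/orP=> /andP[h /orP[]/eqP[-> ->]]; have [h1 h2 h3 h4 h5] := incomp_neq h;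
by rewrite !(ne _ _ h1, ne _ _ h2, ne _ _ h3, ne _ _ h4, ne _ _ h5,
  ne _ _ (meet_neq_join h)).
Qed.

Definition lead_mon q := mon q.1.1 q.1.2.
Definition tail_mon q := mon q.2.1 q.2.2.

(** Recovers the pair that defines the binomial: a meet and a join are comparable, so only one half
    of a rectangle is incomparable. *)
Definition side q : L * L := if q.1.1 >< q.1.2 then q.1 else q.2.

Lemma rect_side_mon q : rect q ->
  (side q).1 >< (side q).2 /\
  (((lead_mon q = mon (side q).1 (side q).2) /\
    (tail_mon q = mon ((side q).1 `&` (side q).2) ((side q).1 `|` (side q).2))) \/
   ((tail_mon q = mon (side q).1 (side q).2) /\
    (lead_mon q = mon ((side q).1 `&` (side q).2) ((side q).1 `|` (side q).2)))).
Proof.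
case: q => [[p v] [a b]]; rewrite /rect /meet_join /side /lead_mon /tail_mon /= !inE.
case/orP=> /andP[h /orP[]/eqP[-> ->]].
- by rewrite h; split=> //; left.
- by rewrite h; split=> //; left; rewrite [mon (_ `|` _) _]monC.
- rewrite ifN; first by split=> //; right.
  by rewrite negbK le_comparable // le_meet_join.
- rewrite ifN; first by split=> //; right; rewrite [mon (_ `|` _) _]monC.
  by rewrite negbK ge_comparable // le_meet_join.
Qed.

Section Order.

Context (le : rel 'X_{1..#|L|}) (mo : monomial_order le) (K : fieldType).

Lemma join_meet_binomE a b :
  join_meet_binom K a b = ('X_[mon a b] - 'X_[mon (a `&` b) (a `|` b)])%R.
Proof. by rewrite /join_meet_binom /xvar -!mpolyXD. Qed.

Lemma init_binom q : rect q -> le (tail_mon q) (lead_mon q) ->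
  init le (join_meet_binom K (side q).1 (side q).2) = 'X_[lead_mon q]%R.
Proof.
move=> /rect_side_mon[h e] l; rewrite /init join_meet_binomE.
have ne := mon_meet_join h.
case: e => -[e1 e2]; rewrite -e1 -e2 in ne *; congr 'X_[_].
  by have [] := init_monom2 mo K ne (mon_neq0 _ _) (mon_neq0 _ _) l.
by have [] := init_monom2 mo K (m1 := lead_mon q) (m2 := tail_mon q);
  rewrite ?mon_neq0 // eq_sym.
Qed.

End Order.

(** The second conjunct excludes squares, a repetition inside one lead that coprimality between
    different leads does not see. *)
Lemma leads_mcoprime Q : uniq (leads Q) <->
  (pairwise (@mcoprime _) [seq lead_mon q | q <- Q] /\ {in Q, forall q, q.1.1 != q.1.2}).
Proof.
have cop q r : mcoprime (lead_mon q) (lead_mon r) = 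
    ~~ has (mem (lead q)) (lead r).
  apply/forallP/hasPn => [h y yx|h i].
    apply/negP => yq; have := h (enum_rank y); rewrite !monE.
    by move: yq yx; rewrite !inE !(eq_sym y) => /orP[]->  /orP[]->; rewrite ?addn1 ?add1n.
  have [y ->] : exists y, i = enum_rank y by exists (enum_val i); rewrite enum_valK.
  rewrite !monE; have [yq|] := boolP (y \in lead q); last first.
    by rewrite !inE !(eq_sym y) negb_or => /andP[/negbTE-> /negbTE->].
  have : y \notin lead r by apply/negP => /h /=; rewrite yq.
  by rewrite !inE !(eq_sym y) negb_or orbC => /andP[/negbTE-> /negbTE->].
elim: Q => [|q Q IH] /=; first by split.
rewrite inE negb_or -/(leads Q) -andbA.
have -> : [&& q.1.1 != q.1.2, q.1.1 \notin leads Q, q.1.2 \notin leads Q & uniq (leads Q)]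
   = [&& q.1.1 != q.1.2, all (fun r => mcoprime (lead_mon q) (lead_mon r)) Q & uniq (leads Q)].
  congr (_ && _); rewrite andbA; congr (_ && _).
  apply/andP/allP => [[h1 h2] r rQ|h].
    rewrite cop; apply/hasPn => y yx; rewrite /= !inE negb_or.
    have yl : y \in leads Q by apply/leadsP; exists r.
    by apply/andP; split; apply: contraTneq yl => ->.
  split; apply/negP => /leadsP[r /h]; rewrite cop => /hasPn hh /hh;
  by rewrite /= !inE eqxx ?orbT.
rewrite all_map; split.
  case/and3P=> h1 h2 /IH[h3 h4]; rewrite h3 andbT; split=> //.
  by move=> r; rewrite inE => /orP[/eqP->|/h4].
case=> /andP[h2 h3] h4; rewrite h2 h4 ?mem_head //=; apply/IH; split=> //.
by move=> r rQ; apply: h4; rewrite inE rQ orbT.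
Qed.

Section Weight.

Context (Q : seq (quad L)).

(* Later pivots are larger, and all the other variables are smaller. *)
Definition prio x : nat :=
  if x \in [seq pivot q | q <- Q] then (index x [seq pivot q | q <- Q]).+1 else 0.

(** Base 3, because two tail variables of lower priority then weigh together at most two thirds of
    the pivot. *)
Definition weight (m : 'X_{1..#|L|}) : nat :=
  \sum_(i < #|L|) m i * 3 ^ prio (enum_val i).

(** Ties are broken by the monomial order of the library, which makes the comparison
    antisymmetric. *)
Definition weight_le (m m' : 'X_{1..#|L|}) : bool :=
  (weight m < weight m')%N || (weight m == weight m') && (m <= m')%O.

Lemma weightD m m' : weight (m + m')%MM = (weight m + weight m')%N.
Proof. by rewrite -big_split; apply: eq_bigr => i _; rewrite mnmDE mulnDl. Qed.

Lemma weightU x : weight U_(enum_rank x)%MM = 3 ^ prio x.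
Proof.
rewrite /weight (bigD1 (enum_rank x)) //= mnm1E eqxx mul1n enum_rankK big1 ?addn0 //.
by move=> i ne; rewrite mnm1E eq_sym (negbTE ne).
Qed.

Lemma weight_monomial_order : monomial_order weight_le.
Proof.
rewrite /weight_le; split.
- split.
  + by move=> m; rewrite eqxx lexx orbT.
  + move=> m m' /andP[/orP[h1|/andP[/eqP h1 l1]] /orP[h2|/andP[/eqP h2 l2]]];
      try (by clear -h1 h2; lia).
    by apply/le_anti; rewrite l1.
  + move=> m' m m'' /orP[h1|/andP[/eqP h1 l1]] /orP[h2|/andP[/eqP h2 l2]].
    * by rewrite (ltn_trans h1 h2).
    * by rewrite -h2 h1.
    * by rewrite h1 h2.
    * by rewrite h1 h2 eqxx (le_trans l1 l2) orbT.
  + by move=> m m'; case: (ltngtP (weight m) (weight m')) => //= _; exact: le_total.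
- have w0 : weight 0%MM = 0%N by rewrite /weight big1 // => i _; rewrite mnm0E.
  by move=> m; rewrite w0 le0x andbT; case: (weight m).
- move=> m m1 m2; rewrite !weightD ltn_add2r eqn_add2r => /orP[->//|/andP[-> h]].
  by rewrite lem_add ?orbT.
Qed.

(** [ordered] keeps later pivots out of the tail and [rectP] the pivot itself, so a pivot in the
    tail is an earlier one. All other variables have priority 0. *)
Lemma prio_tail : ordered Q -> uniq (leads Q) -> all rect Q ->
  {in Q, forall q, {in tail q, forall x, (prio x < prio (pivot q))%N}}.
Proof.
move=> oQ uQ rQ q qQ x xq; set ps := [seq pivot q | q <- Q].
have ups : uniq ps.
  have sub : subseq ps (leads Q).
    rewrite /ps; elim: (Q) => //= q' Q' IH; rewrite eqxx.
    exact: (subseq_trans IH (subseq_cons _ _)).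
  exact: subseq_uniq sub uQ.
have pp : pivot q \in ps by exact: map_f.
rewrite /prio -/ps pp; case: ifP => // xps; rewrite ltnS ltn_neqAle.
have ltk : (index q Q < size Q)%N by rewrite index_mem.
have ek : index (pivot q) ps = index q Q.
  rewrite -{1}(nth_index q qQ) -(nth_map q (pivot q)) //.
  by rewrite index_uniq // size_map.
have /rectP[_ _ npt _] := allP rQ _ qQ.
have ne : index x ps != index (pivot q) ps.
  apply: contraNneq npt => e.
  by rewrite -(nth_index (pivot q) pp) -e nth_index.
apply/andP; split=> //.
rewrite leqNgt ek; apply/negP => lt.
have ltx : (index x ps < size Q)%N by rewrite -(size_map pivot Q) index_mem.
have /(pairwiseP q)/(_ _ _ ltk ltx lt) := oQ.
by rewrite nth_index // -(nth_map q (pivot q)) // nth_index // xq.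
Qed.

Lemma weight_quad : ordered Q -> uniq (leads Q) -> all rect Q ->
  {in Q, forall q, weight_le (tail_mon q) (lead_mon q)}.
Proof.
move=> oQ uQ rQ q qQ; rewrite /weight_le; apply/orP; left.
rewrite /tail_mon /lead_mon !weightD !weightU.
have h := prio_tail oQ uQ rQ qQ.
have bd x : x \in tail q -> (3 * 3 ^ prio x <= 3 ^ prio q.1.1)%N.
  by move=> /h l; rewrite -expnS leq_pexp2l.
have := bd q.2.1; rewrite !inE eqxx => /(_ isT).
have := bd q.2.2; rewrite !inE eqxx orbT => /(_ isT).
have : (0 < 3 ^ prio q.1.2)%N by rewrite expn_gt0.
have : (0 < 3 ^ prio q.1.1)%N by rewrite expn_gt0.
have aux A B C D : (0 < C -> 0 < D -> 3 * B <= C -> 3 * A <= C -> A + B < C + D)%N.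
  by clear; lia.
exact: aux.
Qed.

End Weight.

Lemma konig_of_quads (K : fieldType) Q :
  all rect Q -> ordered Q -> uniq (leads Q) ->
  size Q = (#|L| - (Defs.dim [set: L]).+1)%N -> konig_type K L.
Proof.
move=> rQ oQ uQ sQ; exists [seq side q | q <- Q], (weight_le Q); split.
- by rewrite size_map.
- by move=> a b /mapP[q /(allP rQ)/rect_side_mon[h _] e]; move: h; rewrite -e.
- exact: weight_monomial_order.
have -> : [seq init (weight_le Q) (join_meet_binom K ab.1 ab.2) | ab <- [seq side q | q <- Q]]
    = monoms K [seq lead_mon q | q <- Q].
  rewrite /monoms -!map_comp; apply/eq_in_map => q qQ /=.
  apply: (init_binom (weight_monomial_order Q)); first exact: (allP rQ).
  exact: weight_quad.
apply: regular_monoms; first by have /leads_mcoprime[] := uQ.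
by apply/mapP => -[q _ /eqP]; rewrite eq_sym (negbTE (mon_neq0 _ _)).
Qed.

Lemma quads_of_konig (K : fieldType) : konig_type K L ->
  exists Q le, [/\ monomial_order le, all rect Q, uniq (leads Q),
    {in Q, forall q, le (tail_mon q) (lead_mon q)} &
    size Q = (#|L| - (Defs.dim [set: L]).+1)%N].
Proof.
move=> [s [le [ss inc mo reg]]].
(* Each binomial is oriented by the given order: its larger monomial becomes the lead. *)
pose qd (ab : L * L) : quad L :=
  let mj := (ab.1 `&` ab.2, ab.1 `|` ab.2) in
  if le (mon mj.1 mj.2) (mon ab.1 ab.2) then (ab, mj) else (mj, ab).
have rq ab : ab \in s -> rect (qd ab).
  move=> h; have {}h : ab.1 >< ab.2 by apply: inc; case: ab h.
  rewrite /qd; case: ifP => _; case: ab h => a b /= h.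
    exact: rect_incomp.
  exact: rect_meet_join.
have tot := mo; case: tot => -[_ _ _ tot] _ _.
have lq ab : le (tail_mon (qd ab)) (lead_mon (qd ab)).
  rewrite /qd /tail_mon /lead_mon; case: ifP => //= h.
  by have := tot (mon ab.1 ab.2) (mon (ab.1 `&` ab.2) (ab.1 `|` ab.2)); rewrite h orbF.
have sq ab : ab \in s -> side (qd ab) = ab.
  move=> h; have {}h : ab.1 >< ab.2 by apply: inc; case: ab h.
  rewrite /qd; case: ifP => _; rewrite /side /=; first by rewrite h.
  by rewrite ifN // negbK le_comparable // le_meet_join.
exists [seq qd ab | ab <- s], le; split=> //; last by rewrite size_map.
- by apply/allP => q /mapP[ab /rq h ->].
- apply/leads_mcoprime; split; last first.
    by move=> q /mapP[ab /rq/rectP[h _ _ _] ->].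
  apply: (@regular_monoms_coprime K); first by move=> m /mapP[q _ ->]; exact: mdeg_mon.
  suff <- : [seq init le (join_meet_binom K ab.1 ab.2) | ab <- s] =
     monoms K [seq lead_mon q | q <- [seq qd ab | ab <- s]] by [].
  rewrite /monoms -!map_comp; apply/eq_in_map => ab abs /=.
  by rewrite -(init_binom mo K (rq _ abs) (lq ab)) sq.
- by move=> q /mapP[ab _ ->].
Qed.

End Konig.

(** * Linear independence of the exponent vectors *)

Section Independence.

Import Num.Theory.
Local Open Scope ring_scope.

Section MonomialOrder.

Context (n : nat) (le : rel 'X_{1..n}) (mo : monomial_order le).

(** The second part serves [nonpos_combination], where an equality of products has to be traced back
    to the factors. *)
Lemma mo_add m1 m2 m3 m4 : le m1 m3 -> le m2 m4 ->
  le (m1 + m2)%MM (m3 + m4)%MM /\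
  ((m1 + m2)%MM = (m3 + m4)%MM -> m1 = m3 /\ m2 = m4).
Proof.
case: mo => [[_ anti trans _] _ add] h1 h2.
have l1 := add m2 _ _ h1.
have l2 : le (m3 + m2)%MM (m3 + m4)%MM.
  by rewrite [(m3 + m2)%MM]addmC [(m3 + m4)%MM]addmC; exact: add.
split=> [|e]; first exact: trans l1 l2.
have e1 : (m1 + m2)%MM = (m3 + m2)%MM by apply: anti; rewrite l1 e.
have m13 : m1 = m3 by apply: addIm e1.
by split=> //; move: e; rewrite m13 => /addmI.
Qed.

Lemma mo_muln m m' k : le m m' ->
  le (m *+ k)%MM (m' *+ k)%MM /\
  ((m *+ k)%MM = (m' *+ k)%MM -> (0 < k)%N -> m = m').
Proof.
move=> h; split; last first.
  move=> e k0; apply/mnmP => i; apply/eqP; rewrite -(eqn_pmul2r k0) -!mulmnE.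
  by rewrite e.
elim: k => [|k IH]; first by rewrite !mulm0n; case: mo => -[].
by rewrite !mulmS; have [] := mo_add h IH.
Qed.

Lemma mo_sum (I : eqType) (s : seq I) (F G : I -> 'X_{1..n}) :
  {in s, forall i, le (F i) (G i)} ->
  le (\big[mnm_add/mnm0]_(i <- s) F i) (\big[mnm_add/mnm0]_(i <- s) G i) /\
  (\big[mnm_add/mnm0]_(i <- s) F i = \big[mnm_add/mnm0]_(i <- s) G i ->
   {in s, forall i, F i = G i}).
Proof.
elim: s => [|i s IH] h; first by rewrite !big_nil; split=> //; case: mo => -[].
have [l1 e1] : le (\big[mnm_add/mnm0]_(i <- s) F i) (\big[mnm_add/mnm0]_(i <- s) G i) /\
  (\big[mnm_add/mnm0]_(i <- s) F i = \big[mnm_add/mnm0]_(i <- s) G i ->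
   {in s, forall i, F i = G i}).
  by apply: IH => j js; apply: h; rewrite inE js orbT.
rewrite !big_cons; have [l e] := mo_add (h i (mem_head _ _)) l1.
split=> // /e[ei /e1 es] j; rewrite inE => /orP[/eqP->//|]; exact: es.
Qed.

End MonomialOrder.

Section Independence.

Context {disp : Order.disp_t} {L : finTBDistrLatticeType disp}.
Implicit Types (a b c x y z : L) (q : quad L) (Q S : seq (quad L)).

Definition mult (p : L * L) x : nat := ((p.1 == x) + (p.2 == x))%N.

Lemma mult_mem p x : mult p x != 0%N -> x = p.1 \/ x = p.2.
Proof.
rewrite /mult; case: (eqVneq p.1 x) => [->|_]; first by left.
by case: (eqVneq p.2 x) => [->|//]; right.
Qed.

Lemma mon_mult p x : mon p.1 p.2 (enum_rank x) = mult p x.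
Proof. exact: monE. Qed.

Context (Q : seq (quad L)) (le : rel 'X_{1..#|L|}) (mo : monomial_order le).
Hypotheses (rQ : all rect Q) (uQ : uniq (leads Q)).
Hypothesis lQ : {in Q, forall q, le (tail_mon q) (lead_mon q)}.

Lemma lead_mon_neq_tail q : rect q -> lead_mon q != tail_mon q.
Proof.
move=> /rect_side_mon[h [[-> ->]|[-> ->]]]; first exact: mon_meet_join.
by rewrite eq_sym; exact: mon_meet_join.
Qed.

Lemma mult_lead_le1 q q' x : q \in Q -> q' \in Q -> mult q.1 x != 0%N ->
  mult q'.1 x != 0%N -> q = q'.
Proof.
move=> qQ q'Q h h'.
have xq : x \in lead q by rewrite !inE; case: (mult_mem h) => ->; rewrite eqxx ?orbT.
have xq' : x \in lead q' by rewrite !inE; case: (mult_mem h') => ->; rewrite eqxx ?orbT.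
move: uQ qQ q'Q xq xq'; clear; elim: (Q) => //= r S IH.
rewrite inE negb_or -/(leads S) => /and3P[/andP[_ n1] n2 uS].
rewrite [q \in _]inE [q' \in _]inE.
have no s : s \in S -> x \in lead r -> x \in lead s -> False.
  move=> sS; rewrite [x \in lead r]inE mem_seq1 => /orP[]/eqP-> xs.
    by move/negP: n1; apply; apply/leadsP; exists s.
  by move/negP: n2; apply; apply/leadsP; exists s.
case/orP=> [/eqP->|qS] /orP[/eqP->|q'S] // xq xq'; last exact: IH.
  by case: (no _ q'S).
by case: (no _ qS).
Qed.

Lemma mult_lead_le q x : q \in Q -> (mult q.1 x <= 1)%N.
Proof.
move=> /(allP rQ)/rectP[ne _ _ _]; rewrite /mult.
case: (eqVneq q.1.1 x) => [e|_]; last by case: (_ == _).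
by rewrite -e eq_sym (negbTE ne).
Qed.

Lemma uniq_of_leads : uniq Q.
Proof.
move: uQ; clear; elim: (Q) => //= r S IH.
rewrite inE negb_or -/(leads S) => /and3P[/andP[_ n1] _ uS].
rewrite IH // andbT; apply: contra n1 => rS; apply/leadsP; exists r => //.
exact: mem_head.
Qed.

(** Let M1 and M2 be the products of the leads and of the tails, raised to the positive parts of c;
    then M2 <= M1. As leads are disjoint, each exponent of M1 comes from a single quad, and the
    relation bounds it by the exponent in M2. So M1 divides M2 and M1 <= M2. The equality forces
    lead = tail wherever c is positive, which is absurd. *)
Lemma nonpos_combination (c : quad L -> int) :
  (forall x, \sum_(q <- Q) c q * (mult q.1 x)%:Z = \sum_(q <- Q) c q * (mult q.2 x)%:Z) ->
  {in Q, forall q, c q <= 0}.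
Proof.
move=> eqc q qQ; rewrite leNgt; apply/negP => cq.
pose d r : nat := if 0 < c r then `|c r|%N else 0%N.
have cd r : c r <= (d r)%:Z.
  by rewrite /d; case: ltP => h; [rewrite gez0_abs // ltW|].
pose M1 := \big[mnm_add/mnm0]_(r <- Q) (lead_mon r *+ d r)%MM.
pose M2 := \big[mnm_add/mnm0]_(r <- Q) (tail_mon r *+ d r)%MM.
have [l21 strict] : le M2 M1 /\ (M2 = M1 -> {in Q, forall r,
    (tail_mon r *+ d r)%MM = (lead_mon r *+ d r)%MM}).
  by apply: (mo_sum mo) => r rQ'; have [] := mo_muln mo (d r) (lQ rQ').
have dvd : (M1 <= M2)%MM.
  apply/mnm_lepP => i; have [x ->] : exists x, i = enum_rank x.
    by exists (enum_val i); rewrite enum_valK.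
  rewrite /M1 /M2 !mnm_sumE.
  have -> : (\sum_(r <- Q) (lead_mon r *+ d r)%MM (enum_rank x) = \sum_(r <- Q) mult r.1 x * d r)%N.
    by apply: eq_bigr => r _; rewrite mulmnE mon_mult.
  have -> : (\sum_(r <- Q) (tail_mon r *+ d r)%MM (enum_rank x) = \sum_(r <- Q) mult r.2 x * d r)%N.
    by apply: eq_bigr => r _; rewrite mulmnE mon_mult.
  have [/hasP[r0 r0Q r0x]|/hasPn no] := boolP (has (fun r => mult r.1 x != 0%N) Q); last first.
    by rewrite big_seq big1 // => r /no; rewrite negbK => /eqP->.
  have zero r : r \in Q -> r != r0 -> mult r.1 x = 0%N.
    move=> rQ'; apply: contra_neq_eq => rx.
    by rewrite (mult_lead_le1 rQ' r0Q rx r0x).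
  have one : mult r0.1 x = 1%N.
    by have := mult_lead_le x r0Q; case: (mult r0.1 x) r0x => [|[|]].
  rewrite (bigD1_seq r0) ?uniq_of_leads //= one mul1n big_seq_cond big1 ?addn0; last first.
    by move=> r /andP[rQ' ne]; rewrite zero.
  have := eqc x; rewrite (bigD1_seq r0) ?uniq_of_leads //= one mulr1.
  rewrite big_seq_cond big1 ?addr0; last first.
    by move=> r /andP[rQ' ne]; rewrite zero // mulr0.
  move=> e; rewrite {1}/d; have [c0|//] := ltP 0 (c r0).
  rewrite -lez_nat (gez0_abs (ltW c0)) e.
  rewrite (big_morph Posz PoszD (erefl (0 : int))); apply: ler_sum => r _.
  by rewrite PoszM mulrC; apply: ler_wpM2l.
have e12 : M2 = M1.
  have [[_ anti _ _] le0 add] := mo.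
  apply: anti; rewrite l21 /=.
  rewrite -(submK dvd) addmC -{1}[M1]addm0 addmC [X in le _ X]addmC.
  exact: add.
have := strict e12 _ qQ; have [_ h] := mo_muln mo (d q) (lQ qQ) => /h e.
have /lead_mon_neq_tail := allP rQ _ qQ; rewrite e ?eqxx //.
by rewrite /d cq absz_gt0; case: ltgtP cq.
Qed.

Lemma zero_combination (c : quad L -> int) :
  (forall x, \sum_(q <- Q) c q * (mult q.1 x)%:Z = \sum_(q <- Q) c q * (mult q.2 x)%:Z) ->
  {in Q, forall q, c q = 0}.
Proof.
move=> eqc q qQ; apply/le_anti; rewrite (nonpos_combination eqc) //=.
rewrite -oppr_le0; apply: (@nonpos_combination (fun q => - c q)) qQ => x.
under eq_bigr do rewrite mulNr; under [RHS]eq_bigr do rewrite mulNr.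
by rewrite !sumrN eqc.
Qed.

Definition modular (phi : L -> rat) : Prop :=
  forall a b, phi (a `&` b)%O + phi (a `|` b)%O = phi a + phi b.

(* The vectors lead - tail are linearly independent and orthogonal to all the
   modular functions, hence remain independent off a set [C] on which the
   modular functions separate the functions. *)
Lemma quads_bound (A C : {set L}) :
  (forall f : L -> rat, (forall x, x \notin C -> f x = 0) ->
     (forall phi, modular phi -> \sum_x f x * phi x = 0) -> forall x, f x = 0) ->
  {in Q, forall q, {subset lead q <= A} /\ {subset tail q <= A}} ->
  (size Q <= #|A :\: C|)%N.
Proof.
move=> hC hA.
pose qi (i : 'I_(size Q)) := tnth (in_tuple Q) i.
have qiQ i : qi i \in Q by exact: mem_tnth.
pose g (i : 'I_(size Q)) x : rat := (mult (qi i).1 x)%:R - (mult (qi i).2 x)%:R.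
pose M : 'M[rat]_(size Q, #|A :\: C|) := \matrix_(i, j) g i (enum_val j).
suff : row_free M by rewrite /row_free => /eqP <-; exact: rank_leq_col.
apply: inj_row_free => v vM; apply/rowP => i0; rewrite mxE.
pose f x := \sum_i v 0 i * g i x.
(* f vanishes off C: on A minus C because v is in the kernel of M, and outside A because all the
   quads lie in A. It is also orthogonal to the modular functions, as meet and join balance the two
   halves of a rectangle. *)
have f0 x : f x = 0.
  apply: hC => {x}.
    move=> x xC; have [xA|xA] := boolP (x \in A).
      have xAC : x \in A :\: C by rewrite inE xC.
      have := congr1 (fun w : 'rV_ _ => w 0 (enum_rank_in xAC x)) vM; rewrite !mxE => e.
      by rewrite -[RHS]e; apply: eq_bigr => i _; rewrite mxE enum_rankK_in.
    rewrite /f big1 // => i _; have [hl ht] := hA _ (qiQ i).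
    have m1 : mult (qi i).1 x = 0%N.
      apply/eqP; apply: contraR xA => /mult_mem e; apply: hl.
      by rewrite !inE; case: e => ->; rewrite eqxx ?orbT.
    have m2 : mult (qi i).2 x = 0%N.
      apply/eqP; apply: contraR xA => /mult_mem e; apply: ht.
      by rewrite !inE; case: e => ->; rewrite eqxx ?orbT.
    by rewrite /g m1 m2 subrr mulr0.
  move=> phi mphi; under eq_bigr do rewrite mulr_suml.
  rewrite exchange_big big1 //= => i _.
  under eq_bigr do rewrite -mulrA.
  rewrite -mulr_sumr; have -> : \sum_x g i x * phi x = 0; last by rewrite mulr0.
  have sm (p : L * L) : \sum_x (mult p x)%:R * phi x = phi p.1 + phi p.2.
    under eq_bigr do rewrite natrD mulrDl.
    rewrite big_split /=; congr (_ + _).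
      rewrite (bigD1 p.1) //= eqxx mul1r big1 ?addr0 // => x.
      by rewrite eq_sym => /negbTE->; rewrite mul0r.
    rewrite (bigD1 p.2) //= eqxx mul1r big1 ?addr0 // => x.
    by rewrite eq_sym => /negbTE->; rewrite mul0r.
  under eq_bigr do rewrite mulrBl.
  rewrite sumrB !sm; have := allP rQ _ (qiQ i).
  case: (qi i) => [[p w] [a b]]; rewrite /rect /meet_join /= !inE.
  by case/orP=> /andP[_ /orP[]/eqP[-> ->]]; rewrite ?mphi ?[phi (_ `|` _)%O + _]addrC ?mphi subrr.
(* Multiplying by the product of all denominators turns v into integers, which can serve as
   exponents of monomials. *)
pose z (i : 'I_(size Q)) : int := numq (v 0 i) * \prod_(j | j != i) denq (v 0 j).
have D0 : \prod_j denq (v 0 j) != 0 by apply/prodf_neq0 => j _; exact: denq_neq0.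
have vz i : v 0 i * (\prod_j denq (v 0 j))%:~R = (z i)%:~R.
  rewrite /z (bigD1 i) //= !rmorphM /= mulrA; congr (_ * _).
  by rewrite numqE.
pose c (q : quad L) : int := if insub (index q Q) is Some i then z i else 0.
have cq i : c (qi i) = z i.
  rewrite /c /qi (tnth_nth (qi i)) /= index_uniq ?uniq_of_leads //.
  by rewrite insubT //= => lt; congr z; apply: val_inj.
have zero : {in Q, forall q, c q = 0}.
  apply: zero_combination => x; apply/eqP; rewrite -subr_eq0 -sumrB.
  rewrite -(intr_eq0 rat).
  have := congr1 (fun w : rat => w * (\prod_j denq (v 0 j))%:~R) (f0 x).
  rewrite mul0r /f mulr_suml => e; apply/eqP; rewrite -[RHS]e.
  rewrite (big_tnth _ _ Q) rmorph_sum /=; apply: eq_bigr => i _.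
  rewrite -/(qi i) cq -mulrBr rmorphM /= -vz rmorphB /= -!pmulrn /g; ring.
have : z i0 = 0 by rewrite -cq zero.
move/eqP; rewrite -(intr_eq0 rat) -vz mulf_eq0 intr_eq0 (negbTE D0) orbF.
by move/eqP.
Qed.

End Independence.

End Independence.

(** * Intervals and apexes *)

Section Intervals.

Context {disp : Order.disp_t} {L : finTBDistrLatticeType disp}.
Implicit Types (a b c x y z : L) (A C : {set L}).

Lemma itvE x y a : (a \in itv x y) = (x <= a <= y).
Proof. by rewrite inE. Qed.

Lemma bot_in_itv x y : x <= y -> bot_in (itv x y) = x.
Proof.
move=> xy; apply/le_anti/andP; split.
  by apply: meets_inf; rewrite itvE lexx.
by apply/meetsP => a; rewrite itvE => /andP[].
Qed.

Lemma top_in_itv x y : x <= y -> top_in (itv x y) = y.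
Proof.
move=> xy; apply/le_anti/andP; split.
  by apply/joinsP => a; rewrite itvE => /andP[].
have yI : y \in itv x y by rewrite itvE xy lexx.
exact: (@joins_sup _ _ L y (mem (itv x y)) id yI).
Qed.

Context (rk : L -> nat) (gr : graded rk).

Notation lev := (lev rk).

Lemma rk_chain_inj C : chain C -> {in C &, injective rk}.
Proof.
move=> /forall_inP ch a b aC bC e.
have /forall_inP/(_ b bC)/orP[ab|ba] := ch a aC.
  by apply: (eq_rk gr); rewrite ?e.
by apply/esym/(eq_rk gr); rewrite ?e.
Qed.

Lemma exists_chain x a : x <= a ->
  exists C, [/\ chain_with_top (itv x a) a C & #|C| = (rk a - rk x).+1].
Proof.
move=> xa; have : (rk a = rk x + (rk a - rk x))%N.
  by rewrite subnKC // (rk_le gr).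
move: (rk a - rk x)%N => n; elim: n a xa => [|n IH] a xa ra.
  have e : x = a by apply: (eq_rk gr); rewrite // ra addn0.
  exists [set a]; rewrite cards1 e; split=> //; apply/and4P; split.
  - by apply/subsetP => c /set1P->; rewrite itvE lexx.
  - by apply/forall_inP => c /set1P->; apply/forall_inP => c' /set1P->; exact: comparablexx.
  - by rewrite inE.
  - by apply/forall_inP => c /set1P->.
have lt : x < a.
  by rewrite lt_neqAle xa andbT; apply/eqP => e; move: ra; rewrite e; lia.
have [_ _ _ down] := gr; have [c /andP[xc ca] rc] := down _ _ lt.
have [|C [/and4P[sC chC cC /forall_inP topC] cardC]] := IH c xc; first by move: ra rc; lia.
have aC : a \notin C by apply/negP => /topC; rewrite lt_geF.
exists (a |: C); rewrite cardsU1 aC cardC; split=> //; apply/and4P; split.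
- apply/subsetP => e /setU1P[->|/(subsetP sC)]; rewrite !itvE ?xa ?lexx //.
  by move=> /andP[-> ec]; rewrite (le_trans ec) // ltW.
- have top' e : e \in C -> e <= a by move=> /topC ec; rewrite (le_trans ec) // ltW.
  apply/forall_inP => e /setU1P[->|eC]; apply/forall_inP => e' /setU1P[->|e'C].
  + exact: comparablexx.
  + by rewrite ge_comparable // top'.
  + by rewrite le_comparable // top'.
  + by move/forall_inP: chC => /(_ e eC)/forall_inP/(_ e' e'C).
- by rewrite setU11.
- apply/forall_inP => e /setU1P[->|/topC ec]; rewrite ?lexx //.
  by rewrite (le_trans ec) // ltW.
Qed.

(** [rk] is injective on a chain, which bounds its length; [exists_chain] attains the bound. *)
Lemma rank_itv x y a : a \in itv x y -> rank (itv x y) a = (rk a - rk x)%N.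
Proof.
rewrite itvE => /andP[xa ay]; apply/eqP; rewrite eqn_leq; apply/andP; split.
  apply/bigmax_leqP => C /and4P[sC chC aC /forall_inP topC].
  have inj := rk_chain_inj chC.
  suff : (#|C| <= (rk a - rk x).+1)%N by case: #|C|.
  rewrite cardE -(size_map rk) -(size_iota (rk x) (rk a - rk x).+1).
  apply: uniq_leq_size.
    rewrite map_inj_in_uniq ?enum_uniq // => b c; rewrite !mem_enum; exact: inj.
  move=> k /mapP[b]; rewrite mem_enum => bC ->; rewrite mem_iota.
  have /(subsetP sC) := bC; rewrite itvE => /andP[xb _].
  have := rk_le gr xb; have := rk_le gr (topC _ bC); lia.
have [C [hC cC]] := exists_chain xa.
have hC' : chain_with_top (itv x y) a C.
  case/and4P: hC => sC h1 h2 h3; apply/and4P; split=> //.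
  apply/subsetP => c /(subsetP sC); rewrite !itvE => /andP[-> ca].
  exact: le_trans ca ay.
have := @leq_bigmax_cond _ (chain_with_top (itv x y) a) (fun C => #|C|.-1) C hC'.
by rewrite cC.
Qed.

Lemma above_rank a k : (rk a <= k <= rk \top)%N -> exists2 b, a <= b & rk b = k.
Proof.
move=> /andP[ak kt]; have -> : k = (rk a + (k - rk a))%N by rewrite subnKC.
have : (rk a + (k - rk a) <= rk \top)%N by rewrite subnKC.
elim: (k - rk a)%N => [|n IH] h; first by exists a; rewrite ?addn0.
have [|b ab rb] := IH; first by move: h; lia.
have lt : b < \top by rewrite lt_neqAle lex1 andbT; apply/eqP => e; move: h; rewrite -e rb; lia.
have [_ _ up _] := gr; have [c /andP[bc _] rc] := up _ _ lt.
by exists c; [exact: le_trans ab (ltW bc)|rewrite rc rb addnS].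
Qed.

Lemma below_rank a k : (rk \bot <= k <= rk a)%N -> exists2 b, b <= a & rk b = k.
Proof.
move=> /andP[bk ka]; have : (k = rk a - (rk a - k))%N by rewrite subKn.
have : (rk \bot + (rk a - k) <= rk a)%N by lia.
move: (rk a - k)%N => n h e; rewrite e {bk ka e k}.
elim: n h => [|n IH] h; first by exists a; rewrite ?subn0.
have [|b ab rb] := IH; first by move: h; lia.
have lt : \bot < b.
  by rewrite lt_neqAle le0x andbT; apply/eqP => e; move: h rb; rewrite -e; lia.
have [_ _ _ down] := gr; have [c /andP[_ bc] rc] := down _ _ lt.
by exists c; [exact: le_trans (ltW bc) ab|move: rc rb; lia].
Qed.

Lemma apexP x : reflect (forall a, x >=< a) (apex [set: L] x).
Proof.
rewrite /apex in_setT /=; apply: (iffP forall_inP) => h a; first exact: h.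
by move=> _; exact: h.
Qed.

Lemma apex_card x : apex [set: L] x <-> #|lev (rk x)| = 1.
Proof.
split=> [/apexP h|h].
  apply/eqP/cards1P; exists x; apply/setP => a; rewrite !inE.
  apply/eqP/eqP => [e|-> //].
  by have /orP[xa|ax] := h a; [apply/esym/(eq_rk gr); rewrite ?e|apply: (eq_rk gr); rewrite ?e].
apply/apexP => a; have [l|l] := leqP (rk a) (rk x).
  have [|b ab rb] := @above_rank a (rk x); first by rewrite l (rk_le gr) // lex1.
  by rewrite (card_lev1 h (erefl _) rb) ge_comparable.
have [|b ab rb] := @below_rank a (rk x); first by rewrite (rk_le gr) ?le0x // ltnW.
by rewrite (card_lev1 h (erefl _) rb) le_comparable.
Qed.

Lemma apex_le x a : apex [set: L] x -> (rk x < rk a)%N -> x <= a.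
Proof. by move=> /apexP/(_ a)/orP[//|/(rk_le gr)]; case: ltngtP. Qed.

Lemma apex_ge x a : apex [set: L] x -> (rk a < rk x)%N -> a <= x.
Proof. by move=> /apexP/(_ a)/orP[/(rk_le gr)|//]; case: ltngtP. Qed.

Lemma apex_itv x y a : apex [set: L] x -> apex [set: L] y -> (rk x <= rk y)%N ->
  (a \in itv x y) = (rk x <= rk a <= rk y)%N.
Proof.
move=> ax ay xy; rewrite itvE; apply/andP/andP => -[h1 h2].
  by split; apply: (rk_le gr).
split.
  move: h1; rewrite leq_eqVlt => /orP[/eqP e|]; last exact: apex_le.
  have /apex_card c1 := ax; by rewrite (card_lev1 c1 (erefl _) (esym e)).
move: h2; rewrite leq_eqVlt => /orP[/eqP e|]; last exact: apex_ge.
have /apex_card c1 := ay; by rewrite (card_lev1 c1 e (erefl _)).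
Qed.

Lemma rho_itv x y i : apex [set: L] x -> apex [set: L] y -> (rk x <= rk y)%N ->
  (rk x + i <= rk y)%N -> rho (itv x y) i = #|lev (rk x + i)|.
Proof.
move=> ax ay xy xi; apply: eq_card => a; rewrite [in LHS]inE [in RHS]inE.
apply/andP/eqP => [[aA /eqP]|e].
  rewrite rank_itv // => <-; move: aA; rewrite apex_itv // => /andP[h _].
  by rewrite subnKC.
have aA : a \in itv x y by rewrite apex_itv // e xi leq_addr.
by split=> //; rewrite rank_itv // e addKn.
Qed.

Lemma card_between m n :
  #|[set x | (m < rk x < m + n.+1)%N]| = (\sum_(k <- iota m.+1 n) #|lev k|)%N.
Proof.
elim: n => [|n IH].
  by rewrite big_nil; apply: eq_card0 => x; rewrite !inE addn1; apply/negP; clear; lia.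
have -> : iota m.+1 n.+1 = iota m.+1 n ++ [:: m.+1 + n]%N by rewrite -[n.+1]addn1 iotaD.
rewrite big_cat big_seq1 -IH addSnnS.
have -> : [set x | (m < rk x < m + n.+2)%N] = [set x | (m < rk x < m + n.+1)%N] :|: lev (m + n.+1).
  by apply/setP => x; rewrite !inE; clear; apply/idP/orP; lia.
rewrite cardsU (_ : _ :&: _ = set0) ?cards0 ?subn0 //.
apply/setP => x; rewrite !inE; apply/negP => /andP[h /eqP e]; move: h; rewrite e; clear; lia.
Qed.

Lemma card_between_width3 m M : (m < M)%N ->
  (forall k, (m < k < M)%N -> (2 <= #|lev k| <= 3)%N) ->
  #|[set x | (m < rk x < M)%N]| = ((M - m).-1.*2 + size (width3 rk m M))%N.
Proof.
move=> mM h; have e : M = (m + (M - m).-1.+1)%N by lia.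
rewrite {1}e card_between.
have -> : size (width3 rk m M) = (\sum_(k <- iota m.+1 (M - m).-1) (#|lev k| == 3))%N.
  by rewrite size_filter -sum1_count big_mkcond; apply: eq_bigr => k _; case: eqP.
have -> : (M - m).-1.*2 = (\sum_(k <- iota m.+1 (M - m).-1) 2)%N.
  by rewrite big_const_seq count_predT size_iota iter_addn addn0 mul2n.
have hk k : k \in iota m.+1 (M - m).-1 -> (2 <= #|lev k| <= 3)%N.
  by rewrite mem_iota => hk; apply: h; lia.
rewrite -big_split /=; apply: eq_big_seq => k /hk; move: #|lev k| => c; case: eqP; clear; lia.
Qed.

(** An element of level k - 1 has at most two upper covers, since three would have three joins at
    level k + 1. Every element of level k covers one of level k - 1, and if there are two of these,
    their sets of covers share their join: 2 + 2 - 1 = 3. *)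
Lemma card_lev_le3 k : (rk \bot < k)%N -> (#|lev k.-1| <= 2)%N -> (#|lev k.+1| <= 2)%N ->
  (#|lev k| <= 3)%N.
Proof.
move=> bk c2 c2'; have ek : k = k.-1.+1 by lia.
pose up m := [set x in lev k | m <= x].
have upE m x : (x \in up m) = (rk x == k) && (m <= x) by rewrite !inE.
have card_up m : rk m = k.-1 -> (#|up m| <= 2)%N.
  move=> rm; rewrite leqNgt; apply/negP => /card_gt2P[x [y [z [[xu yu zu] [xy yz zx]]]]].
  move: xu yu zu; rewrite !upE => /andP[/eqP rx mx] /andP[/eqP ry my] /andP[/eqP rz mz].
  rewrite ek in rx ry rz c2'.
  by apply: (no_triple_above gr c2' rx ry rz _ _ _ rm); rewrite // eq_sym.
have cov x : rk x = k -> exists2 m, rk m = k.-1 & m <= x.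
  move=> rx; have [|b bx rb] := @below_rank x k.-1; last by exists b.
  by rewrite rx leq_pred andbT; lia.
have [c1|c1] := leqP #|lev k.-1| 1.
  have [/cards0_eq e|] := posnP #|lev k|; first by rewrite e cards0.
  move=> /card_gt0P[x]; rewrite inE => /eqP/cov[m rm _].
  apply: leq_trans (_ : #|up m| <= 3)%N; last exact: leq_trans (card_up _ rm) _.
  apply/subset_leq_card/subsetP => y; rewrite inE upE => /eqP ry; rewrite ry eqxx.
  have [m' rm' ?] := cov _ ry; have c1' : #|lev k.-1| = 1.
    apply/eqP; rewrite eqn_leq c1 card_gt0; apply/set0Pn; exists m; by rewrite inE rm.
  by rewrite (card_lev1 c1' rm rm').
have c2e : #|lev k.-1| = 2 by lia.
have [a [b hab]] := pair_lev_ex c2e; have [ab ra rb hl] := hab.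
have sub : lev k \subset up a :|: up b.
  apply/subsetP => x; rewrite inE => /eqP rx; have [m rm mx] := cov _ rx.
  by rewrite inE !upE rx eqxx; have [<-|<-] := hl _ rm; rewrite mx ?orbT.
apply: leq_trans (subset_leq_card sub) _; rewrite cardsU.
have : (0 < #|up a :&: up b|)%N.
  apply/card_gt0P; exists (a `|` b); rewrite inE !upE leUl leUr.
  by rewrite (pair_join gr hab) -ek eqxx.
have := card_up _ ra; have := card_up _ rb; lia.
Qed.

End Intervals.

(** * Lattices of poset ideals *)

Section Ideals.

Context {disp : Order.disp_t} {P : finPOrderType disp}.
Implicit Types (a b c x y z : J P) (p q r : P).

Lemma leJ a b : (a <= b) = (J_val a \subset J_val b).
Proof. by rewrite leEsub Order.SetSubsetOrder.leEsubset. Qed.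

Lemma J_valI a b : J_val (a `&` b) = J_val a :&: J_val b.
Proof. by []. Qed.

Lemma J_valU a b : J_val (a `|` b) = J_val a :|: J_val b.
Proof. by []. Qed.

(** Locked, so that conversion does not unfold ranks into cardinalities. *)
Definition rkJ : J P -> nat := locked (fun a => #|J_val a|).

Lemma rkJE a : rkJ a = #|J_val a|.
Proof. by rewrite /rkJ -lock. Qed.

Lemma rkJ_bot : rkJ (\bot : J P) = 0%N.
Proof. by rewrite rkJE; exact: cards0. Qed.

Lemma rkJ_top : rkJ (\top : J P) = #|P|.
Proof. by rewrite rkJE; exact: cardsT. Qed.

Lemma J_down a p q : p \in J_val a -> q <= p -> q \in J_val a.
Proof. by have /poset_idealP := J_valP a; apply. Qed.

Lemma exists_minimal (A : {set P}) p0 : p0 \in A ->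
  exists2 p, p \in A & forall q, q \in A -> q <= p -> q = p.
Proof.
move=> p0A; have [p pA h] := arg_minnP (fun p => #|[set q | q <= p]|) p0A.
exists p => // q qA qp; apply/eqP; rewrite eq_le qp /=; apply/negPn/negP => npq.
have := h _ qA; rewrite leqNgt => /negP; apply; apply: proper_card.
apply/properP; split.
  by apply/subsetP => r; rewrite !inE => /le_trans; apply.
by exists p; rewrite !inE.
Qed.

Lemma exists_maximal (A : {set P}) p0 : p0 \in A ->
  exists2 p, p \in A & forall q, q \in A -> p <= q -> q = p.
Proof.
move=> p0A; have [p pA h] := arg_minnP (fun p => #|[set q | p <= q]|) p0A.
exists p => // q qA pq; apply/eqP; rewrite eq_le pq andbT; apply/negPn/negP => nqp.
have := h _ qA; rewrite leqNgt => /negP; apply; apply: proper_card.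
apply/properP; split.
  by apply/subsetP => r; rewrite !inE; exact: le_trans.
by exists p; rewrite !inE.
Qed.

Lemma J_remove_max x y : x < y ->
  exists c p, [/\ x <= c, J_val y = p |: J_val c, p \notin J_val c & p \notin J_val x].
Proof.
rewrite lt_neqAle leJ => /andP[ne sub].
have /subsetPn[p0 p0y p0x] : ~~ (J_val y \subset J_val x).
  apply: contra ne => s'; apply/eqP/val_inj/eqP; by rewrite eqEsubset sub.
have [|p pA pmax] := @exists_maximal (J_val y :\: J_val x) p0; first by rewrite inE p0x.
move: pA; rewrite inE => /andP[px py].
have idl : J_val y :\ p \in @poset_ideal disp P.
  apply/poset_idealP => q r; rewrite !inE => /andP[qp qy] rq.
  rewrite (J_down qy rq) andbT; apply: contraNneq qp => e; rewrite e in rq.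
  apply/eqP/pmax => //; rewrite inE qy andbT; apply: contra px => qx.
  exact: J_down qx rq.
exists (MkJ idl), p; split=> //=.
- rewrite leJ /=; apply/subsetP => q qx; rewrite !inE (subsetP sub) // andbT.
  by apply: contraNneq px => <-.
- by rewrite setD1K.
- by rewrite !inE eqxx.
Qed.

Lemma graded_rkJ : graded rkJ.
Proof.
split.
- move=> a b; rewrite lt_neqAle leJ !rkJE => /andP[ne sub]; apply: proper_card.
  rewrite properEneq sub andbT; apply: contra ne => /eqP e; apply/eqP.
  exact: val_inj.
- by move=> a b; rewrite !rkJE J_valI J_valU addnC cardsUI.
- move=> x y; rewrite lt_neqAle leJ => /andP[ne sub].
  have /subsetPn[p0 p0y p0x] : ~~ (J_val y \subset J_val x).
    apply: contra ne => s'; apply/eqP/val_inj/eqP; by rewrite eqEsubset sub.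
  have [|p pA pmin] := @exists_minimal (J_val y :\: J_val x) p0; first by rewrite inE p0x.
  move: pA; rewrite inE => /andP[px py].
  have idl : p |: J_val x \in @poset_ideal disp P.
    apply/poset_idealP => q r /setU1P[->|qx] rq; last first.
      by rewrite inE (J_down qx rq) orbT.
    rewrite !inE; have [//|rx] := boolP (r \in J_val x); first by rewrite orbT.
    by rewrite orbF; apply/eqP/pmin => //; rewrite inE rx (J_down py rq).
  exists (MkJ idl); last by rewrite !rkJE /= cardsU1 px.
  rewrite lt_neqAle !leJ /= subsetUr andbT; apply/andP; split.
    by apply: contraNneq px => -> /=; rewrite setU11.
  by rewrite subUset sub1set py.
- move=> x y /J_remove_max[c [p [xc ey pc px]]]; exists c; last first.
    by rewrite !rkJE ey cardsU1 pc.
  rewrite xc lt_neqAle leJ ey subsetUr andbT /=.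
  by apply: contraNneq pc => ->; rewrite ey setU11.
Qed.

Lemma modular_mem p : modular (fun a => (p \in J_val a)%:R : rat).
Proof.
move=> a b; rewrite J_valI J_valU !inE.
by case: (p \in J_val a); case: (p \in J_val b); rewrite ?addr0 ?add0r.
Qed.

(* [C] is a maximal chain of [x, y], and the modular functions used are the
   constants and the indicators of the sets [{a | p \in a}], for p in P. *)
Lemma exists_separated x y : x <= y ->
  exists C : {set J P}, [/\ C \subset itv x y, #|C| = (rkJ y - rkJ x).+1 &
    forall f : J P -> rat, (forall a, a \notin C -> f a = 0%R) ->
     (forall phi, modular phi -> (\sum_a f a * phi a = 0)%R) -> forall a, f a = 0%R].
Proof.
move=> xy; have : (rkJ y = rkJ x + (rkJ y - rkJ x))%N.
  by rewrite subnKC // (rk_le graded_rkJ).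
move: (rkJ y - rkJ x)%N => n; elim: n y xy => [|n IH] y xy ry.
  have e : x = y by apply: (eq_rk graded_rkJ); rewrite // ry addn0.
  exists [set y]; rewrite cards1; split=> //.
    by rewrite sub1set itvE xy lexx.
  move=> f f0 /(_ (fun=> 1%R)) h a; have [->|ay] := eqVneq a y; last first.
    by apply: f0; rewrite inE.
  have := h (fun _ _ => erefl); rewrite (bigD1 y) //= mulr1 big1 ?addr0 // => b bny.
  by rewrite f0 ?mul0r // inE.
have lt : x < y.
  by rewrite lt_neqAle xy andbT; apply/eqP => e; move: ry; rewrite e; lia.
have [c [p [xc ey pc px]]] := J_remove_max lt.
have rc : rkJ y = (rkJ c).+1 by rewrite !rkJE ey cardsU1 pc.
have cy : c <= y by rewrite leJ ey subsetUr.
have [|C [sC cC hC]] := IH c xc; first by move: ry rc; lia.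
have nC b : b \in C -> p \notin J_val b.
  move=> /(subsetP sC); rewrite itvE leJ => /andP[_]; rewrite leJ => bc.
  by apply: contra pc => /(subsetP bc).
have py : p \in J_val y by rewrite ey setU11.
have yC : y \notin C by apply/negP => /nC; rewrite py.
exists (y |: C); split.
- apply/subsetP => b /setU1P[->|/(subsetP sC)]; rewrite !itvE ?xy ?lexx //.
  by move=> /andP[-> bc]; rewrite (le_trans bc).
- by rewrite cardsU1 yC cC.
(* Among the elements of the chain only y contains p, so the indicator of p isolates f y. *)
move=> f f0 hf; have fy : f y = 0%R.
  have := hf _ (modular_mem p); rewrite (bigD1 y) //= py mulr1 big1 ?addr0 // => b bny.
  have [bC|bC] := boolP (b \in C); first by rewrite (negbTE (nC _ bC)) mulr0.
  by rewrite f0 ?mul0r // !inE negb_or bny.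
apply: hC => // a aC; have [->//|ay] := eqVneq a y.
by apply: f0; rewrite !inE negb_or ay.
Qed.

(* The join-irreducible elements of [x, y] are the [x \/ (down set of p)]. *)
Lemma dim_itv x y : x <= y -> Defs.dim (itv x y) = (rkJ y - rkJ x)%N.
Proof.
move=> xy; have sub : J_val x \subset J_val y by rewrite -leJ.
have idl p : J_val x :|: [set q | q <= p] \in @poset_ideal disp P.
  apply/poset_idealP => q r; rewrite !inE => /orP[qx|qp] rq.
    by rewrite (J_down qx rq).
  by rewrite (le_trans rq qp) orbT.
pose j p := MkJ (idl p).
have jI p : p \in J_val y -> j p \in itv x y.
  move=> py; rewrite itvE !leJ /= subsetUl subUset sub /=.
  by apply/subsetP => q; rewrite inE; exact: J_down.
have pj p : p \in J_val (j p) by rewrite !inE lexx orbT.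
have jle p a : x <= a -> p \in J_val a -> j p <= a.
  move=> xa pa; rewrite leJ /= subUset -leJ xa /=.
  by apply/subsetP => q; rewrite inE; exact: J_down.
rewrite /Defs.dim.
have -> : [set z in itv x y | join_irreducible (itv x y) z] = [set j p | p in J_val y :\: J_val x].
  apply/setP => z; rewrite [LHS]inE; apply/idP/imsetP.
    case/andP=> zI /and3P[_]; rewrite bot_in_itv // => zx irr.
    move: (zI); rewrite itvE => /andP[xz zy].
    have lt : x < z by rewrite lt_neqAle eq_sym zx.
    have [c [p [xc ez pc px]]] := J_remove_max lt.
    have pz : p \in J_val z by rewrite ez setU11.
    have cz : c <= z by rewrite leJ ez subsetUr.
    exists p; first by rewrite inE px /= (subsetP (_ : J_val z \subset J_val y)) -?leJ.
    have cI : c \in itv x y by rewrite itvE xc (le_trans cz).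
    have py : p \in J_val y by rewrite (subsetP (_ : J_val z \subset J_val y)) -?leJ.
    have /forall_inP/(_ c cI)/forall_inP/(_ _ (jI p py))/implyP := irr.
    have -> : (z == c `|` j p).
      apply/eqP/le_anti; rewrite leUx cz jle // !andbT leJ J_valU ez subUset sub1set.
      by rewrite inE pj orbT subsetUl.
    move=> /(_ isT)/orP[|] /eqP e //.
    by move: pz; rewrite e (negbTE pc).
  case=> p; rewrite inE => /andP[px py] ->.
  rewrite jI //= /join_irreducible jI //= bot_in_itv //.
  apply/andP; split; first by apply: contraNneq px => <-; exact: pj.
  apply/forall_inP => a; rewrite itvE => /andP[xa ay].
  apply/forall_inP => b; rewrite itvE => /andP[xb yb]; apply/implyP => /eqP e.
  have : p \in J_val (a `|` b) by rewrite -e pj.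
  rewrite J_valU inE => /orP[pa|pb]; apply/orP; [left|right]; apply/eqP/le_anti.
    by rewrite jle //= e leUl.
  by rewrite jle //= e leUr.
rewrite card_in_imset ?cardsD ?(setIidPr sub) ?rkJE // => p q.
rewrite !inE => /andP[px _] /andP[qx _] e.
have : p \in J_val (j q) by rewrite -e.
have : q \in J_val (j p) by rewrite e.
rewrite !inE (negbTE px) (negbTE qx) /= => qp pq.
by apply/le_anti; rewrite pq.
Qed.

Lemma itvT : itv \bot \top = [set: J P].
Proof. by apply/setP => a; rewrite itvE le0x lex1 inE. Qed.

Lemma dim_setT : Defs.dim [set: J P] = #|P|.
Proof. by rewrite -itvT dim_itv ?le0x // rkJ_bot rkJ_top subn0. Qed.

End Ideals.

Lemma card_itv_cat (disp : Order.disp_t) (L : finTBDistrLatticeType disp) (x y z : L) :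
  apex [set: L] y -> x <= y -> y <= z ->
  (#|itv x z| + 1)%N = (#|itv x y| + #|itv y z|)%N.
Proof.
move=> /apexP ay xy yz; rewrite -cardsUI; congr (_ + _)%N.
  apply: eq_card => a; apply/idP/setUP; rewrite !itvE => h.
    have /orP[ya|a_y] := ay a; first by right; rewrite ya; case/andP: h.
    by left; rewrite a_y; case/andP: h => ->.
  case: h => /andP[h1 h2]; first by rewrite h1 (le_trans h2).
  by rewrite h2 (le_trans xy).
rewrite -(cards1 y); apply: eq_card => a; apply/set1P/setIP => [->|]; rewrite !itvE.
  by rewrite xy yz lexx.
by case=> /andP[_ h1] /andP[h2 _]; apply/le_anti; rewrite h1.
Qed.

Lemma uniq_leads_filter (T : eqType) (p : pred (quad T)) Q :
  uniq (leads Q) -> uniq (leads (filter p Q)).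
Proof.
apply: subseq_uniq; elim: Q => // q Q IH; rewrite [filter _ _]/=.
have e R : leads (q :: R) = lead q ++ leads R by [].
by case: (p q); rewrite !e ?cat_subseq // (subseq_trans IH) // suffix_subseq.
Qed.

(* Both [f k - 2] and [f k' - 2] contribute to the excess of the sum. *)
Lemma leq_add_sum_seq (f : nat -> nat) (s : seq nat) k k' :
  (forall l, l \in s -> 2 <= f l)%N -> k \in s -> k' \in s -> k != k' ->
  (f k + f k' + (size s).*2 <= \sum_(l <- s) f l + 4)%N.
Proof.
move=> hf ks ks' kk'; have p1 := perm_to_rem ks.
have ks'' : k' \in rem k s.
  by move: ks'; rewrite (perm_mem p1) inE eq_sym (negbTE kk').
have p2 := perm_to_rem ks''.
rewrite (perm_big _ p1) big_cons /= (perm_big _ p2) big_cons /=.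
rewrite (perm_size p1) /= (perm_size p2) /=.
have hf' : (forall l, l \in rem k' (rem k s) -> 2 <= f l)%N.
  by move=> l /mem_rem/mem_rem/hf.
have : ((size (rem k' (rem k s))).*2 <= \sum_(l <- rem k' (rem k s)) f l)%N.
  elim: (rem _ _) hf' => [|l u IH] h; first by rewrite big_nil.
  rewrite big_cons /= doubleS -add2n leq_add ?h ?mem_head // IH // => m mu.
  by rewrite h // inE mu orbT.
move: (size _) (\sum_(l <- _) f l)%N => u v; clear; lia.
Qed.

(** * The blocks of a non-decomposable lattice *)

Section Apexes.

Context {disp : Order.disp_t} {P : finPOrderType disp}.
Context (s : nat) (xi : nat -> J P).
Hypotheses (hd : ~ decomposable (J P)) (xi0 : xi 0%N = \bot) (xis : xi s = \top).
Hypothesis xi_lt : forall i, (i < s)%N -> xi i < xi i.+1.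
Hypothesis xiP : forall a : J P, apex [set: J P] a <-> exists2 i, (i <= s)%N & a = xi i.

Implicit Types (a b x y : J P).

Notation gr := (@graded_rkJ disp P).
Notation lev := (lev (@rkJ disp P)).

Let r i := rkJ (xi i).
(** Numbered from 0: this is [Li i.+1] of the theorem. *)
Let block i := itv (xi i) (xi i.+1).
Let th i := theta (block i).

Lemma apex_xi i : (i <= s)%N -> apex [set: J P] (xi i).
Proof. by move=> h; apply/xiP; exists i. Qed.

Lemma xi_mono i j : (i < j <= s)%N -> xi i < xi j.
Proof.
elim: j => [|j IH]; first by rewrite ltn0.
move=> /andP[]; rewrite ltnS leq_eqVlt => /orP[/eqP->|ij] js; first exact: xi_lt.
by apply: lt_trans (xi_lt js); apply: IH; rewrite ij ltnW.
Qed.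

Lemma r_mono i j : (i < j <= s)%N -> (r i < r j)%N.
Proof. by move=> h; apply: (rk_lt gr); exact: xi_mono. Qed.

Lemma r_le i j : (i <= j <= s)%N -> (r i <= r j)%N.
Proof.
move=> /andP[]; rewrite leq_eqVlt => /orP[/eqP->//|ij] js.
by apply/ltnW/r_mono; rewrite ij.
Qed.

Lemma sublattice_itv x y : x <= y -> sublattice (itv x y).
Proof.
move=> xy; split.
- by apply/set0Pn; exists x; rewrite itvE lexx.
- move=> a b; rewrite !itvE => /andP[xa ay] /andP[xb yb].
  by rewrite lexI xa xb (le_trans (leIl a b)).
- move=> a b; rewrite !itvE => /andP[xa ay] /andP[xb yb].
  by rewrite leUx ay yb (le_trans xa (leUl a b)).
Qed.

(** If consecutive apexes had consecutive ranks, every element would be below the first or above the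
    second, and the lattice would be an ordinal sum. *)
Lemma r_gap i : (i < s)%N -> ((r i).+1 < r i.+1)%N.
Proof.
move=> si; have lt : (r i < r i.+1)%N by apply: r_mono; rewrite ltnSn.
rewrite ltn_neqAle lt andbT; apply/eqP => e; apply: hd.
have ai := apex_xi (ltnW si); have ai' := apex_xi si.
have r0 : (rkJ (\bot : J P) <= r i)%N by rewrite rkJ_bot.
have r1 : (r i.+1 <= rkJ (\top : J P))%N by apply: (rk_le gr); exact: lex1.
have ab : apex [set: J P] \bot by apply/apexP => a; rewrite le_comparable // le0x.
have at' : apex [set: J P] \top by apply/apexP => a; rewrite ge_comparable // lex1.
have mA a : (a \in itv \bot (xi i)) = (rkJ a <= r i)%N.
  by rewrite (apex_itv gr a ab ai r0) rkJ_bot.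
have e' : rkJ (xi i.+1) = (r i).+1 := esym e.
have mB a : (a \in itv (xi i.+1) \top) = (r i < rkJ a)%N.
  by rewrite (apex_itv gr a ai' at' r1) (rk_le gr (lex1 a)) andbT e'.
exists (itv \bot (xi i)), (itv (xi i.+1) \top); split.
- by apply: sublattice_itv; exact: le0x.
- by apply: sublattice_itv; exact: lex1.
split.
- apply/setP => a; rewrite in_setT; apply/setUP.
  by have [h|h] := leqP (rkJ a) (r i); [left; rewrite mA|right; rewrite mB].
- apply/pred0P => a /=; apply/negP => /andP[]; rewrite mA leqNgt => /negP h.
  by rewrite mB.
- move=> a b; rewrite !itvE => /andP[_ ai''] /andP[ib _].
  exact: le_lt_trans ai'' (lt_le_trans (xi_lt si) ib).
Qed.

Lemma rk_bounds i k : (i < s)%N -> (r i < k < r i.+1)%N -> exists x, rkJ x = k.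
Proof.
move=> si hk; have r1 : (r i.+1 <= rkJ (\top : J P))%N by apply: (rk_le gr); exact: lex1.
have [|x _ rx] := @above_rank _ _ _ gr \bot k; last by exists x.
by rewrite rkJ_bot /=; case/andP: hk => _ /ltnW h; exact: leq_trans h r1.
Qed.

Lemma inner_not_xi i x : (i < s)%N -> (r i < rkJ x < r i.+1)%N -> ~ apex [set: J P] x.
Proof.
move=> si hk /xiP[j js e]; move: hk; rewrite e -/(r j) => hk.
have [ji|ij] := leqP j i.
  have : (r j <= r i)%N by apply: r_le; rewrite ji (ltnW si).
  by lia.
have : (r i.+1 <= r j)%N by apply: r_le; rewrite ij.
lia.
Qed.

Lemma card_inner_ge2 i k : (i < s)%N -> (r i < k < r i.+1)%N -> (2 <= #|lev k|)%N.
Proof.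
move=> si hk; have [x rx] := rk_bounds si hk.
have c0 : (0 < #|lev k|)%N by apply/card_gt0P; exists x; rewrite inE rx.
rewrite leqNgt ltnS; apply/negP => c1.
have c1' : #|lev (rkJ x)| = 1 by rewrite rx; lia.
by apply: (@inner_not_xi i x si); [rewrite rx|apply/(apex_card gr)].
Qed.

Lemma card_xi i : (i <= s)%N -> #|lev (r i)| = 1.
Proof. by move=> /apex_xi/(apex_card gr). Qed.

Lemma block_le i : (i < s)%N -> xi i <= xi i.+1.
Proof. by move=> si; apply/ltW/xi_lt. Qed.

Lemma mem_block i x : (i < s)%N -> (x \in block i) = (r i <= rkJ x <= r i.+1)%N.
Proof.
move=> si; have le : (r i <= r i.+1)%N by apply: r_le; rewrite leqnSn.
exact: (apex_itv gr x (apex_xi (ltnW si)) (apex_xi si) le).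
Qed.

(** An inner element comparable with the whole block would be an apex of the whole lattice. The
    block has more than two elements because [r_gap] leaves room for an inner rank. *)
Lemma simple_block i : (i < s)%N -> simple (block i).
Proof.
move=> si; have le := block_le si; have gap := r_gap si.
have xI : xi i \in block i by rewrite itvE lexx.
have yI : xi i.+1 \in block i by rewrite itvE lexx andbT.
split; rewrite bot_in_itv // top_in_itv //.
  move=> e; have hk : (r i < (r i).+1 < r i.+1)%N by rewrite ltnSn.
  have [x rx] := rk_bounds si hk.
  have : x \in block i by rewrite mem_block // rx leqnSn ltnW.
  rewrite e !inE => /orP[]/eqP xe; move: rx; rewrite xe -/(r i) -?/(r i.+1); lia.
move=> z; split.
  case/andP=> zI /forall_inP hz; have := zI; rewrite itvE => /andP[iz zi].
  have [|ne] := eqVneq z (xi i); first by left.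
  have [|ne'] := eqVneq z (xi i.+1); first by right.
  exfalso; apply: (@inner_not_xi i z si).
    by rewrite !(rk_lt gr) // lt_neqAle ?ne' ?zi // eq_sym ne.
  apply/apexP => a; have [aI|] := boolP (a \in block i); first exact: hz.
  rewrite mem_block // negb_and -!ltnNge => /orP[h|h].
    by rewrite ge_comparable // (le_trans _ iz) // (apex_ge gr) // apex_xi // ltnW.
  by rewrite le_comparable // (le_trans zi) // (apex_le gr) // apex_xi.
case=> ->; apply/andP; split=> //; apply/forall_inP => a; rewrite itvE => /andP[ia ai].
  by rewrite le_comparable.
by rewrite ge_comparable.
Qed.

Lemma rho_block i k : (i < s)%N -> (r i + k <= r i.+1)%N ->
  rho (block i) k = #|lev (r i + k)|.
Proof.
move=> si h; have le : (r i <= r i.+1)%N by apply: r_le; rewrite leqnSn.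
exact: (rho_itv gr (apex_xi (ltnW si)) (apex_xi si) le).
Qed.

Lemma dim_block i : (i < s)%N -> Defs.dim (block i) = (r i.+1 - r i)%N.
Proof. by move=> si; apply/dim_itv/block_le. Qed.

Lemma quasi_thin_block i : (i < s)%N ->
  quasi_thin (block i) <-> (forall k, (r i < k < r i.+1)%N -> (#|lev k| <= 3)%N).
Proof.
move=> si; split=> [[_ h] k hk|h].
  have := h (k - r i)%N; rewrite dim_block // rho_block //; last by lia.
  by rewrite subnKC; [apply; lia|lia].
split; first exact: simple_block.
move=> k; rewrite dim_block // => hk; rewrite rho_block //; last by lia.
by apply: h; lia.
Qed.

(** The indices counted by [theta] include the two ends, but these are apexes, with levels of one
    element, so only inner ranks contribute. *)
Lemma theta_block i : (i < s)%N -> th i = size (width3 (@rkJ disp P) (r i) (r i.+1)).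
Proof.
move=> si; have gap := r_gap si.
rewrite /th /theta cardE -(size_map (fun k : 'I__ => r i + k)%N).
apply/perm_size/uniq_perm.
- by rewrite map_inj_uniq ?enum_uniq // => k k' /addnI/val_inj.
- exact: filter_uniq (iota_uniq _ _).
move=> k; rewrite mem_width3; last exact: ltnW gap.
apply/mapP/andP => [[j]|[hk c3]].
  rewrite mem_enum inE => /eqP + ->.
  have := ltn_ord j; rewrite {2}dim_block // => lj; rewrite rho_block //; last by lia.
  move=> c3; split; last by apply/eqP.
  apply/andP; split; rewrite ltn_neqAle; apply/andP; split; try lia.
    by apply/eqP => e; move: c3; rewrite -e card_xi // ltnW.
  by apply/eqP => e; move: c3; rewrite e card_xi.
have lt : (k - r i < (Defs.dim (block i)).+1)%N by rewrite dim_block //; lia.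
exists (Ordinal lt); last by rewrite /= subnKC //; lia.
by rewrite mem_enum inE /= rho_block // subnKC //; lia.
Qed.

Lemma card_block_inner i : (i < s)%N ->
  (forall k, (r i < k < r i.+1)%N -> (#|lev k| <= 3)%N) ->
  #|[set x : J P | (r i < rkJ x < r i.+1)%N]| = ((r i.+1 - r i).-1.*2 + th i)%N.
Proof.
move=> si h; have gap := r_gap si.
rewrite card_between_width3 ?theta_block //; first exact: ltnW gap.
by move=> k hk; rewrite (h _ hk) (card_inner_ge2 si hk).
Qed.

Lemma block_cert_block i (bot top : bool) : (i < s)%N ->
  (forall k, (r i < k < r i.+1)%N -> (#|lev k| <= 3)%N) -> th i = (bot + top)%N ->
  block_cert (@rkJ disp P) (r i) (r i.+1) bot top.
Proof.
move=> si h; have gap := ltnW (r_gap si); rewrite theta_block //.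
have c1 := card_xi (ltnW si); have c1' := card_xi si.
have c23 k : (r i < k < r i.+1)%N -> (2 <= #|lev k| <= 3)%N.
  by move=> hk; rewrite (h _ hk) (card_inner_ge2 si hk).
case: bot; case: top => e.
- exact: (block_cert2 gr c1 c1' gap c23 e).
- by case: (block_cert1 gr c1 c1' gap c23 e).
- by case: (block_cert1 gr c1 c1' gap c23 e).
- exact: (block_cert0 gr gap c23 e).
Qed.

(* The initial monomials have exactly as many variables as there are elements
   to be covered. *)
Lemma leads_block i (bot top : bool) Q : (i < s)%N ->
  (forall k, (r i < k < r i.+1)%N -> (#|lev k| <= 3)%N) -> th i = (bot + top)%N ->
  size Q = ((r i.+1 - r i).-1 + bot + top)%N ->
  (forall x, (r i + ~~ bot <= rkJ x < r i.+1 + top)%N -> x \in leads Q) ->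
  uniq (leads Q) /\
  (forall x, (x \in leads Q) = (r i + ~~ bot <= rkJ x < r i.+1 + top)%N).
Proof.
move=> si h e sQ cQ; have gap := r_gap si.
pose U := [set x : J P | (r i + ~~ bot <= rkJ x < r i.+1 + top)%N].
have cU : #|U| = ((r i.+1 - r i).-1.*2 + th i + bot + top)%N.
  pose B := [set x : J P | bot && (rkJ x == r i)].
  pose T := [set x : J P | top && (rkJ x == r i.+1)].
  pose I := [set x : J P | (r i < rkJ x < r i.+1)%N].
  have -> : U = (I :|: B) :|: T.
    apply/setP => x; rewrite !in_setU !in_set.
    by move: (r i) (r i.+1) gap (rkJ x) => p q; case: (bot); case: (top); clear => /=; lia.
  have cB : #|B| = bot.
    rewrite /B; case: (bot) => /=; last by apply: eq_card0 => x; rewrite inE.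
    by rewrite -(card_xi (ltnW si)); apply: eq_card => x; rewrite !inE.
  have cT : #|T| = top.
    rewrite /T; case: (top) => /=; last by apply: eq_card0 => x; rewrite inE.
    by rewrite -(card_xi si); apply: eq_card => x; rewrite !inE.
  rewrite cardsU [X in (_ - X)%N](_ : _ = 0)%N ?subn0; last first.
    apply: eq_card0 => x; rewrite !in_setI !in_setU !in_set [RHS]inE.
    by move: (r i) (r i.+1) gap (rkJ x) => p q; clear; case: bot; case: top => /=; lia.
  rewrite cardsU [X in (_ - X)%N](_ : _ = 0)%N ?subn0; last first.
    apply: eq_card0 => x; rewrite !in_setI !in_set [RHS]inE.
    by move: (r i) (r i.+1) gap (rkJ x) => p q; clear; case: bot => /=; lia.
  by rewrite cB cT card_block_inner.
have sub : {subset enum U <= leads Q} by move=> x; rewrite mem_enum in_set => /cQ.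
have sz : (size (leads Q) <= size (enum U))%N.
  by rewrite size_leads -cardE cU sQ e; clear; lia.
split; first exact: leq_size_uniq (enum_uniq _) sub sz.
have [_ eqU] := uniq_min_size (enum_uniq _) sub sz.
by move=> x; rewrite -eqU mem_enum in_set.
Qed.

Lemma card_below_xi i : (i < s)%N ->
  (forall k, (r i < k < r i.+1)%N -> (#|lev k| <= 3)%N) ->
  #|[set x : J P | (rkJ x <= r i.+1)%N]| =
  (#|[set x : J P | (rkJ x <= r i)%N]| + ((r i.+1 - r i).-1.*2 + th i) + 1)%N.
Proof.
move=> si h; rewrite -(card_block_inner si h) -(card_xi si).
have gap := r_gap si.
pose A := [set x : J P | (rkJ x <= r i)%N].
pose I := [set x : J P | (r i < rkJ x < r i.+1)%N].
rewrite -/A -/I; have -> : [set x : J P | (rkJ x <= r i.+1)%N] = A :|: I :|: lev (r i.+1).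
  apply/setP => x; rewrite !in_setU !in_set.
  by move: (r i) (r i.+1) gap (rkJ x) => p q; clear; lia.
rewrite cardsU [X in (_ - X)%N](_ : _ = 0)%N ?subn0; last first.
  apply: eq_card0 => x; rewrite !in_setI !in_setU !in_set [RHS]inE.
  by move: (r i) (r i.+1) gap (rkJ x) => p q; clear; lia.
rewrite cardsU [X in (_ - X)%N](_ : _ = 0)%N ?subn0 //.
apply: eq_card0 => x; rewrite !in_setI !in_set [RHS]inE.
by move: (r i) (r i.+1) gap (rkJ x) => p q; clear; lia.
Qed.

(** The last clause is the invariant behind a greedy choice: if the current apex is already used,
    some earlier block has theta = 2 and none since has theta = 0. A further block with theta = 2
    then finds its lower apex free by condition (2). *)
Lemma global_cert i : (i <= s)%N ->
  (forall j k, (j < s)%N -> (r j < k < r j.+1)%N -> (#|lev k| <= 3)%N) ->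
  (forall j, (j < s)%N -> (th j <= 2)%N) ->
  (forall j j', (j < j')%N -> (j' < s)%N -> th j = 2 -> th j' = 2 ->
     exists2 k, (j < k < j')%N & th k = 0) ->
  exists Q : seq (quad (J P)),
  [/\ [/\ all rect Q, ordered Q, uniq (leads Q) &
     (size Q + (r i).+1)%N = #|[set x : J P | (rkJ x <= r i)%N]|],
     {in Q, forall q, (rkJ (pivot q) < r i)%N /\
        {in tail q, forall x, (rkJ x <= r i)%N}},
     {in leads Q, forall x, (rkJ x <= r i)%N} &
     xi i \in leads Q -> exists2 j, (j < i)%N & th j = 2 /\
       (forall k, (j < k < i)%N -> th k <> 0)].
Proof.
move=> si h3 h2 h; elim: i si => [|i IH] si.
  have r0 : r 0 = 0 by rewrite /r xi0 rkJ_bot.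
  exists [::]; split=> //; split=> //.
  by rewrite r0 -(card_xi (leq0n s)) r0; apply: eq_card => x; rewrite !inE leqn0.
have [Q [[rQ oQ uQ sQ] bQ lQ hQ]] := IH (ltnW si); have gap := r_gap si.
(* A block with theta = 1 uses its lower apex if this is free, and its upper apex otherwise. *)
have [bot [top [eth nbot ntop]]] : exists bot top : bool, [/\ th i = (bot + top)%N,
    bot -> xi i \notin leads Q &
    top -> exists2 j, (j < i.+1)%N & th j = 2 /\ (forall k, (j < k < i.+1)%N -> th k <> 0)].
  have := h2 i si; case et : (th i) => [|[|[|//]]] _.
  - by exists false, false.
  - have [xQ|xQ] := boolP (xi i \in leads Q); last by exists true, false.
    exists false, true; split=> // _; have [j ji [tj hj]] := hQ xQ.
    exists j; first exact: ltnW.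
    split=> // k /andP[jk]; rewrite ltnS leq_eqVlt => /orP[/eqP->|ki]; first by rewrite et.
    by apply: hj; rewrite jk.
  - exists true, true; split=> // _.
      apply/negP => /hQ[j ji [tj hj]].
      by have [k hk tk] := h j i ji si tj et; apply: (hj k hk).
    by exists i => //; split=> // k; rewrite ltnS; case: ltngtP.
have [Q' [[rQ' oQ' sQ'] bQ' cQ']] := block_cert_block si (h3 i ^~ si) eth.
have [uQ' eQ'] := leads_block si (h3 i ^~ si) eth sQ' cQ'.
exists (Q ++ Q'); split.
- split.
  + by rewrite all_cat rQ.
  + apply/ordered_cat; split=> // q q' /bQ[_ tq] /bQ'[pq' _ _].
    by apply/negP => /tq; case/andP: pq' => lt _; rewrite leqNgt lt.
  + rewrite leads_cat cat_uniq uQ uQ' andbT /=; apply/hasPn => x; rewrite eQ' => hx.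
    apply/negP => xQ; have rx := lQ _ xQ.
    have e : rkJ x = r i by move: hx rx; clear; lia.
    have hbot : bot by move: hx; rewrite e; case: (bot) => //=; clear; lia.
    by move: (nbot hbot); rewrite -(card_lev1 (card_xi (ltnW si)) e (erefl _)) xQ.
  + rewrite size_cat sQ' (card_below_xi si (h3 i ^~ si)) -sQ eth.
    by move: gap; clear; lia.
- move=> q; rewrite mem_cat => /orP[/bQ[h1' h2']|/bQ'[h1' _ h2']].
    split; first by move: h1' gap; clear; lia.
    by move=> x /h2'; move: gap; clear; lia.
  split; first by case/andP: h1'.
  by move=> x /h2' /andP[].
- move=> x; rewrite leads_cat mem_cat => /orP[/lQ|]; first by move: gap; clear; lia.
  by rewrite eQ'; case: (top); clear; lia.
- rewrite leads_cat mem_cat => /orP[/lQ|]; first by rewrite -/(r i.+1); move: gap; clear; lia.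
  rewrite eQ' => /andP[_ ht]; apply: ntop; move: ht; rewrite -/(r i.+1).
  by case: (top) => //; rewrite addn0 ltnn.
Qed.

Lemma konig_of_theta (K : fieldType) :
  (forall j k, (j < s)%N -> (r j < k < r j.+1)%N -> (#|lev k| <= 3)%N) ->
  (forall j, (j < s)%N -> (th j <= 2)%N) ->
  (forall j j', (j < j')%N -> (j' < s)%N -> th j = 2 -> th j' = 2 ->
     exists2 k, (j < k < j')%N & th k = 0) ->
  konig_type K (J P).
Proof.
move=> h3 h2 h.
have [Q [[rQ oQ uQ sQ] _ _ _]] := global_cert (leqnn s) h3 h2 h.
apply: konig_of_quads rQ oQ uQ _.
rewrite dim_setT -(addnK #|P|.+1 (size Q)); congr (_ - _)%N.
move: sQ; rewrite /r xis rkJ_top => ->; apply: eq_card => x; rewrite inE -rkJ_top.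
by rewrite (rk_le gr) // lex1.
Qed.

(** * Necessity: the size of an interval between two apexes *)

Section Forward.

Context (Q : seq (quad (J P))) (le : rel 'X_{1..#|{: J P}|}) (mo : monomial_order le).
Hypotheses (rQ : all rect Q) (uQ : uniq (leads Q)).
Hypothesis lQ : {in Q, forall q, le (tail_mon q) (lead_mon q)}.
Hypothesis sQ : size Q = (#|{: J P}| - (Defs.dim [set: J P]).+1)%N.

Let inside x y (q : quad (J P)) := all (mem (itv x y)) (lead q ++ tail q).

(** [quads_bound] is applied with C a maximal chain of [x, y], which has rk y - rk x + 1
    elements. *)
Lemma count_inside x y : x <= y ->
  (count (inside x y) Q + (rkJ y - rkJ x).+1 <= #|itv x y|)%N.
Proof.
move=> xy; have [C [sC cC hC]] := exists_separated xy.
rewrite -cC -(cardsID C (itv x y)) addnC (setIidPr sC) leq_add2l -size_filter.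
have sub : {subset [seq q <- Q | inside x y q] <= Q} by move=> q; rewrite mem_filter => /andP[].
apply: (quads_bound mo _ _ _ hC).
- by apply/allP => q /sub/(allP rQ).
- exact: uniq_leads_filter.
- by move=> q /sub/lQ.
- move=> q; rewrite mem_filter => /andP[/allP hq _].
  by split=> a ha; apply: hq; rewrite mem_cat ha ?orbT.
Qed.

Lemma inside_meet_join x y a b c d : meet_join a b c d ->
  x <= a `&` b -> a `|` b <= y -> all (mem (itv x y)) [:: a; b; c; d].
Proof.
case/andP=> _ h xm my; have /andP[xa xb] : (x <= a) && (x <= b) by rewrite -lexI.
have /andP[ay yb] : (a <= y) && (b <= y) by rewrite -leUx.
have mj := le_meet_join a b.
by apply/allP => e; rewrite !inE; move: h; rewrite !inE => /orP[]/eqP[-> ->] /or4P[]/eqP->;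
  rewrite ?xa ?xb ?ay ?yb ?xm ?my ?(le_trans mj my) ?(le_trans xm mj).
Qed.

Lemma inside_rect q : rect q -> exists a b, [/\ a >< b &
  forall x y, x <= a `&` b -> a `|` b <= y -> inside x y q].
Proof.
case: q => [[p v] [a b]]; rewrite /rect /= => /orP[] h.
  by exists p, v; split; [case/andP: h|move=> x y; exact: inside_meet_join].
exists a, b; split; first by case/andP: h.
move=> x y xm my; have /= := inside_meet_join h xm my.
by rewrite /inside /= => /and5P[-> -> -> -> _].
Qed.

Lemma apex_meet_join x a b : apex [set: J P] x -> a >< b ->
  x <= a `&` b \/ a `|` b <= x.
Proof.
move=> /apexP ax ab; have /orP[xa|xa] := ax a; have /orP[xb|xb] := ax b.
- by left; rewrite lexI xa.
- by move: ab; rewrite ge_comparable // (le_trans xb).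
- by move: ab; rewrite le_comparable // (le_trans xa).
- by right; rewrite leUx xa.
Qed.

(** Every quad lies in [0, x], [x, y] or [y, 1]. The three bounds of [count_inside] add up to (|L| +
    2) - (|P| + 3), the number of quads, so [x, y] contains at least as many quads as its own bound.
    Their leads are disjoint and lie in [x, y]. *)
Lemma card_itv_apex x y : apex [set: J P] x -> apex [set: J P] y -> x <= y ->
  (#|itv x y| <= (rkJ y - rkJ x).*2 + 2)%N.
Proof.
move=> ax ay xy.
have cover : (size Q <= count (inside \bot x) Q + count (inside x y) Q +
    count (inside y \top) Q)%N.
  have all3 : all (predU (predU (inside \bot x) (inside x y)) (inside y \top)) Q.
    apply/allP => q /(allP rQ)/inside_rect[a [b [ab h]]] /=.
    have [xm|mx] := apex_meet_join ax ab; last by rewrite h ?le0x.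
    have [ym|my] := apex_meet_join ay ab; last by rewrite orbAC orbC h.
    by rewrite orbC h ?lex1.
  move: all3; rewrite all_count => /eqP <-.
  have cU p1 p2 : (count (predU p1 p2) Q <= count p1 Q + count p2 Q)%N.
    by rewrite -count_predUI leq_addr.
  by apply: leq_trans (cU _ _) _; rewrite leq_add2r.
have c1 := count_inside (le0x x); have c2 := count_inside xy.
have c3 := count_inside (lex1 y).
have d1 := card_itv_cat ax (le0x x) (lex1 x).
have d2 := card_itv_cat ay xy (lex1 y).
have sz : ((count (inside x y) Q).*2 <= #|itv x y|)%N.
  rewrite -size_filter -size_leads; have uF := uniq_leads_filter (inside x y) uQ.
  rewrite -(card_uniqP uF); apply/subset_leq_card/subsetP => a /leadsP[q].
  rewrite mem_filter => /andP[/allP hq _] aq; apply: hq.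
  by rewrite mem_cat aq.
have rx := rk_le gr (lex1 y); have rxy := rk_le gr xy.
have cT : #|itv (\bot : J P) \top| = #|{: J P}| by rewrite itvT cardsT.
move: sQ; rewrite dim_setT -cT -rkJ_top.
move: c1; rewrite rkJ_bot subn0.
have arithm A1 A2 A3 A4 T c c' c'' n u v w : (u <= v -> v <= w ->
  T + 1 = A1 + A4 -> A4 + 1 = A2 + A3 -> c.*2 <= A2 -> n <= c' + c + c'' ->
  c + (v - u).+1 <= A2 -> c'' + (w - v).+1 <= A3 -> c' + u.+1 <= A1 -> n = T - w.+1 ->
  A2 <= (v - u).*2 + 2)%N by lia.
exact: arithm rxy rx d1 d2 sz cover c2 c3.
Qed.

End Forward.

Lemma konig_small (K : fieldType) : konig_type K (J P) -> forall i j, (i <= j <= s)%N ->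
  (#|itv (xi i) (xi j)| <= (r j - r i).*2 + 2)%N.
Proof.
move=> /quads_of_konig[Q [le [mo rQ uQ lQ sQ]]] i j /andP[ij js].
apply: (card_itv_apex mo rQ uQ lQ sQ).
- exact: (apex_xi (leq_trans ij js)).
- exact: (apex_xi js).
move: ij; rewrite leq_eqVlt => /orP[/eqP->//|ij].
by apply/ltW/(xi_mono); rewrite ij.
Qed.

(** * Necessity: conditions (1) and (2) from the size inequality *)

Section Small.

Hypothesis small : forall i j, (i <= j <= s)%N ->
  (#|itv (xi i) (xi j)| <= (r j - r i).*2 + 2)%N.

Lemma card_block i : (i < s)%N ->
  #|block i| = (#|[set x : J P | (r i < rkJ x < r i.+1)%N]| + 2)%N.
Proof.
move=> si; have gap := r_gap si.
have -> : block i = xi i |: (xi i.+1 |: [set x : J P | (r i < rkJ x < r i.+1)%N]).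
  apply/setP => x; rewrite (mem_block x si) !in_setU1 in_set.
  apply/andP/idP => [[]|/or3P[/eqP->|/eqP->|/andP[h1 h2]]]; last 3 first.
  - by split=> //; move: gap; rewrite /r; clear; lia.
  - by split=> //; move: gap; rewrite /r; clear; lia.
  - by rewrite ltnW // ltnW.
  rewrite leq_eqVlt => /orP[/eqP e _|h].
    by rewrite (card_lev1 (card_xi (ltnW si)) (esym e) (erefl _)) eqxx.
  rewrite leq_eqVlt => /orP[/eqP e|h'].
    by rewrite (card_lev1 (card_xi si) e (erefl _)) eqxx orbT.
  by rewrite /r h h' !orbT.
rewrite !cardsU1 !inE !negb_or !ltnn andbF /= !andbT.
have -> : xi i != xi i.+1 by rewrite lt_eqF // xi_lt.
by rewrite addn2.
Qed.

(** Inner levels have at least two elements, and by [small] their excess over two is at most 2 in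
    total. A level with four elements takes all of it, so its neighbours have at most two, against
    [card_lev_le3]. *)
Lemma card_inner_le3 i k : (i < s)%N -> (r i < k < r i.+1)%N -> (#|lev k| <= 3)%N.
Proof.
move=> si hk; have gap : ((r i).+1 < r i.+1)%N := r_gap si.
have ge2 l : (r i < l < r i.+1)%N -> (2 <= #|lev l|)%N.
  exact: (card_inner_ge2 si).
have : (#|block i| <= (r i.+1 - r i).*2 + 2)%N by apply: small; rewrite leqnSn.
rewrite (card_block si); set n := (r i.+1 - r i).-1.
have e : r i.+1 = (r i + n.+1)%N by rewrite /n; move: gap; clear; lia.
rewrite {1}e (card_between (@rkJ disp P)) => sum.
rewrite leqNgt; apply/negP => c4.
have mem l : (l \in iota (r i).+1 n) = (r i < l < r i.+1)%N.
  by rewrite mem_iota; move: gap; rewrite /n; clear; lia.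
have le2 l : (r i <= l <= r i.+1)%N -> l != k -> (#|lev l| <= 2)%N.
  move=> hl lk; have [->|nl] := eqVneq l (r i); first by rewrite (card_xi) // ltnW.
  have [->|nl'] := eqVneq l (r i.+1); first by rewrite (card_xi).
  have hl' : (r i < l < r i.+1)%N by move: hl nl nl'; clear; lia.
  have := @leq_add_sum_seq (fun l => #|lev l|) (iota (r i).+1 n) k l.
  rewrite !mem size_iota eq_sym => /(_ _ hk hl' lk) h.
  have {}h := h (fun m hm => ge2 m (etrans (esym (mem m)) hm)).
  have arithm c c' S D : (c + c' + n.*2 <= S + 4 -> S + 2 <= D.*2 + 2 -> D <= n.+1 ->
    3 < c -> c' <= 2)%N by clear; lia.
  by apply: arithm h sum _ c4; rewrite /n; clear; lia.
have bk : (rkJ (\bot : J P) < k)%N by rewrite rkJ_bot; move: hk; clear; lia.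
move: c4; rewrite ltnNge => /negP; apply; apply: (card_lev_le3 gr bk).
  by apply: le2; move: hk; clear; lia.
by apply: le2; move: hk; clear; lia.
Qed.

Lemma card_block_theta i : (i < s)%N -> #|block i| = ((r i.+1 - r i).*2 + th i)%N.
Proof.
move=> si; have gap : ((r i).+1 < r i.+1)%N := r_gap si.
rewrite (card_block si) (card_block_inner si); last first.
  by move=> k; exact: card_inner_le3.
have arithm m M t : (m.+1 < M -> (M - m).-1.*2 + t + 2 = (M - m).*2 + t)%N by lia.
exact: arithm gap.
Qed.

Lemma theta_le2 i : (i < s)%N -> (th i <= 2)%N.
Proof.
move=> si; have : (#|block i| <= (r i.+1 - r i).*2 + 2)%N by apply: small; rewrite leqnSn.
by rewrite (card_block_theta si) leq_add2l.
Qed.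

Lemma card_itv_block i j : (i < j < s)%N ->
  (#|itv (xi i) (xi j.+1)| + 1)%N =
  (#|itv (xi i) (xi j)| + ((r j.+1 - r j).*2 + th j))%N.
Proof.
move=> /andP[ij js]; rewrite -(card_block_theta js); apply: card_itv_cat.
- exact: (apex_xi (ltnW js)).
- by apply/ltW/(xi_mono); rewrite ij ltnW.
- exact/ltW/xi_lt.
Qed.

(** The excess of the number of elements over twice the length is 2 for block i. Each further block
    adds its theta and loses one for the shared apex, so the excess does not drop while theta is at
    least 1. *)
Lemma card_itv_theta i j : (i < j)%N -> (j <= s)%N -> th i = 2 ->
  (forall k, (i < k < j)%N -> th k <> 0) ->
  ((r j - r i).*2 + 2 <= #|itv (xi i) (xi j)|)%N.
Proof.
elim: j => // j IH; rewrite ltnS leq_eqVlt => /orP[/eqP->|ij] js ti hk.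
  by rewrite (card_block_theta js) -ti.
have {}IH : ((r j - r i).*2 + 2 <= #|itv (xi i) (xi j)|)%N.
  apply: IH => //; first exact: ltnW.
  by move=> k /andP[ik kj]; apply: hk; rewrite ik ltnW.
have tj : th j <> 0 by apply: hk; rewrite ij ltnSn.
have rij : (r i < r j)%N by apply: (r_mono); rewrite ij ltnW.
have gap : (r j < r j.+1)%N by apply: (r_mono); rewrite ltnSn.
have ijs : (i < j < s)%N by rewrite ij.
have arithm c c' t u v w : (c + 1 = c' + ((w - v).*2 + t) -> u < v -> v < w -> t <> 0 ->
  (v - u).*2 + 2 <= c' -> (w - u).*2 + 2 <= c)%N by clear; lia.
exact: arithm (card_itv_block ijs) rij gap tj IH.
Qed.

(** Otherwise block j would raise the excess from at least 2 to at least 2 + 2 - 1 = 3, while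
    [small] allows 2. *)
Lemma theta_separated i j : (i < j)%N -> (j < s)%N -> th i = 2 -> th j = 2 ->
  exists2 k, (i < k < j)%N & th k = 0.
Proof.
move=> ij js ti tj.
have [/hasP[k]|/hasPn h] := boolP (has (fun k => th k == 0) (iota i.+1 (j - i.+1))).
  by rewrite mem_iota => hk /eqP tk; exists k => //; move: hk; clear; lia.
exfalso; have {}h k : (i < k < j)%N -> th k <> 0.
  by move=> hk; apply/eqP/h; rewrite mem_iota; move: hk; clear; lia.
have c := card_itv_theta ij (ltnW js) ti h.
have ijs : (i < j < s)%N by rewrite ij.
have := small (_ : i <= j.+1 <= s)%N; rewrite js leqW ?(ltnW ij) // => /(_ isT) c'.
have rij : (r i < r j)%N by apply: (r_mono); rewrite ij ltnW.
have gap : (r j < r j.+1)%N by apply: (r_mono); rewrite ltnSn.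
have arithm c1 c2 t u v w : (c1 + 1 = c2 + ((w - v).*2 + t) -> u < v -> v < w -> t = 2 ->
  (v - u).*2 + 2 <= c2 -> ~ (c1 <= (w - u).*2 + 2))%N by clear; lia.
exact: arithm (card_itv_block ijs) rij gap tj c c'.
Qed.

End Small.

End Apexes.

Unset Implicit Arguments.
Set Strict Implicit.
Set Printing Implicit Defensive.

Theorem theorem4p1 (disp : Order.disp_t) (P : finPOrderType disp)
    (K : fieldType) (s : nat) (xi : nat -> J P) :
  (2 <= #|P|)%N ->
  ~ decomposable (J P) ->
  xi 0%N = \bot ->
  xi s = \top ->
  (forall i, (i < s)%N -> xi i < xi i.+1) ->
  (forall a : J P, apex [set: J P] a <-> exists2 i, (i <= s)%N & a = xi i) ->
  let Li := fun i : nat => itv (xi i.-1) (xi i) in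
  konig_type K (J P) <->
    (forall i, (1 <= i <= s)%N -> quasi_thin (Li i) /\ (theta (Li i) <= 2)%N) /\
    (forall i i', (1 <= i)%N -> (i < i')%N -> (i' <= s)%N ->
       theta (Li i) = 2%N -> theta (Li i') = 2%N ->
       exists2 j, (i < j < i')%N & theta (Li j) = 0%N).
Proof.
move=> _ hd xi0 xis xi_lt xiP Li; split=> [hK|[h1 h2]].
  have small := konig_small xi_lt xiP hK; split=> [[//|i] /= si|].
    split; last exact: (theta_le2 hd xi_lt xiP small si).
    by apply/(quasi_thin_block hd xi_lt xiP si) => k; exact: (card_inner_le3 hd xi_lt xiP small si).
  move=> [//|i] [//|j] _ ij js ti tj.
  have [k kij tk] := theta_separated hd xi_lt xiP small (i := i) (j := j) ij js ti tj.
  by exists k.+1.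
apply: (konig_of_theta hd xi0 xis xi_lt xiP K).
- by move=> i k si; have [/(quasi_thin_block hd xi_lt xiP si) h _] := h1 i.+1 si; exact: h.
- by move=> i si; have [] := h1 i.+1 si.
- move=> i j ij js ti tj; have [[//|k] kij tk] := h2 i.+1 j.+1 isT ij js ti tj.
  by exists k.
Qed.
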